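(* Let $p\in\left(0,1-\frac{\sqrt{2}}{2}\right]$. For $f\in Co(p)$ write $f(z)=\sum_{n=-1}^{\infty}a_n(f)(z-p)^n$ for $0<|z-p|<1-p$. Then the domain of variability $\{a_1(f): f\in Co(p)\}$ of $a_1(f)$ is determined by the inequality $$\left|a_1(f)\left(\frac{1-p^2}{p}\right)^2+\frac{p^2}{1-p^4}\right|\ \leq\ \frac{1}{1-p^4},$$ that is, it is exactly the set of all $w\in\mathbb{C}$ that satisfy this inequality with $w$ in place of $a_1(f)$. Moreover, for $f\in Co(p)$, equality is attained in this inequality if and only if there is some $\theta\in[0,2\pi]$ such that $$f(z)=\frac{z-\frac{p}{1+p^2}\left(1+e^{i\theta}\right)z^2}{\left(1-\frac{z}{p}\right)(1-zp)},\qquad z\in\mathbb{D}.$$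
   Context: $\mathbb{D}=\{z\in\mathbb{C}:|z|<1\}$ is the open unit disc and $\overline{\mathbb{C}}$ is the Riemann sphere. For $p\in(0,1)$, $Co(p)$ denotes the family of functions $f:\mathbb{D}\to\overline{\mathbb{C}}$ such that: (i) $f$ is meromorphic in $\mathbb{D}$ and has a simple pole at the point $p$; (ii) $f(0)=f'(0)-1=0$; (iii) $f$ maps $\mathbb{D}$ conformally (in particular injectively) onto a set whose complement with respect to $\overline{\mathbb{C}}$ is convex. For $f\in Co(p)$, the numbers $a_n(f)$, $n\geq -1$, are the Laurent coefficients of $f$ at the point $p$. *)

(* Defs.v *)
From Stdlib Require Import Reals ZArith ClassicalEpsilon.
From Coquelicot Require Import Coquelicot.

Open Scope R_scope.

Definition unit_disc (z : C) : Prop := Cmod z < 1.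

(* The Riemann sphere: [None] is the point at infinity. *)
Definition sphere : Type := option C.

(* a / b as a point of the sphere, with a / 0 = infinity.
   It is meaningful only when a and b are not both 0. *)
Definition sphere_div (a b : C) : sphere :=
  if Ceq_dec b 0 then None else Some (a / b)%C.

Definition C_differentiable_at (g : C -> C) (z : C) : Prop :=
  ex_derive (K := C_AbsRing) (V := C_NormedModule) g z.

Definition holomorphic_at (f : C -> sphere) (z0 : C) : Prop :=
  exists (g : C -> C) (r : R), 0 < r /\
    forall z : C, Cmod (z - z0) < r ->
      C_differentiable_at g z /\ f z = Some (g z).

(* A pole of order m >= 1: f = g / (z - z0)^m near z0, with g holomorphic near
   z0 and g z0 <> 0. *)
Definition pole_at (m : nat) (f : C -> sphere) (z0 : C) : Prop :=
  (1 <= m)%nat /\ f z0 = None /\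
  exists (g : C -> C) (r : R), 0 < r /\ g z0 <> 0 /\
    forall z : C, Cmod (z - z0) < r ->
      C_differentiable_at g z /\
      (z <> z0 -> f z = Some (g z / (z - z0) ^ m)%C).

(* Functions on the disc are represented by functions on C whose values outside
   the disc are irrelevant; the disc being open, the radii above may be
   shrunk. *)
Definition meromorphic_on_disc (f : C -> sphere) : Prop :=
  forall z : C, unit_disc z ->
    holomorphic_at f z \/ exists m : nat, pole_at m f z.

(* The finite part is used below at points where f is finite only. *)
Definition finite_part (f : C -> sphere) (z : C) : C :=
  match f z with Some w => w | None => 0 end.

Definition injective_on_disc (f : C -> sphere) : Prop :=
  forall z w : C, unit_disc z -> unit_disc w -> f z = f w -> z = w.

Definition image_of_disc (f : C -> sphere) (w : sphere) : Prop :=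
  exists z : C, unit_disc z /\ f z = w.

Definition convex_C (K : C -> Prop) : Prop :=
  forall (u v : C) (t : R), K u -> K v -> 0 <= t <= 1 ->
    K (t * u + (1 - t) * v)%C.

(* A subset of the sphere is convex when it is a convex set of (finite)
   complex numbers. *)
Definition convex_sphere (E : sphere -> Prop) : Prop :=
  exists K : C -> Prop, convex_C K /\
    forall w : sphere, E w <-> exists u : C, K u /\ w = Some u.

(* A meromorphic map is conformal onto its image exactly when it is injective:
   injectivity forces f' <> 0 at finite points and simplicity of the pole. *)
Definition Co (p : R) (f : C -> sphere) : Prop :=
  meromorphic_on_disc f /\
  pole_at 1 f p /\
  f 0 = Some (RtoC 0) /\
  is_derive (K := C_AbsRing) (V := C_NormedModule)
    (finite_part f) (RtoC 0) (RtoC 1) /\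
  injective_on_disc f /\
  convex_sphere (fun w => ~ image_of_disc f w).

(* a is the sequence of Laurent coefficients of f at p, for a pole of order at
   most 1: f z = \sum_(n >= -1) a n (z - p)^n for 0 < |z - p| < 1 - p. *)
Definition is_laurent (p : R) (f : C -> sphere) (a : Z -> C) : Prop :=
  (forall n : Z, (n < -1)%Z -> a n = 0) /\
  forall z : C, 0 < Cmod (z - p) < 1 - p ->
    exists s : C,
      is_pseries (K := C_AbsRing) (V := C_NormedModule)
        (fun n : nat => a (Z.of_nat n)) (z - p)%C s /\
      f z = Some (a (-1)%Z / (z - p) + s)%C.

(* a_n(f): by choice, since the coefficients are determined by f whenever an
   expansion exists. *)
Definition laurent_coeff (p : R) (f : C -> sphere) (n : Z) : C :=
  epsilon (inhabits (fun _ : Z => RtoC 0)) (is_laurent p f) n.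

Definition Cexpi (theta : R) : C := (cos theta, sin theta).

(* Main.v *)
Require Import Defs.
From Stdlib Require Import Reals ZArith Lra Lia Classical ClassicalEpsilon.
From Coquelicot Require Import Coquelicot.

Open Scope R_scope.

(** A Moebius transformation moves the pole to the origin; a function of the
    class becomes [F z = N z / z], with [N] holomorphic in the disc and
    [a = N 0] different from 0. Put [x = N'' 0 / (2 a)], the quotient of the
    Laurent coefficients of [F] of orders 1 and -1, and
    [H = - p^2 F' (- p) / a = (N (- p) + p N' (- p)) / a]. The normalization at
    the point that corresponds to [- p] turns [a_1 ((1 - p^2) / p)^2] into
    [- x / H], and the inequality to be proved into [|x| <= |H + p^2 x|].

    Convexity of the complement means that [Re (- 1 - z F'' / F') >= 0]
    ([concave_inequality]). The Cayley transform of this function has a double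
    zero at the origin, because [F'] has no residue; it is [z^2 chi] with [chi]
    bounded by 1 and [chi 0 = x] ([concave_schwarz_function]). If [chi] is
    constant then [N - z N' = a (1 - x z^2)], so that [H + p^2 x = 1] and the
    inequality reads [|x| <= 1]. In general the Schwarz-Pick lemma bounds
    [chi - x] by a multiple of [1 - |x|]; integrating the differential equation
    that expresses [N - z N'] through [chi] from [0] to [- p] gives
    [|H + p^2 x - 1| <= (3/5) (1 - |x|)] as soon as [p <= 3/10], hence the
    inequality, with equality only for [|x| = 1]. Then [chi] is constant and [N]
    is a quadratic polynomial ([concave_coefficient_inequality]).

    The differential inequality is the infinitesimal form of the fact that the
    images of smaller concentric discs also have convex complements
    ([midpoint_not_inside]). The boundary values of [F] need not exist; what is
    used is that [F z] approaches the omitted set as [z] approaches the unit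
    circle, and the maximum modulus principle.

    Conversely, let [c] be a constant of modulus at most 1 in place of
    [exp (i theta)] in the extremal functions. The unit circle is then mapped
    to an ellipse, degenerate when [|c| = 1], and the function belongs to the
    class ([ellipse_map_Co]). Its coefficient is an affine function of [c],
    which sweeps out the whole disc ([ellipse_map_coeff]).

    Complex differentiability alone is assumed of the functions. Goursat's
    theorem for rectangles, applied in the coordinate [log z], shows that
    integrals over concentric circles agree; Cauchy's formula, removable
    singularities, Taylor series and the maximum modulus principle follow. *)

(** * Continuity and complex differentiability *)

Lemma Cmod_sub_sym (a b : C) : Cmod (a - b) = Cmod (b - a).
Proof. rewrite <- (Cmod_opp (b - a)). f_equal. ring. Qed.

Lemma Cmod_sub_triangle (a b c : C) : Cmod (a - c) <= Cmod (a - b) + Cmod (b - c).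
Proof. replace (a - c)%C with ((a - b) + (b - c))%C by ring. apply Cmod_triangle. Qed.

Lemma Cmod_triangle_rev (a b : C) : Cmod a - Cmod b <= Cmod (a - b).
Proof.
  assert (H := Cmod_triangle (a - b) b).
  replace (a - b + b)%C with a in H by ring. lra.
Qed.

Lemma Cmod_triangle_sub (a b : C) : Cmod (a - b) <= Cmod a + Cmod b.
Proof. rewrite <- (Cmod_opp b). apply Cmod_triangle. Qed.

Lemma Cmod_pos_neq (a : C) : 0 < Cmod a -> a <> 0.
Proof. intros H E. rewrite E, Cmod_0 in H. lra. Qed.

Lemma Cmod_diff_neq (a b : C) : a <> b -> 0 < Cmod (a - b).
Proof.
  intros H. apply Cmod_gt_0. intros E. apply H.
  replace a with (a - b + b)%C by ring. rewrite E. ring.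
Qed.

Lemma Csub_neq_0 (a b : C) : a <> b -> (a - b)%C <> 0.
Proof. intros H. apply Cmod_pos_neq, Cmod_diff_neq, H. Qed.

Lemma Cmod_sub_diag (z : C) : Cmod (z - z) = 0.
Proof. replace (z - z)%C with (RtoC 0) by ring. apply Cmod_0. Qed.

Lemma RtoC_pos_neq (x : R) : 0 < x -> RtoC x <> RtoC 0.
Proof. intros H. apply Cmod_pos_neq. rewrite Cmod_R, Rabs_pos_eq; lra. Qed.

Lemma Cmod_le_2Rmax (z : C) : Cmod z <= 2 * Rmax (Rabs (fst z)) (Rabs (snd z)).
Proof.
  eapply Rle_trans; [apply Cmod_2Rmax|]. apply Rmult_le_compat_r.
  - eapply Rle_trans; [apply Rabs_pos|apply Rmax_l].
  - rewrite <- (sqrt_Rsqr 2) at 2 by lra. apply sqrt_le_1; unfold Rsqr; lra.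
Qed.

Definition ccont (g : C -> C) (z : C) : Prop :=
  forall eps, 0 < eps -> exists del, 0 < del /\
    forall y, Cmod (y - z) < del -> Cmod (g y - g z) < eps.

(** Carathéodory's form of the derivative: the calculus rules then reduce to
    the continuity of sums, products and compositions. *)
Definition cderiv (g : C -> C) (z l : C) : Prop :=
  exists phi : C -> C, ccont phi z /\ phi z = l /\
    forall y, g y = (g z + phi y * (y - z))%C.

Definition cdiff (g : C -> C) (z : C) : Prop := exists l, cderiv g z l.

Lemma ccont_const (c z : C) : ccont (fun _ => c) z.
Proof.
  intros e He. exists 1. split; [lra|]. intros y _.
  rewrite Cmod_sub_diag. exact He.
Qed.

Lemma ccont_id (z : C) : ccont (fun y => y) z.
Proof. intros e He. exists e. auto. Qed.

Lemma ccont_ext_near (g h : C -> C) (z : C) (d : R) :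
  0 < d -> (forall y, Cmod (y - z) < d -> g y = h y) -> ccont g z -> ccont h z.
Proof.
  intros Hd E Hg e He. destruct (Hg e He) as [d1 [Hd1 H1]].
  exists (Rmin d d1). split; [now apply Rmin_glb_lt|]. intros y Hy.
  assert (Ez : g z = h z).
  { apply E. rewrite Cmod_sub_diag. exact Hd. }
  rewrite <- (E y), <- Ez.
  - apply H1. eapply Rlt_le_trans; [exact Hy|apply Rmin_r].
  - eapply Rlt_le_trans; [exact Hy|apply Rmin_l].
Qed.

Lemma ccont_ext (g h : C -> C) (z : C) :
  (forall y, g y = h y) -> ccont g z -> ccont h z.
Proof. intros E. apply ccont_ext_near with 1; [lra|]. auto. Qed.

Lemma ccont_plus (g h : C -> C) (z : C) :
  ccont g z -> ccont h z -> ccont (fun y => g y + h y)%C z.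
Proof.
  intros Hg Hh e He.
  destruct (Hg (e/2)) as [d1 [Hd1 H1]]; [lra|].
  destruct (Hh (e/2)) as [d2 [Hd2 H2]]; [lra|].
  exists (Rmin d1 d2). split; [now apply Rmin_glb_lt|]. intros y Hy.
  assert (A1 := H1 y (Rlt_le_trans _ _ _ Hy (Rmin_l _ _))).
  assert (A2 := H2 y (Rlt_le_trans _ _ _ Hy (Rmin_r _ _))).
  replace (g y + h y - (g z + h z))%C with ((g y - g z) + (h y - h z))%C by ring.
  eapply Rle_lt_trans; [apply Cmod_triangle|]. lra.
Qed.

Lemma ccont_mult (g h : C -> C) (z : C) :
  ccont g z -> ccont h z -> ccont (fun y => g y * h y)%C z.
Proof.
  intros Hg Hh e He.
  set (A := Cmod (g z)). set (B := Cmod (h z)).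
  assert (HA : 0 <= A) by apply Cmod_ge_0.
  assert (HB : 0 <= B) by apply Cmod_ge_0.
  set (m := Rmin 1 (e / (A + B + 1))).
  assert (Hm : 0 < m).
  { apply Rmin_glb_lt; [lra|]. apply Rdiv_lt_0_compat; lra. }
  destruct (Hg m Hm) as [d1 [Hd1 H1]].
  destruct (Hh m Hm) as [d2 [Hd2 H2]].
  exists (Rmin d1 d2). split; [now apply Rmin_glb_lt|]. intros y Hy.
  assert (A1 := H1 y (Rlt_le_trans _ _ _ Hy (Rmin_l _ _))).
  assert (A2 := H2 y (Rlt_le_trans _ _ _ Hy (Rmin_r _ _))).
  replace (g y * h y - g z * h z)%C
    with ((g y - g z) * (h y - h z) + g z * (h y - h z) + h z * (g y - g z))%C by ring.
  eapply Rle_lt_trans; [apply Cmod_triangle|].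
  eapply Rle_lt_trans; [apply Rplus_le_compat_r, Cmod_triangle|].
  rewrite !Cmod_mult. fold A B.
  set (u := Cmod (g y - g z)) in *. set (v := Cmod (h y - h z)) in *.
  assert (0 <= u) by apply Cmod_ge_0. assert (0 <= v) by apply Cmod_ge_0.
  assert (M1 : m <= 1) by apply Rmin_l.
  assert (M2 : m * (A + B + 1) <= e).
  { assert (m <= e / (A + B + 1)) by apply Rmin_r.
    apply (Rmult_le_compat_r (A + B + 1)) in H3; [|lra].
    replace (e / (A + B + 1) * (A + B + 1)) with e in H3 by (field; lra). exact H3. }
  assert (u * v < m) by nra.
  nra.
Qed.

Lemma ccont_opp (g : C -> C) (z : C) : ccont g z -> ccont (fun y => - g y)%C z.
Proof.
  intros H. apply (ccont_ext (fun y => (-1) * g y)%C); [intros; ring|].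
  apply ccont_mult; [apply ccont_const|exact H].
Qed.

Lemma ccont_minus (g h : C -> C) (z : C) :
  ccont g z -> ccont h z -> ccont (fun y => g y - h y)%C z.
Proof. intros Hg Hh. apply ccont_plus; [exact Hg|now apply ccont_opp]. Qed.

Lemma ccont_comp (g h : C -> C) (z : C) :
  ccont h z -> ccont g (h z) -> ccont (fun y => g (h y)) z.
Proof.
  intros Hh Hg e He. destruct (Hg e He) as [d1 [Hd1 H1]].
  destruct (Hh d1 Hd1) as [d2 [Hd2 H2]]. exists d2. auto.
Qed.

Lemma ccont_lower (g : C -> C) (z : C) :
  ccont g z -> g z <> 0 ->
  exists d, 0 < d /\ forall y, Cmod (y - z) < d -> Cmod (g z) / 2 < Cmod (g y).
Proof.
  intros Hg Hz. apply Cmod_gt_0 in Hz.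
  destruct (Hg (Cmod (g z) / 2)) as [d [Hd H]]; [lra|].
  exists d. split; [exact Hd|]. intros y Hy. specialize (H y Hy).
  assert (T := Cmod_triangle_rev (g z) (g y)).
  rewrite Cmod_sub_sym in T. lra.
Qed.

Lemma ccont_inv (g : C -> C) (z : C) :
  ccont g z -> g z <> 0 -> ccont (fun y => / g y)%C z.
Proof.
  intros Hg Hz e He.
  destruct (ccont_lower g z Hg Hz) as [d0 [Hd0 H0]].
  assert (HA := proj1 (Cmod_gt_0 _) Hz). set (A := Cmod (g z)) in *.
  destruct (Hg (e * A * A / 2)) as [d1 [Hd1 H1]].
  { assert (0 < e * A) by nra. assert (0 < e * A * A) by nra. lra. }
  exists (Rmin d0 d1). split; [now apply Rmin_glb_lt|]. intros y Hy.
  assert (A0 := H0 y (Rlt_le_trans _ _ _ Hy (Rmin_l _ _))).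
  assert (A1 := H1 y (Rlt_le_trans _ _ _ Hy (Rmin_r _ _))).
  assert (Hgy : g y <> 0) by (apply Cmod_pos_neq; lra).
  replace (/ g y - / g z)%C with (- (g y - g z) / (g y * g z))%C by (field; auto).
  rewrite Cmod_div by (apply Cmult_neq_0; auto).
  rewrite Cmod_opp, Cmod_mult. fold A.
  set (B := Cmod (g y)) in *.
  apply Rmult_lt_reg_r with (B * A); [nra|].
  unfold Rdiv. rewrite Rmult_assoc, Rinv_l, Rmult_1_r by nra.
  eapply Rlt_trans; [exact A1|]. assert (0 < e * A) by nra. nra.
Qed.

Lemma ccont_div (g h : C -> C) (z : C) :
  ccont g z -> ccont h z -> h z <> 0 -> ccont (fun y => g y / h y)%C z.
Proof. intros Hg Hh Hz. apply ccont_mult; [exact Hg|now apply ccont_inv]. Qed.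

Lemma cderiv_cont (g : C -> C) (z l : C) : cderiv g z l -> ccont g z.
Proof.
  intros [phi [Hp [_ H]]].
  apply (ccont_ext (fun y => g z + phi y * (y - z))%C); [intros; symmetry; apply H|].
  apply ccont_plus; [apply ccont_const|].
  apply ccont_mult; [exact Hp|].
  apply ccont_minus; [apply ccont_id|apply ccont_const].
Qed.

Lemma cdiff_cont (g : C -> C) (z : C) : cdiff g z -> ccont g z.
Proof. intros [l H]. exact (cderiv_cont _ _ _ H). Qed.

Lemma cderiv_eq (g : C -> C) (z l m : C) : l = m -> cderiv g z l -> cderiv g z m.
Proof. now intros ->. Qed.

(** Away from [z] the quotient is forced to be the difference quotient, so a
    factorization near [z] suffices. *)
Lemma cderiv_near (g phi : C -> C) (z l : C) (d : R) :
  0 < d -> ccont phi z -> phi z = l ->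
  (forall y, Cmod (y - z) < d -> g y = (g z + phi y * (y - z))%C) -> cderiv g z l.
Proof.
  intros Hd Hp El H.
  exists (fun y => if Rlt_dec (Cmod (y - z)) d then phi y
                   else ((g y - g z) / (y - z))%C).
  split; [|split].
  - apply ccont_ext_near with phi d; [exact Hd| |exact Hp].
    intros y Hy. destruct (Rlt_dec (Cmod (y - z)) d); [reflexivity|contradiction].
  - destruct (Rlt_dec (Cmod (z - z)) d) as [_|n]; [exact El|].
    exfalso; apply n. now rewrite Cmod_sub_diag.
  - intros y. destruct (Rlt_dec (Cmod (y - z)) d) as [i|n]; [now apply H|].
    field. apply Cmod_pos_neq. lra.
Qed.

Lemma cderiv_ext_near (g h : C -> C) (z l : C) (d : R) :
  0 < d -> (forall y, Cmod (y - z) < d -> g y = h y) -> cderiv g z l -> cderiv h z l.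
Proof.
  intros Hd E [phi [Hp [El H]]].
  apply cderiv_near with phi d; auto.
  intros y Hy. rewrite <- (E y Hy), <- (E z); [apply H|].
  now rewrite Cmod_sub_diag.
Qed.

Lemma cderiv_ext (g h : C -> C) (z l : C) :
  (forall y, g y = h y) -> cderiv g z l -> cderiv h z l.
Proof. intros E. apply cderiv_ext_near with 1; [lra|auto]. Qed.

Lemma cdiff_ext_near (g h : C -> C) (z : C) (d : R) :
  0 < d -> (forall y, Cmod (y - z) < d -> g y = h y) -> cdiff g z -> cdiff h z.
Proof. intros Hd E [l H]. exists l. exact (cderiv_ext_near _ _ _ _ _ Hd E H). Qed.

Lemma cderiv_const (c z : C) : cderiv (fun _ => c) z 0.
Proof.
  exists (fun _ => RtoC 0). split; [apply ccont_const|].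
  split; [reflexivity|]. intros; ring.
Qed.

Lemma cderiv_id (z : C) : cderiv (fun y => y) z 1.
Proof.
  exists (fun _ => RtoC 1). split; [apply ccont_const|].
  split; [reflexivity|]. intros; ring.
Qed.

Lemma cderiv_plus (g h : C -> C) (z l m : C) :
  cderiv g z l -> cderiv h z m -> cderiv (fun y => g y + h y)%C z (l + m)%C.
Proof.
  intros [p [Hp [Ep H]]] [q [Hq [Eq K]]].
  exists (fun y => p y + q y)%C. split; [now apply ccont_plus|].
  split; [now rewrite Ep, Eq|]. intros y. rewrite (H y), (K y). ring.
Qed.

Lemma cderiv_mult (g h : C -> C) (z l m : C) :
  cderiv g z l -> cderiv h z m ->
  cderiv (fun y => g y * h y)%C z (l * h z + g z * m)%C.
Proof.
  intros Hg Hh. assert (Ch := cderiv_cont _ _ _ Hh).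
  destruct Hg as [p [Hp [Ep H]]], Hh as [q [Hq [Eq K]]].
  exists (fun y => p y * h y + g z * q y)%C. split; [|split].
  - apply ccont_plus; apply ccont_mult; auto. apply ccont_const.
  - now rewrite Ep, Eq.
  - intros y. rewrite (H y), (K y). ring.
Qed.

Lemma cderiv_comp (g h : C -> C) (z l m : C) :
  cderiv h z m -> cderiv g (h z) l -> cderiv (fun y => g (h y)) z (l * m)%C.
Proof.
  intros Hh. assert (Ch := cderiv_cont _ _ _ Hh). revert Hh.
  intros [q [Hq [Eq K]]] [p [Hp [Ep H]]].
  exists (fun y => p (h y) * q y)%C. split; [|split].
  - apply ccont_mult; [|exact Hq]. now apply ccont_comp.
  - now rewrite Ep, Eq.
  - intros y. rewrite (H (h y)) at 1. rewrite (K y) at 2. ring.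
Qed.

Lemma cderiv_inv_id (z : C) : z <> 0 -> cderiv (fun y => / y)%C z (- / (z * z))%C.
Proof.
  intros Hz. assert (Hm := proj1 (Cmod_gt_0 _) Hz).
  apply cderiv_near with (fun y => - / (y * z))%C (Cmod z); auto.
  - apply ccont_opp, ccont_inv; [|now apply Cmult_neq_0].
    apply ccont_mult; [apply ccont_id|apply ccont_const].
  - intros y Hy.
    assert (y <> 0).
    { intros E. rewrite E in Hy. replace (0 - z)%C with (- z)%C in Hy by ring.
      rewrite Cmod_opp in Hy. lra. }
    field. auto.
Qed.

Lemma cderiv_inv (g : C -> C) (z l : C) :
  cderiv g z l -> g z <> 0 -> cderiv (fun y => / g y)%C z (- l / (g z * g z))%C.
Proof.
  intros Hg Hz. eapply cderiv_eq;
    [|apply (cderiv_comp (fun y => / y)%C g); [exact Hg|apply cderiv_inv_id, Hz]].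
  field. exact Hz.
Qed.

Lemma cderiv_opp (g : C -> C) (z l : C) :
  cderiv g z l -> cderiv (fun y => - g y)%C z (- l)%C.
Proof.
  intros H. apply (cderiv_ext (fun y => (-1) * g y)%C); [intros; ring|].
  eapply cderiv_eq; [|apply cderiv_mult; [apply cderiv_const|exact H]]. cbv beta; ring.
Qed.

Lemma cderiv_minus (g h : C -> C) (z l m : C) :
  cderiv g z l -> cderiv h z m -> cderiv (fun y => g y - h y)%C z (l - m)%C.
Proof. intros Hg Hh. apply cderiv_plus; [exact Hg|now apply cderiv_opp]. Qed.

Lemma cderiv_div (g h : C -> C) (z l m : C) :
  cderiv g z l -> cderiv h z m -> h z <> 0 ->
  cderiv (fun y => g y / h y)%C z ((l * h z - g z * m) / (h z * h z))%C.
Proof.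
  intros Hg Hh Hz. eapply cderiv_eq;
    [|apply cderiv_mult; [exact Hg|apply cderiv_inv; [exact Hh|exact Hz]]].
  cbv beta. field. exact Hz.
Qed.

Lemma cdiff_const (c z : C) : cdiff (fun _ => c) z.
Proof. exists (RtoC 0). apply cderiv_const. Qed.

Lemma cdiff_id (z : C) : cdiff (fun y => y) z.
Proof. exists (RtoC 1). apply cderiv_id. Qed.

Lemma cdiff_plus (g h : C -> C) (z : C) :
  cdiff g z -> cdiff h z -> cdiff (fun y => g y + h y)%C z.
Proof. intros [l H] [m K]. eexists. now apply cderiv_plus; eassumption. Qed.

Lemma cdiff_mult (g h : C -> C) (z : C) :
  cdiff g z -> cdiff h z -> cdiff (fun y => g y * h y)%C z.
Proof. intros [l H] [m K]. eexists. now apply cderiv_mult; eassumption. Qed.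

Lemma cdiff_opp (g : C -> C) (z : C) : cdiff g z -> cdiff (fun y => - g y)%C z.
Proof. intros [l H]. eexists. apply cderiv_opp; eassumption. Qed.

Lemma cdiff_minus (g h : C -> C) (z : C) :
  cdiff g z -> cdiff h z -> cdiff (fun y => g y - h y)%C z.
Proof. intros H K. apply cdiff_plus; [exact H|now apply cdiff_opp]. Qed.

Lemma cdiff_inv (g : C -> C) (z : C) :
  cdiff g z -> g z <> 0 -> cdiff (fun y => / g y)%C z.
Proof. intros [l H] Hz. eexists. apply cderiv_inv; eassumption. Qed.

Lemma cdiff_div (g h : C -> C) (z : C) :
  cdiff g z -> cdiff h z -> h z <> 0 -> cdiff (fun y => g y / h y)%C z.
Proof. intros H K Hz. apply cdiff_mult; [exact H|now apply cdiff_inv]. Qed.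

Lemma cdiff_comp (g h : C -> C) (z : C) :
  cdiff h z -> cdiff g (h z) -> cdiff (fun y => g (h y)) z.
Proof. intros [l H] [m K]. eexists. apply cderiv_comp; eassumption. Qed.

Lemma cdiff_pow (g : C -> C) (n : nat) (z : C) :
  cdiff g z -> cdiff (fun y => g y ^ n)%C z.
Proof.
  intros H. induction n as [|n IH]; simpl; [apply cdiff_const|].
  now apply cdiff_mult.
Qed.

Lemma cderiv_littleo (g : C -> C) (z l : C) :
  cderiv g z l <->
  forall eps, 0 < eps -> exists d, 0 < d /\ forall y, Cmod (y - z) < d ->
    Cmod (g y - g z - l * (y - z)) <= eps * Cmod (y - z).
Proof.
  split.
  - intros [phi [Hp [El H]]] e He. destruct (Hp e He) as [d [Hd Hb]].
    exists d. split; [exact Hd|]. intros y Hy. specialize (Hb y Hy).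
    rewrite (H y), <- El.
    replace (g z + phi y * (y - z) - g z - phi z * (y - z))%C
      with ((phi y - phi z) * (y - z))%C by ring.
    rewrite Cmod_mult. apply Rmult_le_compat_r; [apply Cmod_ge_0|]. lra.
  - intros D.
    exists (fun y => if Ceq_dec y z then l else ((g y - g z) / (y - z))%C).
    split; [|split].
    + intros e He. destruct (D (e/2)) as [d [Hd Hb]]; [lra|].
      exists d. split; [exact Hd|]. intros y Hy.
      destruct (Ceq_dec z z) as [_|n]; [|congruence].
      destruct (Ceq_dec y z) as [E|n].
      * rewrite Cmod_sub_diag. exact He.
      * assert (P := Cmod_diff_neq _ _ n). assert (Q := Csub_neq_0 _ _ n).
        replace ((g y - g z) / (y - z) - l)%C
          with ((g y - g z - l * (y - z)) / (y - z))%C by (field; exact Q).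
        rewrite Cmod_div by exact Q.
        apply Rmult_lt_reg_r with (Cmod (y - z)); [exact P|].
        unfold Rdiv. rewrite Rmult_assoc, Rinv_l by lra.
        specialize (Hb y Hy). nra.
    + destruct (Ceq_dec z z); congruence.
    + intros y. destruct (Ceq_dec y z) as [E|n].
      * rewrite E. ring.
      * field. now apply Csub_neq_0.
Qed.

Lemma is_derive_cderiv (g : C -> C) (z l : C) :
  is_derive (K := C_AbsRing) (V := C_NormedModule) g z l <-> cderiv g z l.
Proof.
  rewrite cderiv_littleo. split.
  - intros [_ H] e He. specialize (H z (fun P HP => HP)).
    destruct (H (mkposreal e He)) as [[d Hd] Hb].
    exists d. split; [exact Hd|]. intros y Hy.
    rewrite (Cmult_comm l). exact (Hb y Hy).
  - intros H. split.
    + apply (is_linear_scal_l (K := C_AbsRing) (V := C_NormedModule)).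
    + intros x Hx.
      assert (E : z = x).
      { apply (is_filter_lim_locally_unique (K := C_AbsRing)
                 (V := AbsRing_NormedModule C_AbsRing)). exact Hx. }
      subst x. intros [e He]. destruct (H e He) as [d [Hd Hb]].
      exists (mkposreal d Hd). intros y Hy. specialize (Hb y Hy).
      rewrite (Cmult_comm l) in Hb. exact Hb.
Qed.

Lemma cdiff_iff (g : C -> C) (z : C) : C_differentiable_at g z <-> cdiff g z.
Proof. split; intros [l H]; exists l; now apply is_derive_cderiv. Qed.

Lemma cderiv_unique (g : C -> C) (z l m : C) : cderiv g z l -> cderiv g z m -> l = m.
Proof.
  intros H K. apply is_derive_cderiv in H, K.
  rewrite <- (is_C_derive_unique g z l H). exact (is_C_derive_unique g z m K).
Qed.

(** * Compactness of closed discs *)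

(** The scale stands for a bound, a modulus of continuity or a rank in a
    sequence: one covering argument yields boundedness, positive minima, uniform
    continuity and cluster points. *)
Lemma disc_compact (r : R) (P : C -> R -> Prop) :
  (forall y e e', P y e -> 0 < e' <= e -> P y e') ->
  (forall z, Cmod z <= r -> exists d, 0 < d /\ forall y, Cmod (y - z) < d -> P y d) ->
  exists d, 0 < d /\ forall y, Cmod y <= r -> P y d.
Proof.
  intros Mono Loc.
  assert (G : forall z : C, exists d : posreal,
            (Cmod z <= r -> forall y, Cmod (y - z) < 2 * d -> P y d) /\
            (r < Cmod z -> forall y, Cmod (y - z) < 2 * d -> r < Cmod y)).
  { intros z. destruct (Rle_lt_dec (Cmod z) r) as [Hz|Hz].
    - destruct (Loc z Hz) as [d [Hd H]].
      assert (Hd2 : 0 < d / 2) by lra.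
      exists (mkposreal _ Hd2). split; [|intros; lra]. simpl. intros _ y Hy.
      apply Mono with d; [|lra]. apply H. lra.
    - assert (Hd2 : 0 < (Cmod z - r) / 2) by lra.
      exists (mkposreal _ Hd2). split; [intros; lra|]. simpl. intros _ y Hy.
      assert (T := Cmod_triangle_rev z y). rewrite Cmod_sub_sym in T. lra. }
  set (delta := fun x y => proj1_sig (constructive_indefinite_description _ (G (x, y)))).
  assert (Hdelta : forall x y, (Cmod (x, y) <= r -> forall w, Cmod (w - (x, y)) < 2 * delta x y -> P w (delta x y)) /\
            (r < Cmod (x, y) -> forall w, Cmod (w - (x, y)) < 2 * delta x y -> r < Cmod w)).
  { intros x y. exact (proj2_sig (constructive_indefinite_description _ (G (x, y)))). }
  apply NNPP. intros NH.
  destruct (compactness_value_2d (- r) r (- r) r delta) as [d Hd].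
  apply NH. exists d. split; [apply cond_pos|].
  intros y Hy. apply NNPP. intros NP.
  assert (B := Rmax_Cmod y). destruct y as [y1 y2]. simpl in B.
  assert (B1 := Rle_trans _ _ _ (Rle_trans _ _ _ (Rmax_l _ _) B) Hy).
  assert (B2 := Rle_trans _ _ _ (Rle_trans _ _ _ (Rmax_r _ _) B) Hy).
  apply Rabs_le_between in B1, B2.
  apply (Hd y1 y2 B1 B2). intros [i [j [_ [_ [Hi [Hj Hij]]]]]].
  assert (D : Cmod ((y1, y2) - (i, j)) < 2 * delta i j).
  { eapply Rle_lt_trans; [apply Cmod_le_2Rmax|]. simpl.
    assert (M : Rmax (Rabs (y1 + - i)) (Rabs (y2 + - j)) < delta i j)
      by (apply Rmax_lub_lt; assumption). lra. }
  destruct (Hdelta i j) as [H1 H2].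
  destruct (Rle_lt_dec (Cmod (i, j)) r) as [Hr|Hr].
  - apply NP. apply Mono with (delta i j); [now apply H1|].
    split; [apply cond_pos|exact Hij].
  - specialize (H2 Hr _ D). lra.
Qed.

Lemma bounded_on_disc (r : R) (g : C -> C) :
  (forall z, Cmod z <= r -> ccont g z) ->
  exists M, 0 < M /\ forall z, Cmod z <= r -> Cmod (g z) <= M.
Proof.
  intros Hg.
  destruct (disc_compact r (fun y e => Cmod (g y) <= / e)) as [d [Hd H]].
  - intros y e e' H [He' Hee]. eapply Rle_trans; [exact H|]. apply Rinv_le_contravar; lra.
  - intros z Hz. destruct (Hg z Hz 1) as [d [Hd H]]; [lra|].
    assert (A := Cmod_ge_0 (g z)).
    assert (I : 0 < / (Cmod (g z) + 1)) by (apply Rinv_0_lt_compat; lra).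
    exists (Rmin d (/ (Cmod (g z) + 1))). split; [now apply Rmin_glb_lt|].
    intros y Hy. specialize (H y (Rlt_le_trans _ _ _ Hy (Rmin_l _ _))).
    assert (T := Cmod_triangle_rev (g y) (g z)).
    rewrite <- (Rinv_inv (Cmod (g y))).
    apply Rle_trans with (Cmod (g z) + 1); [rewrite Rinv_inv; lra|].
    rewrite <- (Rinv_inv (Cmod (g z) + 1)) at 1.
    apply Rinv_le_contravar; [now apply Rmin_glb_lt|apply Rmin_r].
  - exists (/ d). split; [now apply Rinv_0_lt_compat|exact H].
Qed.

(** Stated for a relatively closed subset [S] so as to apply to circles. *)
Lemma positive_min_on (r : R) (S : C -> Prop) (g : C -> C) :
  (forall z, Cmod z <= r -> ccont g z) ->
  (forall z, Cmod z <= r -> ~ S z -> exists d, 0 < d /\ forall y, Cmod (y - z) < d -> ~ S y) ->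
  (forall z, Cmod z <= r -> S z -> g z <> 0) ->
  exists m, 0 < m /\ forall z, Cmod z <= r -> S z -> m <= Cmod (g z).
Proof.
  intros Hg HS H0.
  destruct (disc_compact r (fun y e => S y -> e <= Cmod (g y))) as [d [Hd H]].
  - intros y e e' H Hee Sy. specialize (H Sy). lra.
  - intros z Hz. destruct (classic (S z)) as [Sz|NSz].
    + destruct (ccont_lower g z (Hg z Hz) (H0 z Hz Sz)) as [d [Hd H]].
      assert (A := proj1 (Cmod_gt_0 _) (H0 z Hz Sz)).
      exists (Rmin d (Cmod (g z) / 2)). split; [apply Rmin_glb_lt; lra|].
      intros y Hy _. specialize (H y (Rlt_le_trans _ _ _ Hy (Rmin_l _ _))).
      assert (T := Rmin_r d (Cmod (g z) / 2)). lra.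
    + destruct (HS z Hz NSz) as [d [Hd H]]. exists d. split; [exact Hd|].
      intros y Hy Sy. now destruct (H y Hy).
  - exists d. split; [exact Hd|]. intros z Hz Sz. now apply H.
Qed.

Lemma positive_min_circle (r : R) (g : C -> C) :
  (forall z, Cmod z <= r -> ccont g z) -> (forall z, Cmod z = r -> g z <> 0) ->
  exists m, 0 < m /\ forall z, Cmod z = r -> m <= Cmod (g z).
Proof.
  intros Hg H0.
  destruct (positive_min_on r (fun z => Cmod z = r) g Hg) as [m [Hm H]].
  - intros z Hz N. exists (r - Cmod z). split; [lra|]. intros y Hy E.
    assert (T := Cmod_triangle_rev y z). lra.
  - auto.
  - exists m. split; [exact Hm|]. intros z Hz. apply H; lra.
Qed.

Lemma uniform_continuity_disc (r : R) (g : C -> C) :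
  (forall z, Cmod z <= r -> ccont g z) ->
  forall eps, 0 < eps -> exists d, 0 < d /\
    forall y y', Cmod y <= r -> Cmod (y' - y) < d -> Cmod (g y' - g y) < eps.
Proof.
  intros Hg e He.
  destruct (disc_compact r (fun y d => forall y', Cmod (y' - y) < d -> Cmod (g y' - g y) < e))
    as [d [Hd H]].
  - intros y d d' H Hd y' Hy'. apply H. lra.
  - intros z Hz. destruct (Hg z Hz (e / 2)) as [d [Hd H]]; [lra|].
    exists (d / 2). split; [lra|]. intros y Hy y' Hy'.
    assert (A := H y ltac:(lra)).
    assert (T := Cmod_sub_triangle y' y z).
    assert (B := H y' ltac:(lra)).
    assert (T2 := Cmod_sub_triangle (g y') (g z) (g y)).
    rewrite (Cmod_sub_sym (g z)) in T2. lra.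
  - exists d. split; [exact Hd|]. intros y y' Hy. now apply H.
Qed.

Lemma bounded_cluster (r : R) (u : nat -> C) :
  (forall n, Cmod (u n) <= r) ->
  exists z, Cmod z <= r /\
    forall eps (N : nat), 0 < eps -> exists n, (N <= n)%nat /\ Cmod (u n - z) < eps.
Proof.
  intros Hu. apply NNPP. intros NC.
  destruct (disc_compact r (fun y e => forall n, / (INR n + 1) < e -> u n <> y))
    as [d [Hd H]].
  - intros y e e' H Hee n Hn. apply H. lra.
  - intros z Hz.
    assert (L : exists e (N : nat), 0 < e /\ forall n, (N <= n)%nat -> e <= Cmod (u n - z)).
    { apply NNPP. intros NL. apply NC. exists z. split; [exact Hz|].
      intros e N He. apply NNPP. intros NN. apply NL. exists e, N.
      split; [exact He|]. intros n Hn. apply Rnot_lt_le. intros Hlt.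
      apply NN. now exists n. }
    destruct L as [e [N [He H]]].
    assert (I : 0 < / (INR N + 1)).
    { apply Rinv_0_lt_compat. assert (T := pos_INR N). lra. }
    exists (Rmin e (/ (INR N + 1))). split; [now apply Rmin_glb_lt|].
    intros y Hy n Hn E.
    assert (Hn2 : / (INR n + 1) < / (INR N + 1))
      by (eapply Rlt_le_trans; [exact Hn|apply Rmin_r]).
    assert (NN : (N <= n)%nat).
    { apply INR_le. apply Rnot_lt_le. intros HlN.
      assert (T := pos_INR n).
      assert (/ (INR N + 1) < / (INR n + 1)) by (apply Rinv_lt_contravar; nra). lra. }
    specialize (H n NN). rewrite E in H.
    assert (T := Rmin_l e (/ (INR N + 1))). lra.
  - destruct (archimed_cor1 d Hd) as [n [Hn Hn0]].
    apply (H (u n) (Hu n) n); [|reflexivity].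
    assert (T : 0 < INR n) by (apply lt_0_INR; lia).
    eapply Rlt_trans; [|exact Hn]. apply Rinv_lt_contravar; nra.
Qed.

(** * Integrals of complex-valued functions of a real variable *)

Definition pcont (f : R -> C) (t : R) : Prop :=
  forall eps, 0 < eps -> exists del, 0 < del /\
    forall s, Rabs (s - t) < del -> Cmod (f s - f t) < eps.

Lemma pcont_continuous (f : R -> C) (t : R) :
  pcont f t -> continuous (fun s => fst (f s)) t /\ continuous (fun s => snd (f s)) t.
Proof.
  intros H. split; apply continuity_pt_filterlim; intros e He;
    destruct (H e He) as [d [Hd Hb]]; exists d; (split; [exact Hd|]);
    intros s [_ Hs]; specialize (Hb s Hs);
    (eapply Rle_lt_trans; [|exact Hb]);
    assert (M := Rmax_Cmod (f s - f t)%C); unfold Rdist; simpl in *;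
    (eapply Rle_trans; [|exact M]); [apply Rmax_l|apply Rmax_r].
Qed.

Lemma pcont_const (c : C) (t : R) : pcont (fun _ => c) t.
Proof.
  intros e He. exists 1. split; [lra|]. intros.
  now rewrite Cmod_sub_diag.
Qed.

Lemma pcont_comp (g : C -> C) (f : R -> C) (t : R) :
  pcont f t -> ccont g (f t) -> pcont (fun s => g (f s)) t.
Proof.
  intros Hf Hg e He. destruct (Hg e He) as [d1 [Hd1 H1]].
  destruct (Hf d1 Hd1) as [d2 [Hd2 H2]]. exists d2. auto.
Qed.

Lemma pcont_of_ccont (g : C -> C) (t : R) : ccont g t -> pcont (fun s => g (RtoC s)) t.
Proof.
  intros Hg e He. destruct (Hg e He) as [d [Hd H]]. exists d. split; [exact Hd|].
  intros s Hs. apply H. rewrite <- RtoC_minus, Cmod_R. exact Hs.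
Qed.

Lemma pcont_plus (f g : R -> C) (t : R) :
  pcont f t -> pcont g t -> pcont (fun s => f s + g s)%C t.
Proof.
  intros Hg Hh e He.
  destruct (Hg (e/2)) as [d1 [Hd1 H1]]; [lra|].
  destruct (Hh (e/2)) as [d2 [Hd2 H2]]; [lra|].
  exists (Rmin d1 d2). split; [now apply Rmin_glb_lt|]. intros y Hy.
  assert (A1 := H1 y (Rlt_le_trans _ _ _ Hy (Rmin_l _ _))).
  assert (A2 := H2 y (Rlt_le_trans _ _ _ Hy (Rmin_r _ _))).
  replace (f y + g y - (f t + g t))%C with ((f y - f t) + (g y - g t))%C by ring.
  eapply Rle_lt_trans; [apply Cmod_triangle|]. lra.
Qed.

Lemma pcont_scal (c : C) (f : R -> C) (t : R) : pcont f t -> pcont (fun s => c * f s)%C t.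
Proof.
  intros H. apply (pcont_comp (fun w => c * w)%C f); [exact H|].
  apply ccont_mult; [apply ccont_const|apply ccont_id].
Qed.

Lemma pcont_minus (f g : R -> C) (t : R) :
  pcont f t -> pcont g t -> pcont (fun s => f s - g s)%C t.
Proof.
  intros Hf Hg. apply pcont_plus; [exact Hf|].
  apply (pcont_comp (fun w => - w)%C g); [exact Hg|]. apply ccont_opp, ccont_id.
Qed.

Lemma pcont_mult (f g : R -> C) (t : R) :
  pcont f t -> pcont g t -> pcont (fun s => f s * g s)%C t.
Proof.
  intros Hf Hg.
  assert (H : pcont (fun s => (f s - f t) * (g s - g t))%C t).
  { intros e He. destruct (Hf (Rmin 1 e)) as [d1 [Hd1 H1]]; [apply Rmin_glb_lt; lra|].
    destruct (Hg (Rmin 1 e)) as [d2 [Hd2 H2]]; [apply Rmin_glb_lt; lra|].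
    exists (Rmin d1 d2). split; [now apply Rmin_glb_lt|]. intros s Hs.
    assert (A1 := H1 s (Rlt_le_trans _ _ _ Hs (Rmin_l _ _))).
    assert (A2 := H2 s (Rlt_le_trans _ _ _ Hs (Rmin_r _ _))).
    replace ((f s - f t) * (g s - g t) - (f t - f t) * (g t - g t))%C
      with ((f s - f t) * (g s - g t))%C by ring.
    rewrite Cmod_mult.
    assert (M1 := Rmin_l 1 e). assert (M2 := Rmin_r 1 e).
    assert (P1 := Cmod_ge_0 (f s - f t)). assert (P2 := Cmod_ge_0 (g s - g t)). nra. }
  assert (K : pcont (fun s => (f s - f t) * (g s - g t)
                      + (g t * f s + (f t * g s - f t * g t)))%C t).
  { apply pcont_plus; [exact H|]. apply pcont_plus; [now apply pcont_scal|].
    apply pcont_minus; [now apply pcont_scal|apply pcont_const]. }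
  intros e He. destruct (K e He) as [d [Hd Hb]]. exists d. split; [exact Hd|].
  intros s Hs. specialize (Hb s Hs).
  match type of Hb with Cmod ?x < _ => replace x with (f s * g s - f t * g t)%C in Hb by ring end.
  exact Hb.
Qed.

Definition CInt (f : R -> C) (a b : R) : C :=
  (RInt (fun t => fst (f t)) a b, RInt (fun t => snd (f t)) a b).

Lemma pcont_ex_RInt (f : R -> C) (a b : R) :
  a <= b -> (forall t, a <= t <= b -> pcont f t) ->
  ex_RInt (fun t => fst (f t)) a b /\ ex_RInt (fun t => snd (f t)) a b.
Proof.
  intros Hab H. split; apply (ex_RInt_continuous (V := R_CompleteNormedModule));
    intros t Ht; rewrite Rmin_left, Rmax_right in Ht by exact Hab;
    now apply pcont_continuous, H.
Qed.

Lemma CInt_ext (f g : R -> C) (a b : R) :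
  a <= b -> (forall t, a <= t <= b -> f t = g t) -> CInt f a b = CInt g a b.
Proof.
  intros Hab H. unfold CInt. f_equal; apply RInt_ext; intros t Ht;
    rewrite Rmin_left, Rmax_right in Ht by exact Hab; rewrite H by lra; reflexivity.
Qed.

Lemma CInt_plus (f g : R -> C) (a b : R) :
  a <= b -> (forall t, a <= t <= b -> pcont f t) -> (forall t, a <= t <= b -> pcont g t) ->
  CInt (fun t => f t + g t)%C a b = (CInt f a b + CInt g a b)%C.
Proof.
  intros Hab Hf Hg. destruct (pcont_ex_RInt f a b Hab Hf), (pcont_ex_RInt g a b Hab Hg).
  unfold CInt, Cplus. simpl. f_equal; apply (RInt_plus (V := R_CompleteNormedModule)); assumption.
Qed.

Lemma CInt_scal (c : C) (f : R -> C) (a b : R) :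
  a <= b -> (forall t, a <= t <= b -> pcont f t) ->
  CInt (fun t => c * f t)%C a b = (c * CInt f a b)%C.
Proof.
  intros Hab Hf. destruct (pcont_ex_RInt f a b Hab Hf) as [H1 H2].
  destruct c as [x y]. unfold CInt, Cmult. simpl. f_equal.
  - rewrite (RInt_minus (V := R_CompleteNormedModule) (fun t => x * fst (f t)) (fun t => y * snd (f t)));
      [|now apply (ex_RInt_scal (V := R_NormedModule))|now apply (ex_RInt_scal (V := R_NormedModule))].
    rewrite !(RInt_scal (V := R_CompleteNormedModule)) by assumption. reflexivity.
  - rewrite (RInt_plus (V := R_CompleteNormedModule) (fun t => x * snd (f t)) (fun t => y * fst (f t)));
      [|now apply (ex_RInt_scal (V := R_NormedModule))|now apply (ex_RInt_scal (V := R_NormedModule))].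
    rewrite !(RInt_scal (V := R_CompleteNormedModule)) by assumption. reflexivity.
Qed.

Lemma CInt_minus (f g : R -> C) (a b : R) :
  a <= b -> (forall t, a <= t <= b -> pcont f t) -> (forall t, a <= t <= b -> pcont g t) ->
  CInt (fun t => f t - g t)%C a b = (CInt f a b - CInt g a b)%C.
Proof.
  intros Hab Hf Hg.
  rewrite (CInt_ext _ (fun t => f t + (-1) * g t)%C) by (auto; intros; ring).
  rewrite CInt_plus; auto; [|intros; apply pcont_scal; auto].
  rewrite CInt_scal by auto. ring.
Qed.

Lemma CInt_const (c : C) (a b : R) : CInt (fun _ => c) a b = ((b - a)%R * c)%C.
Proof.
  unfold CInt, Cmult. simpl. rewrite !RInt_const. unfold scal; simpl; unfold mult; simpl.
  f_equal; ring.
Qed.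

Lemma CInt_Chasles (f : R -> C) (a b c : R) :
  a <= b <= c -> (forall t, a <= t <= c -> pcont f t) ->
  CInt f a c = (CInt f a b + CInt f b c)%C.
Proof.
  intros Habc Hf.
  destruct (pcont_ex_RInt f a b) as [A1 A2]; [lra|intros; apply Hf; lra|].
  destruct (pcont_ex_RInt f b c) as [B1 B2]; [lra|intros; apply Hf; lra|].
  unfold CInt, Cplus. simpl. f_equal; symmetry;
    apply (RInt_Chasles (V := R_CompleteNormedModule)); assumption.
Qed.

(** The factor 2 comes from bounding the real and imaginary parts separately. *)
Lemma CInt_bound (f : R -> C) (a b M : R) :
  a <= b -> (forall t, a <= t <= b -> pcont f t) ->
  (forall t, a <= t <= b -> Cmod (f t) <= M) -> Cmod (CInt f a b) <= 2 * ((b - a) * M).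
Proof.
  intros Hab Hf HM. destruct (pcont_ex_RInt f a b Hab Hf) as [H1 H2].
  eapply Rle_trans; [apply Cmod_le_2Rmax|].
  assert (Q : Rmax (Rabs (fst (CInt f a b))) (Rabs (snd (CInt f a b))) <= (b - a) * M).
  { unfold CInt; simpl. apply Rmax_lub;
      apply abs_RInt_le_const; auto; intros t Ht; specialize (HM t Ht);
      (eapply Rle_trans; [|exact HM]); (eapply Rle_trans; [|apply Rmax_Cmod]);
      [apply Rmax_l|apply Rmax_r]. }
  lra.
Qed.

(** * The complex exponential *)

Definition Cexp (u : C) : C := (RtoC (exp (fst u)) * Cexpi (snd u))%C.

Lemma Cexpi_plus (a b : R) : Cexpi (a + b) = (Cexpi a * Cexpi b)%C.
Proof. unfold Cexpi, Cmult. simpl. rewrite cos_plus, sin_plus. f_equal; ring. Qed.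

Lemma Cmod_Cexpi (t : R) : Cmod (Cexpi t) = 1.
Proof.
  unfold Cexpi, Cmod. simpl. rewrite !Rmult_1_r, <- sqrt_1. f_equal.
  assert (H := sin2_cos2 t). unfold Rsqr in H. lra.
Qed.

Lemma Cexpi_0 : Cexpi 0 = 1.
Proof. unfold Cexpi. now rewrite cos_0, sin_0. Qed.

Lemma Cexpi_2PI : Cexpi (2 * PI) = 1.
Proof. unfold Cexpi. now rewrite cos_2PI, sin_2PI. Qed.

Lemma Cexp_plus (u v : C) : Cexp (u + v) = (Cexp u * Cexp v)%C.
Proof. unfold Cexp. simpl. rewrite exp_plus, Cexpi_plus, RtoC_mult. ring. Qed.

Lemma Cmod_Cexp (u : C) : Cmod (Cexp u) = exp (fst u).
Proof.
  unfold Cexp. rewrite Cmod_mult, Cmod_Cexpi, Cmod_R, Rabs_pos_eq; [ring|].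
  apply Rlt_le, exp_pos.
Qed.

Lemma Cexp_neq_0 (u : C) : Cexp u <> 0.
Proof. apply Cmod_pos_neq. rewrite Cmod_Cexp. apply exp_pos. Qed.

Lemma Cexp_0 : Cexp 0 = 1.
Proof. unfold Cexp. simpl. rewrite exp_0, Cexpi_0. ring. Qed.

Lemma derivable_littleo (f : R -> R) (l : R) :
  derivable_pt_lim f 0 l -> forall e, 0 < e -> exists d, 0 < d /\
    forall h, Rabs h < d -> Rabs (f h - f 0 - l * h) <= e * Rabs h.
Proof.
  intros H e He. destruct (H e He) as [d Hd]. exists d. split; [apply cond_pos|].
  intros h Hh. destruct (Req_dec h 0) as [->|Hn].
  - replace (f 0 - f 0 - l * 0) with 0 by ring. rewrite !Rabs_R0. lra.
  - specialize (Hd h Hn Hh). rewrite Rplus_0_l in Hd.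
    replace (f h - f 0 - l * h) with (((f h - f 0) / h - l) * h) by (field; exact Hn).
    rewrite Rabs_mult. apply Rmult_le_compat_r; [apply Rabs_pos|lra].
Qed.

Lemma cderiv_Cexp_0 : cderiv Cexp 0 1.
Proof.
  apply cderiv_littleo. intros e He.
  set (eta := Rmin 1 (e / 10)).
  assert (Heta : 0 < eta) by (apply Rmin_glb_lt; lra).
  assert (E1 : eta <= 1) by apply Rmin_l.
  assert (E2 : eta <= e / 10) by apply Rmin_r.
  destruct (derivable_littleo exp 1) with (e := eta) as [d1 [Hd1 H1]]; auto.
  { assert (D := derivable_pt_lim_exp 0). now rewrite exp_0 in D. }
  destruct (derivable_littleo cos 0) with (e := eta) as [d2 [Hd2 H2]]; auto.
  { assert (D := derivable_pt_lim_cos 0). now rewrite sin_0, Ropp_0 in D. }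
  destruct (derivable_littleo sin 1) with (e := eta) as [d3 [Hd3 H3]]; auto.
  { assert (D := derivable_pt_lim_sin 0). now rewrite cos_0 in D. }
  exists (Rmin (Rmin d1 (eta / 2)) (Rmin d2 d3)). split.
  { repeat apply Rmin_glb_lt; lra. }
  intros v Hv. replace (v - 0)%C with v in * by ring. destruct v as [x y].
  rewrite Cexp_0.
  assert (B := Rmax_Cmod (x, y)). cbn [fst snd] in B.
  set (m := Cmod (x, y)) in *.
  assert (Bx : Rabs x <= m) by (eapply Rle_trans; [apply Rmax_l|exact B]).
  assert (By : Rabs y <= m) by (eapply Rle_trans; [apply Rmax_r|exact B]).
  assert (m < d1 /\ m < eta / 2 /\ m < d2 /\ m < d3) as [M1 [M2 [M3 M4]]].
  { repeat split; eapply Rlt_le_trans; try exact Hv;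
      [ eapply Rle_trans; [apply Rmin_l|apply Rmin_l]
      | eapply Rle_trans; [apply Rmin_l|apply Rmin_r]
      | eapply Rle_trans; [apply Rmin_r|apply Rmin_l]
      | eapply Rle_trans; [apply Rmin_r|apply Rmin_r] ]. }
  specialize (H1 x ltac:(lra)). specialize (H2 y ltac:(lra)). specialize (H3 y ltac:(lra)).
  rewrite exp_0 in H1. rewrite cos_0 in H2. rewrite sin_0 in H3.
  assert (X1 : Rabs (exp x - 1) <= eta).
  { replace (exp x - 1) with ((exp x - 1 - 1 * x) + x) by ring.
    eapply Rle_trans; [apply Rabs_triang|].
    assert (P := Rabs_pos x). nra. }
  assert (X2 : Rabs (exp x) <= 2).
  { rewrite Rabs_pos_eq by (apply Rlt_le, exp_pos). apply Rabs_le_between in X1. lra. }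
  assert (P := Rabs_pos x). assert (Q := Rabs_pos y).
  assert (R1 : Rabs (exp x * cos y - 1 - x) <= 3 * eta * m).
  { replace (exp x * cos y - 1 - x)
      with ((exp x - 1 - 1 * x) + exp x * (cos y - 1 - 0 * y)) by ring.
    eapply Rle_trans; [apply Rabs_triang|]. rewrite Rabs_mult.
    assert (S := Rabs_pos (cos y - 1 - 0 * y)). assert (S2 := Rabs_pos (exp x)). nra. }
  assert (R2 : Rabs (exp x * sin y - y) <= 3 * eta * m).
  { replace (exp x * sin y - y)
      with (exp x * (sin y - 0 - 1 * y) + (exp x - 1) * y) by ring.
    eapply Rle_trans; [apply Rabs_triang|]. rewrite !Rabs_mult.
    assert (S := Rabs_pos (sin y - 0 - 1 * y)). assert (S2 := Rabs_pos (exp x)).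
    assert (S3 := Rabs_pos (exp x - 1)). nra. }
  eapply Rle_trans; [apply Cmod_le_2Rmax|].
  assert (K : Rmax (Rabs (fst (Cexp (x, y) - 1 - 1 * (x, y))%C))
                   (Rabs (snd (Cexp (x, y) - 1 - 1 * (x, y))%C)) <= 3 * eta * m).
  { unfold Cexp, Cexpi. simpl. apply Rmax_lub.
    - match goal with |- Rabs ?a <= _ => replace a with (exp x * cos y - 1 - x) by ring end.
      exact R1.
    - match goal with |- Rabs ?a <= _ => replace a with (exp x * sin y - y) by ring end.
      exact R2. }
  assert (m0 : 0 <= m) by apply Cmod_ge_0.
  nra.
Qed.

Lemma cderiv_Cexp (u : C) : cderiv Cexp u (Cexp u).
Proof.
  apply (cderiv_ext (fun w => Cexp u * Cexp (w - u))%C).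
  { intros w. rewrite <- Cexp_plus. f_equal. ring. }
  eapply cderiv_eq; [|apply cderiv_mult; [apply cderiv_const|]].
  2:{ apply (cderiv_comp Cexp (fun w => w - u)%C).
      - apply cderiv_minus; [apply cderiv_id|apply cderiv_const].
      - replace (u - u)%C with (RtoC 0) by ring. apply cderiv_Cexp_0. }
  cbv beta. ring.
Qed.

Lemma pcont_Cexpi (t : R) : pcont Cexpi t.
Proof.
  assert (H : pcont (fun s => Cexp (Ci * RtoC s)) t).
  { apply (pcont_of_ccont (fun w => Cexp (Ci * w))).
    apply (ccont_comp Cexp (fun w => Ci * w)%C).
    - apply ccont_mult; [apply ccont_const|apply ccont_id].
    - eapply cderiv_cont, cderiv_Cexp. }
  assert (E : forall s, Cexp (Ci * RtoC s) = Cexpi s).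
  { intros s. unfold Cexp. simpl.
    replace (0 * s - 1 * 0) with 0 by ring. replace (0 * 0 + 1 * s) with s by ring.
    rewrite exp_0. ring. }
  intros e He. destruct (H e He) as [d [Hd Hb]]. exists d. split; [exact Hd|].
  intros s Hs. rewrite <- !E. now apply Hb.
Qed.

(** * Goursat's theorem and integrals over circles *)

Definition quarter (P : R -> R -> R -> R -> Prop) (q : R * R * (R * R)) : R * R * (R * R) :=
  let '((a, b), (c, d)) := q in
  let m := (a + b) / 2 in let n := (c + d) / 2 in
  if excluded_middle_informative (P a m c n) then
    if excluded_middle_informative (P m b c n) then
      if excluded_middle_informative (P a m n d) then ((m, b), (n, d))
      else ((a, m), (n, d))
    else ((m, b), (c, n))
  else ((a, m), (c, n)).

(** If the property failed for a rectangle it would fail for one of its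
    quarters, and so on down to arbitrarily small rectangles around a point. *)
Lemma rectangle_induction (P : R -> R -> R -> R -> Prop) (a0 b0 c0 d0 : R) :
  a0 <= b0 -> c0 <= d0 ->
  (forall a b c d, a0 <= a -> a <= b -> b <= b0 -> c0 <= c -> c <= d -> d <= d0 ->
     P a ((a + b) / 2) c ((c + d) / 2) -> P ((a + b) / 2) b c ((c + d) / 2) ->
     P a ((a + b) / 2) ((c + d) / 2) d -> P ((a + b) / 2) b ((c + d) / 2) d ->
     P a b c d) ->
  (forall x y, a0 <= x <= b0 -> c0 <= y <= d0 -> exists del, 0 < del /\
     forall a b c d, a0 <= a <= x -> x <= b <= b0 -> c0 <= c <= y -> y <= d <= d0 ->
       b - a < del -> d - c < del -> P a b c d) ->
  P a0 b0 c0 d0.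
Proof.
  intros Hab Hcd Hadd Hloc. apply NNPP. intros HN.
  set (q := fix q n := match n with
                      | O => ((a0, b0), (c0, d0))
                      | S n => quarter P (q n) end).
  set (A := fun n => fst (fst (q n))). set (B := fun n => snd (fst (q n))).
  set (X := fun n => fst (snd (q n))). set (Y := fun n => snd (snd (q n))).
  assert (Inv : forall n, a0 <= A n /\ A n <= B n /\ B n <= b0 /\
            c0 <= X n /\ X n <= Y n /\ Y n <= d0 /\
            ~ P (A n) (B n) (X n) (Y n) /\
            B n - A n = (b0 - a0) * (1/2) ^ n /\ Y n - X n = (d0 - c0) * (1/2) ^ n).
  { induction n as [|n IH].
    - unfold A, B, X, Y; simpl. repeat split; try lra. exact HN.
    - destruct IH as [I1 [I2 [I3 [I4 [I5 [I6 [I7 [I8 I9]]]]]]]].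
      specialize (Hadd _ _ _ _ I1 I2 I3 I4 I5 I6).
      unfold A, B, X, Y in *. simpl q.
      destruct (q n) as [[a b] [c d]]. simpl in *. unfold quarter.
      destruct (excluded_middle_informative (P a ((a + b) / 2) c ((c + d) / 2)));
      [destruct (excluded_middle_informative (P ((a + b) / 2) b c ((c + d) / 2)));
       [destruct (excluded_middle_informative (P a ((a + b) / 2) ((c + d) / 2) d))|]|];
      simpl; repeat split; try lra; try assumption.
      intros H. apply I7, Hadd; assumption. }
  assert (Mono : forall n, A n <= A (S n) /\ B (S n) <= B n /\ X n <= X (S n) /\ Y (S n) <= Y n).
  { intros n. destruct (Inv n) as [I1 [I2 [I3 [I4 [I5 _]]]]].
    unfold A, B, X, Y in *. simpl q.
    destruct (q n) as [[a b] [c d]]. simpl in *. unfold quarter.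
    destruct (excluded_middle_informative (P a ((a + b) / 2) c ((c + d) / 2)));
      [destruct (excluded_middle_informative (P ((a + b) / 2) b c ((c + d) / 2)));
       [destruct (excluded_middle_informative (P a ((a + b) / 2) ((c + d) / 2) d))|]|];
      simpl; repeat split; lra. }
  assert (Lim : forall (U V : nat -> R), (forall n, U n <= U (S n)) -> (forall n, V (S n) <= V n) ->
            (forall n, U n <= V n) -> exists x, forall n, U n <= x <= V n).
  { intros U V HU HV HUV.
    assert (GU : forall n m, (n <= m)%nat -> U n <= U m).
    { intros n m H. induction H; [lra|]. eapply Rle_trans; [exact IHle|apply HU]. }
    assert (GV : forall n m, (n <= m)%nat -> V m <= V n).
    { intros n m H. induction H; [lra|]. eapply Rle_trans; [apply HV|exact IHle]. }
    destruct (completeness (fun x => exists n, x = U n)) as [x [Hx1 Hx2]].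
    - exists (V O). intros y [n ->]. eapply Rle_trans; [apply HUV|]. apply GV. lia.
    - exists (U O). now exists O.
    - exists x. intros n. split; [apply Hx1; now exists n|].
      apply Hx2. intros y [m ->].
      apply Rle_trans with (U (max n m)); [apply GU; lia|].
      eapply Rle_trans; [apply HUV|]. apply GV. lia. }
  destruct (Lim A B) as [x Hx]; [intros; apply Mono|intros; apply Mono|intros; apply Inv|].
  destruct (Lim X Y) as [y Hy]; [intros; apply Mono|intros; apply Mono|intros; apply Inv|].
  destruct (Hloc x y (Hx O) (Hy O)) as [del [Hdel H]].
  assert (HP : exists n, (b0 - a0 + (d0 - c0) + 1) * (1/2) ^ n < del).
  { destruct (pow_lt_1_zero (1/2)) with (y := del / (b0 - a0 + (d0 - c0) + 1)) as [n Hn].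
    - rewrite Rabs_pos_eq; lra.
    - apply Rdiv_lt_0_compat; lra.
    - exists n. specialize (Hn n (le_n n)). rewrite Rabs_pos_eq in Hn by (apply pow_le; lra).
      apply (Rmult_lt_compat_l (b0 - a0 + (d0 - c0) + 1)) in Hn; [|lra].
      replace ((b0 - a0 + (d0 - c0) + 1) * (del / (b0 - a0 + (d0 - c0) + 1))) with del in Hn
        by (field; lra). exact Hn. }
  destruct HP as [n Hn].
  destruct (Inv n) as [I1 [I2 [I3 [I4 [I5 [I6 [I7 [I8 I9]]]]]]]].
  assert (W : 0 < (1/2) ^ n) by (apply pow_lt; lra).
  apply I7, H; auto.
  - split; [exact I1|apply Hx].
  - split; [apply Hx|exact I3].
  - split; [exact I4|apply Hy].
  - split; [apply Hy|exact I6].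
  - rewrite I8. nra.
  - rewrite I9. nra.
Qed.

(** The integral of [G] along the boundary of the rectangle [[a,b] x [c,d]]. *)
Definition rect_int (G : C -> C) (a b c d : R) : C :=
  (Ci * CInt (fun y => G (b, y) - G (a, y)) c d - CInt (fun x => G (x, d) - G (x, c)) a b)%C.

Lemma pcont_vertical (G : C -> C) (x y : R) : ccont G (x, y) -> pcont (fun t => G (x, t)) y.
Proof.
  intros H e He. destruct (H e He) as [d [Hd Hb]]. exists d. split; [exact Hd|].
  intros s Hs. apply Hb. replace ((x, s) - (x, y))%C with (RtoC (s - y) * Ci)%C.
  - rewrite Cmod_mult, Cmod_R, Cmod_Ci, Rmult_1_r. exact Hs.
  - unfold Cmult, Cminus, Cplus, Copp, RtoC, Ci; simpl. f_equal; ring.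
Qed.

Lemma pcont_horizontal (G : C -> C) (x y : R) : ccont G (x, y) -> pcont (fun t => G (t, y)) x.
Proof.
  intros H e He. destruct (H e He) as [d [Hd Hb]]. exists d. split; [exact Hd|].
  intros s Hs. apply Hb. replace ((s, y) - (x, y))%C with (RtoC (s - x))%C.
  - rewrite Cmod_R. exact Hs.
  - unfold Cminus, Cplus, Copp, RtoC; simpl. f_equal; ring.
Qed.

Lemma rect_int_split (G : C -> C) (a m b c n d : R) :
  a <= m <= b -> c <= n <= d ->
  (forall x y, a <= x <= b -> c <= y <= d -> ccont G (x, y)) ->
  rect_int G a b c d =
    (rect_int G a m c n + rect_int G m b c n + rect_int G a m n d + rect_int G m b n d)%C.
Proof.
  intros Hm Hn HG.
  assert (V : forall x, a <= x <= b -> forall y, c <= y <= d -> pcont (fun t => G (x, t)) y)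
    by (intros; apply pcont_vertical; auto).
  assert (H : forall y, c <= y <= d -> forall x, a <= x <= b -> pcont (fun t => G (t, y)) x)
    by (intros; apply pcont_horizontal; auto).
  unfold rect_int.
  rewrite !CInt_minus by (try lra; intros; first [apply V; lra | apply H; lra]).
  rewrite !(CInt_Chasles _ c n d) by (try lra; intros; apply V; lra).
  rewrite !(CInt_Chasles _ a m b) by (try lra; intros; apply H; lra).
  ring.
Qed.

Lemma CInt_near_const (f : R -> C) (k : C) (a b M : R) :
  a <= b -> (forall t, a <= t <= b -> pcont f t) ->
  (forall t, a <= t <= b -> Cmod (f t - k) <= M) ->
  Cmod (CInt f a b - (b - a)%R * k) <= 2 * ((b - a) * M).
Proof.
  intros Hab Hf HM.
  rewrite <- CInt_const, <- CInt_minus; auto; [|intros; apply pcont_const].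
  apply CInt_bound; auto. intros t Ht. apply pcont_minus; auto. apply pcont_const.
Qed.

(** Near a point of differentiability the affine part of [G] contributes
    nothing to the boundary integral, which is thus of smaller order than the
    squared diameter of the rectangle. *)
Lemma rect_int_local (G : C -> C) (x y eps : R) :
  cdiff G (x, y) -> 0 < eps -> exists del, 0 < del /\
  forall a b c d, a <= x <= b -> c <= y <= d -> b - a < del -> d - c < del ->
    (forall s t, a <= s <= b -> c <= t <= d -> ccont G (s, t)) ->
    Cmod (rect_int G a b c d) <= eps * ((b - a) * (b - a) + (d - c) * (d - c)).
Proof.
  intros [l Hl] He. rewrite cderiv_littleo in Hl.
  destruct (Hl (eps / 8)) as [del [Hdel H]]; [lra|].
  exists (del / 2). split; [lra|]. intros a b c d Hx Hy Hab Hcd HG.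
  assert (Near : forall s t, a <= s <= b -> c <= t <= d ->
            Cmod ((s, t) - (x, y)) <= (b - a) + (d - c)).
  { intros s t Hs Ht.
    replace ((s, t) - (x, y))%C with (RtoC (s - x) + RtoC (t - y) * Ci)%C
      by (unfold Cmult, Cminus, Cplus, Copp, RtoC, Ci; simpl; f_equal; ring).
    eapply Rle_trans; [apply Cmod_triangle|].
    rewrite Cmod_mult, !Cmod_R, Cmod_Ci, Rmult_1_r.
    apply Rplus_le_compat; apply Rabs_le; lra. }
  set (rem := fun s t => (G (s, t) - G (x, y) - l * ((s, t) - (x, y)))%C).
  assert (HR : forall s t, a <= s <= b -> c <= t <= d ->
            Cmod (rem s t) <= eps / 8 * (b - a + (d - c))).
  { intros s t Hs Ht. assert (N := Near s t Hs Ht).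
    eapply Rle_trans; [apply H; lra|]. apply Rmult_le_compat_l; lra. }
  set (M := eps / 8 * (b - a + (d - c))) in *.
  assert (I1 : Cmod (CInt (fun t => G (b, t) - G (a, t))%C c d - (d - c)%R * (l * (b - a)%R))
               <= 2 * ((d - c) * (2 * M))).
  { apply CInt_near_const; [lra| |].
    - intros t Ht. apply pcont_minus; apply pcont_vertical, HG; lra.
    - intros t Ht.
      replace (G (b, t) - G (a, t) - l * (b - a)%R)%C with (rem b t - rem a t)%C.
      + eapply Rle_trans; [apply Cmod_triangle_sub|].
        assert (A1 := HR b t ltac:(lra) Ht). assert (A2 := HR a t ltac:(lra) Ht). lra.
      + unfold rem.
        replace (RtoC (b - a)) with ((b, t) - (x, y) - ((a, t) - (x, y)))%C
          by (unfold Cminus, Cplus, Copp, RtoC; simpl; f_equal; ring). ring. }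
  assert (I2 : Cmod (CInt (fun s => G (s, d) - G (s, c))%C a b - (b - a)%R * (l * (Ci * (d - c)%R)))
               <= 2 * ((b - a) * (2 * M))).
  { apply CInt_near_const; [lra| |].
    - intros t Ht. apply pcont_minus; apply pcont_horizontal, HG; lra.
    - intros s Hs.
      replace (G (s, d) - G (s, c) - l * (Ci * (d - c)%R))%C with (rem s d - rem s c)%C.
      + eapply Rle_trans; [apply Cmod_triangle_sub|].
        assert (A1 := HR s d Hs ltac:(lra)). assert (A2 := HR s c Hs ltac:(lra)). lra.
      + unfold rem.
        replace (Ci * RtoC (d - c))%C with ((s, d) - (x, y) - ((s, c) - (x, y)))%C
          by (unfold Cmult, Ci, Cminus, Cplus, Copp, RtoC; simpl; f_equal; ring). ring. }
  unfold rect_int.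
  set (J1 := CInt (fun t => G (b, t) - G (a, t))%C c d) in *.
  set (J2 := CInt (fun s => G (s, d) - G (s, c))%C a b) in *.
  replace (Ci * J1 - J2)%C
    with (Ci * (J1 - (d - c)%R * (l * (b - a)%R)) - (J2 - (b - a)%R * (l * (Ci * (d - c)%R))))%C by ring.
  eapply Rle_trans; [apply Cmod_triangle_sub|]. rewrite Cmod_mult, Cmod_Ci.
  unfold M in *. set (u := b - a) in *. set (v := d - c) in *.
  assert (0 <= u) by (unfold u; lra). assert (0 <= v) by (unfold v; lra).
  apply Rle_trans with (2 * (v * (2 * (eps / 8 * (u + v)))) + 2 * (u * (2 * (eps / 8 * (u + v))))); [lra|].
  replace (2 * (v * (2 * (eps / 8 * (u + v)))) + 2 * (u * (2 * (eps / 8 * (u + v)))))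
    with (eps * ((u + v) * (u + v) / 2)) by field.
  apply Rmult_le_compat_l; [lra|]. assert (Sq := Rle_0_sqr (u - v)). unfold Rsqr in Sq. lra.
Qed.

Lemma goursat_rectangle (G : C -> C) (a b c d : R) :
  a <= b -> c <= d ->
  (forall x y, a <= x <= b -> c <= y <= d -> cdiff G (x, y)) ->
  rect_int G a b c d = 0.
Proof.
  intros Hab Hcd HG.
  assert (K : forall eps, 0 < eps ->
    Cmod (rect_int G a b c d) <= eps * ((b - a) * (b - a) + (d - c) * (d - c))).
  { intros eps He.
    apply (rectangle_induction (fun a b c d =>
      Cmod (rect_int G a b c d) <= eps * ((b - a) * (b - a) + (d - c) * (d - c)))); auto.
    - intros a' b' c' d' A1 A2 A3 A4 A5 A6 Q1 Q2 Q3 Q4.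
      rewrite (rect_int_split G a' ((a' + b') / 2) b' c' ((c' + d') / 2) d') by
        (try lra; intros; apply cdiff_cont, HG; lra).
      eapply Rle_trans; [apply Cmod_triangle|].
      eapply Rle_trans; [apply Rplus_le_compat_r, Cmod_triangle|].
      eapply Rle_trans; [apply Rplus_le_compat_r, Rplus_le_compat_r, Cmod_triangle|].
      replace (eps * ((b' - a') * (b' - a') + (d' - c') * (d' - c'))) with
        (4 * (eps * ((b' - a') / 2 * ((b' - a') / 2) + (d' - c') / 2 * ((d' - c') / 2)))) by field.
      replace ((a' + b') / 2 - a') with ((b' - a') / 2) in * by lra.
      replace (b' - (a' + b') / 2) with ((b' - a') / 2) in * by lra.
      replace ((c' + d') / 2 - c') with ((d' - c') / 2) in * by lra.
      replace (d' - (c' + d') / 2) with ((d' - c') / 2) in * by lra.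
      lra.
    - intros x y Hx Hy.
      destruct (rect_int_local G x y eps (HG x y Hx Hy) He) as [del [Hdel H]].
      exists del. split; [exact Hdel|]. intros a' b' c' d' A1 A2 A3 A4 A5 A6.
      apply H; try lra. intros s t Hs Ht. apply cdiff_cont, HG; lra. }
  set (D := (b - a) * (b - a) + (d - c) * (d - c)) in *.
  assert (HD : 0 <= D) by (unfold D; nra).
  apply Cmod_eq_0. apply Rle_antisym; [|apply Cmod_ge_0].
  apply le_epsilon. intros e He. rewrite Rplus_0_l.
  eapply Rle_trans; [apply (K (e / (D + 1)))|].
  - apply Rdiv_lt_0_compat; lra.
  - apply Rmult_le_reg_r with (D + 1); [lra|].
    replace (e / (D + 1) * D * (D + 1)) with (e * D) by (field; lra). nra.
Qed.

Definition circle_int (g : C -> C) (r : R) : C :=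
  CInt (fun t => g (RtoC r * Cexpi t)%C) 0 (2 * PI).

Lemma Cmod_circle (r t : R) : 0 <= r -> Cmod (RtoC r * Cexpi t) = r.
Proof. intros Hr. rewrite Cmod_mult, Cmod_Cexpi, Cmod_R, Rabs_pos_eq by exact Hr. ring. Qed.

Lemma pcont_circle (g : C -> C) (r t : R) :
  ccont g (RtoC r * Cexpi t)%C -> pcont (fun s => g (RtoC r * Cexpi s)%C) t.
Proof. intros H. apply (pcont_comp g); [apply pcont_scal, pcont_Cexpi|exact H]. Qed.

(** In the coordinate [log z] an annulus is a rectangle whose horizontal sides
    carry the same values. *)
Lemma circle_int_const (g : C -> C) (r1 r2 : R) :
  0 < r1 <= r2 -> (forall z, r1 <= Cmod z <= r2 -> cdiff g z) ->
  circle_int g r1 = circle_int g r2.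
Proof.
  intros Hr Hg.
  assert (P := PI_RGT_0).
  assert (L : ln r1 <= ln r2) by (destruct (Req_dec r1 r2) as [->|]; [lra|left; apply ln_increasing; lra]).
  set (G := fun u => g (Cexp u)).
  assert (HC : forall x y, ln r1 <= x <= ln r2 -> cdiff G (x, y)).
  { intros x y Hx. apply (cdiff_comp g Cexp); [eexists; apply cderiv_Cexp|].
    apply Hg. rewrite Cmod_Cexp. simpl.
    rewrite <- (exp_ln r1), <- (exp_ln r2) by lra.
    assert (Mon : forall u v, u <= v -> exp u <= exp v).
    { intros u v [Huv| ->]; [left; now apply exp_increasing|lra]. }
    split; apply Mon; rewrite ?exp_ln by lra; lra. }
  assert (Z := goursat_rectangle G (ln r1) (ln r2) 0 (2 * PI) L ltac:(lra)
                 (fun x y Hx _ => HC x y Hx)).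
  unfold rect_int in Z.
  rewrite (CInt_ext (fun x => G (x, (2 * PI)%R) - G (x, 0))%C (fun _ => RtoC 0)) in Z.
  2: exact L.
  2:{ intros t _. unfold G, Cexp. simpl. rewrite Cexpi_0, Cexpi_2PI. ring. }
  rewrite CInt_const in Z.
  rewrite CInt_minus in Z; [|lra| |].
  2:{ intros t _. apply pcont_vertical, cdiff_cont, HC. lra. }
  2:{ intros t _. apply pcont_vertical, cdiff_cont, HC. lra. }
  assert (E : forall r, 0 < r -> CInt (fun y => G (ln r, y)) 0 (2 * PI) = circle_int g r).
  { intros r H. apply CInt_ext; [lra|]. intros t _. unfold G, Cexp. simpl.
    now rewrite exp_ln. }
  rewrite !E in Z by lra.
  replace (circle_int g r1) with
    (circle_int g r2 + Ci * (Ci * (circle_int g r2 - circle_int g r1) - (ln r2 - ln r1)%R * 0))%C.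
  - rewrite Z. ring.
  - replace (Ci * (Ci * (circle_int g r2 - circle_int g r1) - (ln r2 - ln r1)%R * 0))%C
      with ((Ci * Ci) * (circle_int g r2 - circle_int g r1))%C by ring.
    replace (Ci * Ci)%C with (- (1))%C
      by (unfold Cmult, Copp, Ci, RtoC; simpl; f_equal; ring). ring.
Qed.

(** * Cauchy's formula and its consequences *)

Lemma eps_zero (x K : R) : 0 <= x -> (forall e, 0 < e -> x <= K * e) -> x = 0.
Proof.
  intros Hx H. apply Rle_antisym; [|exact Hx]. apply le_epsilon. intros e He.
  assert (A := H 1 ltac:(lra)).
  eapply Rle_trans; [apply (H (e / (K + 1)))|].
  - apply Rdiv_lt_0_compat; lra.
  - apply Rmult_le_reg_r with (K + 1); [lra|].
    replace (K * (e / (K + 1)) * (K + 1)) with (K * e) by (field; lra). nra.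
Qed.

Lemma circle_int_bound (g : C -> C) (r M : R) :
  0 <= r -> (forall z, Cmod z = r -> ccont g z) -> (forall z, Cmod z = r -> Cmod (g z) <= M) ->
  Cmod (circle_int g r) <= 4 * PI * M.
Proof.
  intros Hr Hg HM. assert (P := PI_RGT_0).
  replace (4 * PI * M) with (2 * ((2 * PI - 0) * M)) by ring.
  apply CInt_bound; [lra| |]; intros t _.
  - apply pcont_circle, Hg, Cmod_circle, Hr.
  - apply HM, Cmod_circle, Hr.
Qed.

Lemma circle_int_plus (g h : C -> C) (r : R) :
  0 <= r -> (forall z, Cmod z = r -> ccont g z) -> (forall z, Cmod z = r -> ccont h z) ->
  circle_int (fun z => g z + h z)%C r = (circle_int g r + circle_int h r)%C.
Proof.
  intros Hr Hg Hh. assert (P := PI_RGT_0). unfold circle_int.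
  apply (CInt_plus (fun t => g (r * Cexpi t)%C) (fun t => h (r * Cexpi t)%C)); [lra| |];
    intros; apply pcont_circle; [apply Hg|apply Hh]; now apply Cmod_circle.
Qed.

Lemma circle_int_scal (c : C) (g : C -> C) (r : R) :
  0 <= r -> (forall z, Cmod z = r -> ccont g z) ->
  circle_int (fun z => c * g z)%C r = (c * circle_int g r)%C.
Proof.
  intros Hr Hg. assert (P := PI_RGT_0). unfold circle_int.
  apply (CInt_scal c (fun t => g (r * Cexpi t)%C)); [lra|].
  intros; apply pcont_circle, Hg, Cmod_circle, Hr.
Qed.

Lemma circle_int_ext (g h : C -> C) (r : R) :
  0 <= r -> (forall z, Cmod z = r -> g z = h z) -> circle_int g r = circle_int h r.
Proof.
  intros Hr H. assert (P := PI_RGT_0). apply CInt_ext; [lra|].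
  intros t _. apply H, Cmod_circle, Hr.
Qed.

(** The circle integral is a continuous function of the radius and is locally
    constant away from the radii [0] and [Cmod z]; it is [0] at radius [0]. *)
Lemma circle_int_zero (h : C -> C) (z : C) (r : R) :
  Cmod z < r -> h 0 = 0 ->
  (forall w, Cmod w <= r -> ccont h w) ->
  (forall w, Cmod w <= r -> w <> 0 -> w <> z -> cdiff h w) ->
  circle_int h r = 0.
Proof.
  intros Hz H0 Hc Hd. assert (P := PI_RGT_0). assert (Z0 := Cmod_ge_0 z).
  assert (Cont : forall e, 0 < e -> exists d, 0 < d /\ forall a b, 0 <= a <= b -> b <= r ->
            b - a < d -> Cmod (circle_int h b - circle_int h a) <= 4 * PI * e).
  { intros e He. destruct (uniform_continuity_disc r h Hc e He) as [d [Hd0 H]].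
    exists d. split; [exact Hd0|]. intros a b Hab Hbr Hd1.
    unfold circle_int. rewrite <- CInt_minus; [|lra| |].
    - replace (4 * PI * e) with (2 * ((2 * PI - 0) * e)) by ring.
      apply CInt_bound; [lra| |].
      + intros t _. apply pcont_minus; apply pcont_circle, Hc; rewrite Cmod_circle; lra.
      + intros t _. left. apply H; [rewrite Cmod_circle; lra|].
        replace (b * Cexpi t - a * Cexpi t)%C with (RtoC (b - a) * Cexpi t)%C
          by (rewrite RtoC_minus; ring).
        rewrite Cmod_circle; lra.
    - intros t _. apply pcont_circle, Hc; rewrite Cmod_circle; lra.
    - intros t _. apply pcont_circle, Hc; rewrite Cmod_circle; lra. }
  assert (Ends : forall a b, 0 <= a < b -> b <= r -> (Cmod z <= a \/ b <= Cmod z) ->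
            circle_int h a = circle_int h b).
  { intros a b Hab Hb Hsep.
    assert (E : Cmod (circle_int h b - circle_int h a) = 0).
    { apply eps_zero with (8 * PI); [apply Cmod_ge_0|]. intros e He.
      destruct (Cont e He) as [d [Hd0 H]].
      set (m := Rmin (d / 2) ((b - a) / 3)).
      assert (M0 : 0 < m) by (apply Rmin_glb_lt; lra).
      assert (M1 : m <= d / 2) by apply Rmin_l.
      assert (M2 : m <= (b - a) / 3) by apply Rmin_r.
      assert (EQ : circle_int h (a + m) = circle_int h (b - m)).
      { apply circle_int_const; [lra|]. intros w Hw. apply Hd; [lra| |].
        - apply Cmod_pos_neq. lra.
        - intros ->. lra. }
      assert (A1 := H a (a + m) ltac:(lra) ltac:(lra) ltac:(lra)).
      assert (A2 := H (b - m) b ltac:(lra) ltac:(lra) ltac:(lra)).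
      replace (circle_int h b - circle_int h a)%C with
        ((circle_int h b - circle_int h (b - m)) + (circle_int h (a + m) - circle_int h a))%C
        by (rewrite EQ; ring).
      eapply Rle_trans; [apply Cmod_triangle|]. lra. }
    apply Cmod_eq_0 in E.
    replace (circle_int h b) with (circle_int h b - circle_int h a + circle_int h a)%C by ring.
    rewrite E. ring. }
  assert (C0 : circle_int h 0 = 0).
  { unfold circle_int. rewrite (CInt_ext _ (fun _ => RtoC 0)); [|lra|].
    - rewrite CInt_const. ring.
    - intros t _. replace (0 * Cexpi t)%C with (RtoC 0) by ring. exact H0. }
  rewrite <- (Ends (Cmod z) r); [|lra|lra|now left; lra].
  destruct (Req_dec (Cmod z) 0) as [->|Hn]; [exact C0|].
  rewrite <- (Ends 0 (Cmod z)); [exact C0|lra|lra|right; lra].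
Qed.

Lemma circle_sub_neq (z w : C) (r : R) : Cmod z < r -> Cmod w = r -> (w - z)%C <> 0.
Proof. intros Hz Hw. apply Csub_neq_0. intros ->. lra. Qed.

Lemma ccont_kernel (z w : C) : w <> z -> ccont (fun y => y / (y - z))%C w.
Proof.
  intros H. apply ccont_div; [apply ccont_id| |now apply Csub_neq_0].
  apply ccont_minus; [apply ccont_id|apply ccont_const].
Qed.

Lemma circle_int_kernel (z : C) (r : R) :
  Cmod z < r -> circle_int (fun w => w / (w - z))%C r = RtoC (2 * PI).
Proof.
  intros Hz. assert (Z0 := Cmod_ge_0 z). assert (P := PI_RGT_0).
  assert (K : forall s, Cmod z < s -> forall w, Cmod w = s -> ccont (fun y => z / (y - z))%C w).
  { intros s Hs w Hw. apply ccont_div; [apply ccont_const| |eapply circle_sub_neq; eauto].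
    apply ccont_minus; [apply ccont_id|apply ccont_const]. }
  (* the integral does not depend on the radius and tends to 0 at infinity *)
  assert (V : circle_int (fun w => z / (w - z))%C r = 0).
  { apply Cmod_eq_0. apply eps_zero with (4 * PI * (Cmod z + 1)); [apply Cmod_ge_0|].
    intros e He.
    assert (I : 0 < / e) by now apply Rinv_0_lt_compat.
    rewrite (circle_int_const _ r (r + / e)).
    - replace (4 * PI * (Cmod z + 1) * e) with (4 * PI * ((Cmod z + 1) * e)) by ring.
      apply circle_int_bound; [lra|apply K; lra|].
      intros w Hw. assert (N := circle_sub_neq z w (r + / e) ltac:(lra) Hw).
      rewrite Cmod_div by exact N.
      assert (T := Cmod_triangle_rev w z). rewrite Hw in T.
      apply Rmult_le_reg_r with (Cmod (w - z)); [lra|].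
      unfold Rdiv. rewrite Rmult_assoc, Rinv_l by lra. rewrite Rmult_1_r.
      apply Rle_trans with ((Cmod z + 1) * e * / e).
      + rewrite Rmult_assoc, Rinv_r by lra. lra.
      + apply Rmult_le_compat_l; [nra|lra].
    - lra.
    - intros w Hw. apply cdiff_div; [apply cdiff_const| |].
      + apply cdiff_minus; [apply cdiff_id|apply cdiff_const].
      + apply Csub_neq_0. intros ->. lra. }
  rewrite (circle_int_ext _ (fun w => 1 + z / (w - z))%C); [|lra|].
  - rewrite circle_int_plus; [|lra|intros; apply ccont_const|apply K; lra].
    rewrite V. unfold circle_int. rewrite CInt_const.
    rewrite Rminus_0_r. ring.
  - intros w Hw. field. eapply circle_sub_neq; eauto.
Qed.

(** The quotient [(g w - g z) w / (w - z)] is continuous, vanishes at the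
    origin, and is holomorphic except at [0] and [z]. *)
Theorem cauchy_formula (g : C -> C) (r : R) (z : C) :
  Cmod z < r ->
  (forall w, Cmod w <= r -> ccont g w) ->
  (forall w, Cmod w <= r -> w <> 0 -> cdiff g w) ->
  circle_int (fun w => g w * (w / (w - z)))%C r = (RtoC (2 * PI) * g z)%C.
Proof.
  intros Hz Hc Hd. assert (Z0 := Cmod_ge_0 z).
  assert (Q : exists q : C -> C, (forall w, w <> z -> q w = ((g w - g z) / (w - z))%C) /\
                (z <> 0 -> ccont q z)).
  { destruct (classic (z = 0)) as [E|N].
    - exists (fun w => (g w - g z) / (w - z))%C. split; [reflexivity|contradiction].
    - destruct (Hd z ltac:(lra) N) as [l [phi [Hp [_ H]]]].
      exists phi. split; [|auto]. intros w Hw. rewrite (H w). field. now apply Csub_neq_0. }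
  destruct Q as [q [Hq Hqz]].
  assert (Off : forall w, Cmod w <= r -> w <> z -> exists d, 0 < d /\
            forall y, Cmod (y - w) < d -> ((g y - g z) * (y / (y - z)) = q y * y)%C).
  { intros w Hw Hn. exists (Cmod (w - z)). split; [now apply Cmod_diff_neq|].
    intros y Hy.
    assert (y <> z) by (intros ->; rewrite Cmod_sub_sym in Hy; lra).
    rewrite Hq by assumption. field. now apply Csub_neq_0. }
  assert (V : circle_int (fun w => q w * w)%C r = 0).
  { apply circle_int_zero with z; auto.
    - ring.
    - intros w Hw. destruct (classic (w = z)) as [->|Hn].
      + destruct (classic (z = 0)) as [E|N].
        * (* at the centre the function is [g - g 0], which is only known to be continuous *)
          subst z. apply ccont_ext with (fun y => g y - g 0)%C.
          -- intros y. destruct (classic (y = 0)) as [->|Hy]; [ring|].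
             rewrite Hq by exact Hy. field. exact Hy.
          -- apply ccont_minus; [now apply Hc|apply ccont_const].
        * apply ccont_mult; [now apply Hqz|apply ccont_id].
      + destruct (Off w Hw Hn) as [d [Hd0 HE]].
        apply (ccont_ext_near _ _ _ d Hd0 HE). apply ccont_mult.
        * apply ccont_minus; [now apply Hc|apply ccont_const].
        * now apply ccont_kernel.
    - intros w Hw H0 Hn. destruct (Off w Hw Hn) as [d [Hd0 HE]].
      apply (cdiff_ext_near _ _ _ d Hd0 HE). apply cdiff_mult.
      + apply cdiff_minus; [now apply Hd|apply cdiff_const].
      + apply cdiff_div; [apply cdiff_id| |now apply Csub_neq_0].
        apply cdiff_minus; [apply cdiff_id|apply cdiff_const]. }
  assert (Cw : forall w, Cmod w = r -> ccont (fun y => y / (y - z))%C w).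
  { intros w Hw. apply ccont_kernel. intros ->. lra. }
  rewrite (circle_int_ext _ (fun w => q w * w + g z * (w / (w - z)))%C); [|lra|].
  - rewrite circle_int_plus; [|lra| |].
    + rewrite V, circle_int_scal, circle_int_kernel; [ring|exact Hz|lra|exact Cw].
    + intros w Hw. destruct (Off w) as [d [Hd0 HE]]; [lra|intros ->; lra|].
      apply (ccont_ext_near _ _ _ d Hd0 HE). apply ccont_mult; [|now apply Cw].
      apply ccont_minus; [apply Hc; lra|apply ccont_const].
    + intros w Hw. apply ccont_mult; [apply ccont_const|now apply Cw].
  - intros w Hw. assert (w <> z) by (intros ->; lra).
    rewrite Hq by assumption. field. now apply Csub_neq_0.
Qed.

(** Differentiation of Cauchy integrals under the integral sign rests on
    kernels [K y t] that are bounded, and continuous in [y] uniformly in [t]. *)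
Definition ucont (K : C -> R -> C) (z : C) : Prop :=
  (exists M d, 0 < d /\ forall y t, Cmod (y - z) < d -> Cmod (K y t) <= M) /\
  (forall e, 0 < e -> exists d, 0 < d /\ forall y t, Cmod (y - z) < d -> Cmod (K y t - K z t) <= e).

Lemma ucont_mult (K L : C -> R -> C) (z : C) :
  ucont K z -> ucont L z -> ucont (fun y t => K y t * L y t)%C z.
Proof.
  intros [[M [d [Hd HM]]] HK] [[M' [d' [Hd' HM']]] HL]. split.
  - exists (M * M'), (Rmin d d'). split; [now apply Rmin_glb_lt|]. intros y t Hy.
    rewrite Cmod_mult. apply Rmult_le_compat; try apply Cmod_ge_0.
    + apply HM. eapply Rlt_le_trans; [exact Hy|apply Rmin_l].
    + apply HM'. eapply Rlt_le_trans; [exact Hy|apply Rmin_r].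
  - intros e He.
    assert (M0 : 0 <= M).
    { eapply Rle_trans; [apply Cmod_ge_0|apply (HM z 0)].
      now rewrite Cmod_sub_diag. }
    assert (M0' : 0 <= M').
    { eapply Rle_trans; [apply Cmod_ge_0|apply (HM' z 0)].
      now rewrite Cmod_sub_diag. }
    set (eta := e / (M + M' + 1)).
    assert (Heta : 0 < eta) by (apply Rdiv_lt_0_compat; lra).
    assert (Eeta : eta * (M + M' + 1) = e) by (unfold eta; field; lra).
    destruct (HK eta Heta) as [d1 [Hd1 H1]]. destruct (HL eta Heta) as [d2 [Hd2 H2]].
    exists (Rmin (Rmin d d') (Rmin d1 d2)). split; [repeat apply Rmin_glb_lt; assumption|].
    intros y t Hy.
    assert (B1 : Cmod (y - z) < d /\ Cmod (y - z) < d1 /\ Cmod (y - z) < d2).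
    { repeat split; eapply Rlt_le_trans; try exact Hy;
      [ eapply Rle_trans; [apply Rmin_l|apply Rmin_l]
      | eapply Rle_trans; [apply Rmin_r|apply Rmin_l]
      | eapply Rle_trans; [apply Rmin_r|apply Rmin_r] ]. }
    destruct B1 as [B1 [B2 B3]].
    assert (Q1 := HM y t B1). assert (Q2 := H1 y t B2). assert (Q3 := H2 y t B3).
    assert (Q4 : Cmod (L z t) <= M').
    { apply HM'. now rewrite Cmod_sub_diag. }
    replace (K y t * L y t - K z t * L z t)%C
      with (K y t * (L y t - L z t) + L z t * (K y t - K z t))%C by ring.
    eapply Rle_trans; [apply Cmod_triangle|]. rewrite !Cmod_mult.
    assert (P1 := Cmod_ge_0 (K y t)). assert (P2 := Cmod_ge_0 (L z t)).
    assert (P3 := Cmod_ge_0 (K y t - K z t)). assert (P4 := Cmod_ge_0 (L y t - L z t)).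
    assert (S1 := Rmult_le_compat _ _ _ _ P1 P4 Q1 Q3).
    assert (S2 := Rmult_le_compat _ _ _ _ P2 P3 Q4 Q2). lra.
Qed.

Lemma ucont_plus (K L : C -> R -> C) (z : C) :
  ucont K z -> ucont L z -> ucont (fun y t => K y t + L y t)%C z.
Proof.
  intros [[M [d [Hd HM]]] HK] [[M' [d' [Hd' HM']]] HL]. split.
  - exists (M + M'), (Rmin d d'). split; [now apply Rmin_glb_lt|]. intros y t Hy.
    eapply Rle_trans; [apply Cmod_triangle|]. apply Rplus_le_compat.
    + apply HM. eapply Rlt_le_trans; [exact Hy|apply Rmin_l].
    + apply HM'. eapply Rlt_le_trans; [exact Hy|apply Rmin_r].
  - intros e He. destruct (HK (e / 2)) as [d1 [Hd1 H1]]; [lra|].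
    destruct (HL (e / 2)) as [d2 [Hd2 H2]]; [lra|].
    exists (Rmin d1 d2). split; [now apply Rmin_glb_lt|]. intros y t Hy.
    assert (Q2 := H1 y t (Rlt_le_trans _ _ _ Hy (Rmin_l _ _))).
    assert (Q3 := H2 y t (Rlt_le_trans _ _ _ Hy (Rmin_r _ _))).
    replace (K y t + L y t - (K z t + L z t))%C
      with ((K y t - K z t) + (L y t - L z t))%C by ring.
    eapply Rle_trans; [apply Cmod_triangle|]. lra.
Qed.

Lemma ucont_const (phi : R -> C) (M : R) (z : C) :
  (forall t, Cmod (phi t) <= M) -> ucont (fun _ => phi) z.
Proof.
  intros H. split.
  - exists M, 1. split; [lra|auto].
  - intros e He. exists 1. split; [lra|]. intros y t _.
    replace (phi t - phi t)%C with (RtoC 0) by ring. rewrite Cmod_0. lra.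
Qed.

Lemma kernel_lower (r t : R) (y : C) : 0 <= r -> r - Cmod y <= Cmod (RtoC r * Cexpi t - y).
Proof.
  intros Hr. assert (T := Cmod_triangle_rev (RtoC r * Cexpi t) y).
  now rewrite Cmod_circle in T.
Qed.

Lemma ucont_kernel (r : R) (z : C) :
  Cmod z < r -> ucont (fun y t => / (RtoC r * Cexpi t - y))%C z.
Proof.
  intros Hz. assert (Z0 := Cmod_ge_0 z). set (d := (r - Cmod z) / 2).
  assert (Hd : 0 < d) by (unfold d; lra).
  assert (Low : forall y t, Cmod (y - z) < d -> d <= Cmod (RtoC r * Cexpi t - y)).
  { intros y t Hy. assert (T := kernel_lower r t y ltac:(lra)).
    assert (S := Cmod_triangle_rev y z). unfold d in *. lra. }
  assert (Neq : forall y t, Cmod (y - z) < d -> (RtoC r * Cexpi t - y)%C <> 0).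
  { intros y t Hy. apply Cmod_pos_neq. specialize (Low y t Hy). lra. }
  split.
  - exists (/ d), d. split; [exact Hd|]. intros y t Hy.
    rewrite Cmod_inv by now apply Neq. apply Rinv_le_contravar; [exact Hd|now apply Low].
  - intros e He. exists (Rmin d (e * (d * d))). split.
    { apply Rmin_glb_lt; [exact Hd|]. apply Rmult_lt_0_compat; [exact He|now apply Rmult_lt_0_compat]. }
    intros y t Hy.
    assert (Hy1 := Rlt_le_trans _ _ _ Hy (Rmin_l _ _)).
    assert (Hy2 := Rlt_le_trans _ _ _ Hy (Rmin_r _ _)).
    assert (Hz1 : Cmod (z - z) < d).
    { now rewrite Cmod_sub_diag. }
    assert (N1 := Neq y t Hy1). assert (N2 := Neq z t Hz1).
    assert (L1 := Low y t Hy1). assert (L2 := Low z t Hz1).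
    set (a := (RtoC r * Cexpi t - y)%C) in *. set (b := (RtoC r * Cexpi t - z)%C) in *.
    replace (/ a - / b)%C with ((y - z) / (a * b))%C
      by (unfold a, b in *; field; split; assumption).
    rewrite Cmod_div, Cmod_mult by now apply Cmult_neq_0.
    apply Rmult_le_reg_r with (Cmod a * Cmod b); [nra|].
    unfold Rdiv. rewrite Rmult_assoc, Rinv_l by nra. rewrite Rmult_1_r.
    apply Rle_trans with (e * (d * d)); [lra|].
    apply Rmult_le_compat_l; [lra|]. apply Rmult_le_compat; lra.
Qed.

Lemma ccont_CInt (K : C -> R -> C) (a b : R) (z : C) (d : R) :
  a <= b -> 0 < d -> (forall y t, Cmod (y - z) < d -> pcont (K y) t) -> ucont K z ->
  ccont (fun y => CInt (K y) a b) z.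
Proof.
  intros Hab Hd HK [_ HU] e He.
  set (eta := e / (2 * (b - a) + 1) / 2).
  assert (Heta : 0 < eta) by (unfold eta; assert (0 < e / (2 * (b - a) + 1)) by (apply Rdiv_lt_0_compat; lra); lra).
  destruct (HU eta Heta) as [d1 [Hd1 H1]].
  exists (Rmin d d1). split; [now apply Rmin_glb_lt|]. intros y Hy.
  assert (Hy1 := Rlt_le_trans _ _ _ Hy (Rmin_l _ _)).
  assert (Hy2 := Rlt_le_trans _ _ _ Hy (Rmin_r _ _)).
  assert (Hz1 : Cmod (z - z) < d).
  { now rewrite Cmod_sub_diag. }
  rewrite <- CInt_minus by auto.
  apply Rle_lt_trans with (2 * ((b - a) * eta)).
  - apply CInt_bound; auto. intros t _. apply pcont_minus; auto.
  - assert (E : 2 * (2 * (b - a) + 1) * eta = e) by (unfold eta; field; lra). nra.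
Qed.

Lemma kernel_neq (r : R) (y : C) (t : R) : Cmod y < r -> (RtoC r * Cexpi t - y)%C <> 0.
Proof.
  intros Hy. apply Cmod_pos_neq. assert (Y := Cmod_ge_0 y).
  assert (T := kernel_lower r t y ltac:(lra)). lra.
Qed.

Lemma pcont_kernel (r : R) (y : C) (t : R) :
  Cmod y < r -> pcont (fun s => / (RtoC r * Cexpi s - y))%C t.
Proof.
  intros Hy. apply (pcont_circle (fun w => / (w - y))%C).
  apply ccont_inv; [apply ccont_minus; [apply ccont_id|apply ccont_const]|].
  now apply kernel_neq.
Qed.

Lemma near_in_disc (r : R) (z y : C) : Cmod (y - z) < r - Cmod z -> Cmod y < r.
Proof. intros H. assert (T := Cmod_triangle_rev y z). lra. Qed.

Lemma cauchy_integral_deriv (phi : R -> C) (r M : R) (z : C) :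
  (forall t, pcont phi t) -> (forall t, Cmod (phi t) <= M) -> Cmod z < r ->
  cderiv (fun y => CInt (fun t => phi t * / (RtoC r * Cexpi t - y))%C 0 (2 * PI)) z
         (CInt (fun t => phi t * (/ (RtoC r * Cexpi t - z) * / (RtoC r * Cexpi t - z)))%C
            0 (2 * PI)).
Proof.
  set (k := fun (y : C) (t : R) => (/ (RtoC r * Cexpi t - y))%C).
  intros Hphi HM Hz. assert (P := PI_RGT_0).
  assert (Z := near_in_disc r z).
  apply cderiv_near with (fun y => CInt (fun t => phi t * (k y t * k z t))%C 0 (2 * PI)) (r - Cmod z).
  - lra.
  - apply (ccont_CInt (fun y t => phi t * (k y t * k z t))%C) with (r - Cmod z); [lra|lra| |].
    + intros y t Hy. repeat apply pcont_mult; auto; apply pcont_kernel; auto.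
    + apply ucont_mult; [apply ucont_const with M, HM|].
      apply ucont_mult; [now apply ucont_kernel|].
      destruct (ucont_kernel r z Hz) as [[M' [d [Hd H]]] _].
      apply ucont_const with M'. intros t. apply (H z t).
      now rewrite Cmod_sub_diag.
  - reflexivity.
  - intros y Hy. specialize (Z y Hy). change (fun t => phi t * / (RtoC r * Cexpi t - y))%C with (fun t => phi t * k y t)%C.
    rewrite (CInt_ext (fun t => phi t * k y t)%C
              (fun t => phi t * k z t + (y - z) * (phi t * (k y t * k z t)))%C).
    + rewrite CInt_plus; [|lra| |].
      * rewrite CInt_scal; [unfold k; cbv beta; ring|lra|].
        intros; repeat apply pcont_mult; auto; apply pcont_kernel; auto.
      * intros; repeat apply pcont_mult; auto; apply pcont_kernel; auto.
      * intros; apply pcont_scal; repeat apply pcont_mult; auto; apply pcont_kernel; auto.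
    + lra.
    + intros t _. unfold k. field. split; now apply kernel_neq.
Qed.

Lemma cauchy_integral_deriv_diff (phi : R -> C) (r M : R) (z : C) :
  (forall t, pcont phi t) -> (forall t, Cmod (phi t) <= M) -> Cmod z < r ->
  cdiff (fun y => CInt (fun t =>
      phi t * (/ (RtoC r * Cexpi t - y) * / (RtoC r * Cexpi t - y)))%C 0 (2 * PI)) z.
Proof.
  set (k := fun (y : C) (t : R) => (/ (RtoC r * Cexpi t - y))%C).
  intros Hphi HM Hz. assert (P := PI_RGT_0).
  assert (Z := near_in_disc r z).
  assert (Kz : ucont (fun _ => k z) z).
  { destruct (ucont_kernel r z Hz) as [[M' [d [Hd H]]] _].
    apply ucont_const with M'. intros t. apply (H z t).
    now rewrite Cmod_sub_diag. }
  set (L := fun y t => (phi t * (k y t * (k z t * (k y t + k z t))))%C).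
  assert (HL : forall y t, Cmod (y - z) < r - Cmod z -> pcont (L y) t).
  { intros y t Hy. apply pcont_mult; auto. apply pcont_mult; [apply pcont_kernel; auto|].
    apply pcont_mult; [apply pcont_kernel; auto|].
    apply pcont_plus; apply pcont_kernel; auto. }
  exists (CInt (L z) 0 (2 * PI)).
  apply cderiv_near with (fun y => CInt (L y) 0 (2 * PI)) (r - Cmod z).
  - lra.
  - apply ccont_CInt with (r - Cmod z); [lra|lra|exact HL|].
    apply ucont_mult; [apply ucont_const with M, HM|].
    apply ucont_mult; [now apply ucont_kernel|].
    apply ucont_mult; [exact Kz|]. apply ucont_plus; [now apply ucont_kernel|exact Kz].
  - reflexivity.
  - intros y Hy. assert (Zy := Z y Hy).
    rewrite (CInt_ext (fun t => phi t * (k y t * k y t))%C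
              (fun t => phi t * (k z t * k z t) + (y - z) * L y t)%C).
    + rewrite CInt_plus; [|lra| |].
      * rewrite CInt_scal; [unfold k; cbv beta; ring|lra|auto].
      * intros; repeat apply pcont_mult; auto; apply pcont_kernel; auto.
      * intros; apply pcont_scal; auto.
    + lra.
    + intros t _. unfold L, k. field. split; now apply kernel_neq.
Qed.

(** The centre may be an exceptional point: this contains the theorem on
    removable singularities. *)
Theorem holomorphic_derivative (g : C -> C) (r : R) :
  0 < r ->
  (forall w, Cmod w <= r -> ccont g w) ->
  (forall w, Cmod w <= r -> w <> 0 -> cdiff g w) ->
  exists g' : C -> C, forall z, Cmod z < r -> cderiv g z (g' z) /\ cdiff g' z.
Proof.
  intros Hr Hc Hd. assert (P := PI_RGT_0).
  destruct (bounded_on_disc r g Hc) as [M [HM0 HM]].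
  set (phi := fun t => (g (RtoC r * Cexpi t) * (RtoC r * Cexpi t) / RtoC (2 * PI))%C).
  assert (P2 : RtoC (2 * PI) <> 0) by (apply RtoC_pos_neq; lra).
  assert (Hphi : forall t, pcont phi t).
  { intros t. apply (pcont_circle (fun w => g w * w / RtoC (2 * PI))%C).
    apply ccont_div; [|apply ccont_const|exact P2].
    apply ccont_mult; [apply Hc; rewrite Cmod_circle; lra|apply ccont_id]. }
  assert (Mphi : forall t, Cmod (phi t) <= M * r / (2 * PI)).
  { intros t. unfold phi. rewrite Cmod_div, Cmod_mult, Cmod_circle by (auto; lra).
    rewrite Cmod_R, (Rabs_pos_eq (2 * PI)) by lra.
    apply Rmult_le_compat_r; [left; apply Rinv_0_lt_compat; lra|].
    apply Rmult_le_compat_r; [lra|]. apply HM. rewrite Cmod_circle; lra. }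
  exists (fun y => CInt (fun t => phi t * (/ (RtoC r * Cexpi t - y) * / (RtoC r * Cexpi t - y)))%C 0 (2 * PI)).
  intros z Hz. split; [|now apply (cauchy_integral_deriv_diff phi r _ z Hphi Mphi)].
  apply cderiv_ext_near with
    (fun y => CInt (fun t => phi t * / (RtoC r * Cexpi t - y))%C 0 (2 * PI)) (r - Cmod z).
  - lra.
  - intros y Hy. assert (Yr : Cmod y < r) by (assert (T := Cmod_triangle_rev y z); lra).
    assert (F := cauchy_formula g r y Yr Hc Hd).
    replace (g y) with (/ RtoC (2 * PI) * (RtoC (2 * PI) * g y))%C by (field; exact P2).
    rewrite <- F. unfold circle_int.
    assert (PK : forall t, pcont (fun t => g (RtoC r * Cexpi t)
              * (RtoC r * Cexpi t / (RtoC r * Cexpi t - y)))%C t).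
    { intros t. apply (pcont_circle (fun w => g w * (w / (w - y)))%C).
      apply ccont_mult; [apply Hc; rewrite Cmod_circle; lra|].
      apply ccont_kernel. intros E. rewrite <- E, Cmod_circle in Yr; lra. }
    rewrite <- CInt_scal; [|lra|auto].
    apply CInt_ext; [lra|]. intros t _. unfold phi. field. split; [|exact P2].
    now apply kernel_neq.
  - now apply (cauchy_integral_deriv phi r _ z Hphi Mphi).
Qed.

(** Division by [w]; the origin is a removable singularity of the quotient. *)
Lemma holomorphic_quotient (g : C -> C) (r : R) :
  0 < r -> (forall w, Cmod w <= r -> cdiff g w) ->
  exists q : C -> C, (forall w, g w = g 0 + w * q w)%C /\ cderiv g 0 (q 0) /\
    forall w, Cmod w <= r -> cdiff q w.
Proof.
  intros Hr Hg.
  destruct (Hg 0) as [l [phi [Hp [El H]]]]; [rewrite Cmod_0; lra|].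
  assert (Q : forall w : C, w <> 0 -> Cmod w <= r -> cdiff phi w).
  { intros w Hw Hwr.
    apply cdiff_ext_near with (fun y => (g y - g 0) / y)%C (Cmod w).
    - exact (proj1 (Cmod_gt_0 w) Hw).
    - intros y Hy.
      assert (y <> 0).
      { intros ->. replace (0 - w)%C with (- w)%C in Hy by ring. rewrite Cmod_opp in Hy. lra. }
      rewrite (H y). field. assumption.
    - apply cdiff_div; [|apply cdiff_id|exact Hw].
      apply cdiff_minus; [now apply Hg|apply cdiff_const]. }
  exists phi. split; [|split].
  - intros w. rewrite (H w). ring.
  - exists phi. auto.
  - intros w Hw. destruct (classic (w = 0)) as [->|Hn]; [|now apply Q].
    destruct (holomorphic_derivative phi r Hr) as [g' Hg'].
    + intros y Hy. destruct (classic (y = 0)) as [->|Hn]; [exact Hp|].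
      now apply cdiff_cont, Q.
    + auto.
    + eexists. apply Hg'. rewrite Cmod_0. exact Hr.
Qed.

(** Cauchy's formula bounds [g] inside by a multiple of its maximum on the
    circle; applied to the powers of [g] it gives the factor 1. *)
Theorem maximum_modulus (g : C -> C) (r M : R) (z : C) :
  (forall w, Cmod w <= r -> cdiff g w) -> (forall w, Cmod w = r -> Cmod (g w) <= M) ->
  Cmod z <= r -> Cmod (g z) <= M.
Proof.
  intros Hg HM [Hz|Hz]; [|now apply HM]. assert (Z0 := Cmod_ge_0 z). assert (P := PI_RGT_0).
  assert (M0 : 0 <= M).
  { eapply Rle_trans; [apply Cmod_ge_0|apply (HM (RtoC r))].
    rewrite Cmod_R, Rabs_pos_eq; lra. }
  set (L := 2 * (r / (r - Cmod z))).
  assert (Kn : forall n, Cmod (g z) ^ n <= L * M ^ n).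
  { intros n.
    assert (Hgn : forall w, Cmod w <= r -> cdiff (fun y => g y ^ n)%C w)
      by (intros; apply cdiff_pow; auto).
    assert (F := cauchy_formula (fun y => g y ^ n)%C r z Hz
                   (fun w Hw => cdiff_cont _ _ (Hgn w Hw)) (fun w Hw _ => Hgn w Hw)).
    assert (B : Cmod (circle_int (fun w => g w ^ n * (w / (w - z)))%C r)
                <= 4 * PI * (M ^ n * (r / (r - Cmod z)))).
    { apply circle_int_bound; [lra| |].
      - intros w Hw. apply ccont_mult; [apply cdiff_cont, Hgn; lra|].
        apply ccont_kernel. intros ->. lra.
      - intros w Hw. assert (N := circle_sub_neq z w r Hz Hw).
        assert (T := Cmod_triangle_rev w z). rewrite Hw in T.
        rewrite Cmod_mult, Cmod_div, Cmod_pow, Hw by exact N.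
        apply Rmult_le_compat; [apply pow_le, Cmod_ge_0| | |].
        + apply Rmult_le_pos; [lra|]. left. apply Rinv_0_lt_compat. lra.
        + apply pow_incr. split; [apply Cmod_ge_0|]. apply HM, Hw.
        + apply Rmult_le_compat_l; [lra|]. apply Rinv_le_contravar; lra. }
    rewrite F, Cmod_mult, Cmod_R, Rabs_pos_eq, Cmod_pow in B by lra.
    apply Rmult_le_reg_l with (2 * PI); [lra|]. unfold L. lra. }
  apply Rnot_lt_le. intros Hlt.
  destruct (Req_dec M 0) as [E|Hn].
  - specialize (Kn 1%nat). rewrite E in Kn, Hlt. simpl in Kn. lra.
  - set (x := Cmod (g z) / M - 1).
    assert (X : 0 < x).
    { unfold x. apply Rmult_lt_reg_r with M; [lra|].
      replace ((Cmod (g z) / M - 1) * M) with (Cmod (g z) - M) by (field; exact Hn). lra. }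
    assert (E : Cmod (g z) = M * (1 + x)) by (unfold x; field; exact Hn).
    destruct (archimed_cor1 (x / (Rabs L + 1))) as [n [Hn1 Hn2]].
    { apply Rdiv_lt_0_compat; [exact X|]. assert (T := Rabs_pos L). lra. }
    specialize (Kn n). rewrite E, Rpow_mult_distr in Kn.
    assert (Mn : 0 < M ^ n) by (apply pow_lt; lra).
    assert (K1 : (1 + x) ^ n <= L).
    { apply Rmult_le_reg_l with (M ^ n); [exact Mn|]. lra. }
    assert (B := poly n x X).
    assert (In : 0 < INR n) by (apply lt_0_INR; lia).
    assert (LL := Rle_abs L).
    apply (Rmult_lt_compat_r (INR n * (Rabs L + 1))) in Hn1.
    + replace (/ INR n * (INR n * (Rabs L + 1))) with (Rabs L + 1) in Hn1 by (field; lra).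
      replace (x / (Rabs L + 1) * (INR n * (Rabs L + 1))) with (INR n * x) in Hn1.
      * lra.
      * field. assert (T := Rabs_pos L). lra.
    + assert (T := Rabs_pos L). nra.
Qed.

(** The maximum principle for the reciprocal. A function that is smaller at a
    point than on a surrounding circle thus has a zero: this replaces the
    argument principle below. *)
Lemma minimum_modulus (g : C -> C) (c : C) (r m : R) (z : C) :
  0 < m ->
  (forall w, Cmod (w - c) <= r -> cdiff g w) -> (forall w, Cmod (w - c) <= r -> g w <> 0) ->
  (forall w, Cmod (w - c) = r -> m <= Cmod (g w)) ->
  Cmod (z - c) <= r -> m <= Cmod (g z).
Proof.
  intros Hm Hg H0 HM Hz.
  assert (E : forall w, (c + w - c = w)%C) by (intros; ring).
  assert (K := maximum_modulus (fun w => / g (c + w))%C r (/ m) (z - c)).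
  cbv beta in K. replace (c + (z - c))%C with z in K by ring.
  assert (G0 := proj1 (Cmod_gt_0 _) (H0 z Hz)).
  rewrite <- (Rinv_inv m), <- (Rinv_inv (Cmod (g z))).
  apply Rinv_le_contravar; [now apply Rinv_0_lt_compat|].
  rewrite <- Cmod_inv by now apply H0.
  apply K; [| |exact Hz].
  - intros w Hw. apply (cdiff_inv (fun w => g (c + w)%C)).
    + apply (cdiff_comp g (fun w => c + w)%C).
      * apply cdiff_plus; [apply cdiff_const|apply cdiff_id].
      * apply Hg. now rewrite E.
    + apply H0. now rewrite E.
  - intros w Hw. rewrite Cmod_inv by (apply H0; rewrite E; lra).
    apply Rinv_le_contravar; [exact Hm|]. apply HM. now rewrite E.
Qed.

(** * Power series *)

Definition psum (a : nat -> C) (z : C) (n : nat) : C :=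
  sum_n (G := C_AbelianMonoid) (fun k => a k * z ^ k)%C n.

Lemma psum_0 (a : nat -> C) (z : C) : psum a z 0 = a O.
Proof. unfold psum. rewrite sum_O. simpl. ring. Qed.

Lemma psum_S (a : nat -> C) (z : C) (n : nat) :
  psum a z (S n) = (psum a z n + a (S n) * z ^ S n)%C.
Proof. unfold psum. rewrite sum_Sn. reflexivity. Qed.

Lemma is_pseries_psum (a : nat -> C) (z s : C) :
  is_pseries (K := C_AbsRing) (V := C_NormedModule) a z s <->
  forall e, 0 < e -> exists N, forall n, (N <= n)%nat -> Cmod (psum a z n - s) < e.
Proof.
  assert (E : forall n, sum_n (G := C_NormedModule)
            (fun k => scal (K := C_Ring) (V := C_NormedModule) (pow_n (K := C_Ring) z k) (a k)) n = psum a z n).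
  { assert (P : forall k, pow_n (K := C_Ring) z k = (z ^ k)%C).
    { induction k as [|k IH]; [reflexivity|]. simpl. now rewrite IH. }
    intros n. apply sum_n_ext. intros k. rewrite P. apply Cmult_comm. }
  split.
  - intros H e He.
    assert (K : locally (T := C_NormedModule) s (fun y => Cmod (y - s) < e)).
    { apply (locally_le_locally_norm (K := C_AbsRing) (V := C_NormedModule)).
      exists (mkposreal e He). intros y Hy. exact Hy. }
    destruct (H _ K) as [N HN]. exists N. intros n Hn. rewrite <- E. now apply HN.
  - intros H P HP.
    apply (locally_norm_le_locally (K := C_AbsRing) (V := C_NormedModule)) in HP.
    destruct HP as [[e He] HP]. destruct (H e He) as [N HN]. exists N. intros n Hn.
    apply HP. assert (Q := HN n Hn). rewrite <- E in Q. exact Q.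
Qed.

(** The coefficient [circle_int (g / w^n)] does not depend on the radius, so
    one series represents [g] in the whole disc. *)
Theorem taylor_series (g : C -> C) (R : R) :
  0 < R -> (forall w, Cmod w < R -> cdiff g w) ->
  exists a : nat -> C, forall z, Cmod z < R ->
    is_pseries (K := C_AbsRing) (V := C_NormedModule) a z (g z).
Proof.
  intros HR Hg. assert (P := PI_RGT_0).
  assert (P2 : RtoC (2 * PI) <> RtoC 0) by (apply RtoC_pos_neq; lra).
  assert (Gd : forall (w : C) n, w <> 0 -> Cmod w < R -> cdiff (fun y => g y / y ^ n)%C w).
  { intros w n Hw HwR. apply cdiff_div; [now apply Hg|apply cdiff_pow, cdiff_id|now apply Cpow_nz]. }
  set (a := fun n => (circle_int (fun w => g w / w ^ n)%C (R / 2) / RtoC (2 * PI))%C).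
  exists a. intros z Hz. assert (Z0 := Cmod_ge_0 z).
  set (r := (Cmod z + R) / 2). assert (Hr : Cmod z < r < R) by (unfold r; lra).
  assert (W0 : forall w, Cmod w = r -> w <> 0) by (intros w Hw; apply Cmod_pos_neq; lra).
  assert (Ea : forall n, circle_int (fun w => g w / w ^ n)%C r = (RtoC (2 * PI) * a n)%C).
  { intros n. unfold a. replace (RtoC (2 * PI) * (circle_int (fun w => g w / w ^ n)%C (R / 2) / RtoC (2 * PI)))%C
      with (circle_int (fun w => g w / w ^ n)%C (R / 2)) by (field; exact P2).
    destruct (Rle_dec r (R / 2)).
    - apply circle_int_const; [lra|]. intros w Hw. apply Gd; [apply Cmod_pos_neq|]; lra.
    - symmetry. apply circle_int_const; [lra|]. intros w Hw. apply Gd; [apply Cmod_pos_neq|]; lra. }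
  set (T := fun n w => (g w * (w / (w - z)) * (z / w) ^ n)%C).
  assert (CT : forall n w, Cmod w = r -> ccont (T n) w).
  { intros n w Hw. apply ccont_mult; [apply ccont_mult|].
    - apply cdiff_cont, Hg. lra.
    - apply ccont_kernel. intros ->. lra.
    - apply cdiff_cont, cdiff_pow, cdiff_div; [apply cdiff_const|apply cdiff_id|now apply W0]. }
  assert (Rec : forall n, circle_int (T n) r = (z ^ n * (RtoC (2 * PI) * a n) + circle_int (T (S n)) r)%C).
  { intros n. rewrite <- Ea.
    rewrite (circle_int_ext _ (fun w => z ^ n * (g w / w ^ n) + T (S n) w)%C); [|lra|].
    - rewrite circle_int_plus, circle_int_scal; [reflexivity|lra| |lra| |].
      + intros w Hw. apply cdiff_cont, Gd; [now apply W0|lra].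
      + intros w Hw. apply ccont_mult; [apply ccont_const|].
        apply cdiff_cont, Gd; [now apply W0|lra].
      + intros w Hw. now apply CT.
    - intros w Hw. unfold T. assert (N := W0 w Hw).
      assert (M := circle_sub_neq z w r ltac:(lra) Hw).
      assert (Wn : (w ^ n)%C <> 0) by now apply Cpow_nz.
      assert (E : ((z / w) ^ n)%C = (z ^ n / w ^ n)%C).
      { unfold Cdiv. rewrite Cpow_mult_l. f_equal. now rewrite Cpow_inv. }
      simpl. rewrite E. field. auto. }
  assert (Sum : forall n, (RtoC (2 * PI) * g z)%C = (RtoC (2 * PI) * psum a z n + circle_int (T (S n)) r)%C).
  { assert (S0 : (RtoC (2 * PI) * g z)%C = circle_int (T O) r).
    { rewrite <- (cauchy_formula g r z); [|lra| |].
      - apply circle_int_ext; [lra|]. intros w _. unfold T. simpl. ring.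
      - intros w Hw. apply cdiff_cont, Hg. lra.
      - intros w Hw _. apply Hg. lra. }
    induction n as [|n IH].
    - rewrite S0, Rec, psum_0. simpl. ring.
    - rewrite IH, Rec, psum_S. ring. }
  destruct (bounded_on_disc r g) as [M [M0 HM]].
  { intros w Hw. apply cdiff_cont, Hg. lra. }
  set (q := Cmod z / r). assert (Q : 0 <= q < 1).
  { unfold q. split; [apply Rmult_le_pos; [lra|left; apply Rinv_0_lt_compat; lra]|].
    apply Rmult_lt_reg_r with r; [lra|]. unfold Rdiv. rewrite Rmult_assoc, Rinv_l; lra. }
  set (L := M * (r / (r - Cmod z))).
  assert (L0 : 0 <= L).
  { unfold L. apply Rmult_le_pos; [lra|]. apply Rmult_le_pos; [lra|].
    left. apply Rinv_0_lt_compat. lra. }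
  assert (B : forall n, Cmod (psum a z n - g z) <= 2 * L * q ^ S n).
  { intros n.
    assert (BT : Cmod (circle_int (T (S n)) r) <= 4 * PI * (L * q ^ S n)).
    { apply circle_int_bound; [lra|intros; now apply CT|].
      intros w Hw. unfold T, L, q. assert (N := W0 w Hw).
      assert (D := circle_sub_neq z w r ltac:(lra) Hw).
      rewrite !Cmod_mult, Cmod_pow, !Cmod_div, Hw by assumption.
      apply Rmult_le_compat_r.
      - apply pow_le. apply Q.
      - apply Rmult_le_compat; [apply Cmod_ge_0| | |].
        + apply Rmult_le_pos; [lra|]. left. apply Rinv_0_lt_compat.
          now apply Cmod_gt_0.
        + apply HM. lra.
        + apply Rmult_le_compat_l; [lra|]. apply Rinv_le_contravar; [lra|].
          assert (Tr := Cmod_triangle_rev w z). lra. }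
    assert (E : (RtoC (2 * PI) * (g z - psum a z n))%C = circle_int (T (S n)) r).
    { replace (RtoC (2 * PI) * (g z - psum a z n))%C
        with (RtoC (2 * PI) * g z - RtoC (2 * PI) * psum a z n)%C by ring.
      rewrite (Sum n). ring. }
    rewrite <- E, Cmod_mult, Cmod_R, Rabs_pos_eq, Cmod_sub_sym in BT by lra.
    apply Rmult_le_reg_l with (2 * PI); lra. }
  apply is_pseries_psum. intros e He.
  destruct (pow_lt_1_zero q) with (y := e / (2 * L + 1)) as [N HN].
  - rewrite Rabs_pos_eq; lra.
  - apply Rdiv_lt_0_compat; lra.
  - exists N. intros n Hn. eapply Rle_lt_trans; [apply B|].
    specialize (HN (S n) ltac:(lia)). rewrite Rabs_pos_eq in HN by (apply pow_le; lra).
    assert (H : (2 * L + 1) * q ^ S n < (2 * L + 1) * (e / (2 * L + 1)))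
      by (apply Rmult_lt_compat_l; lra).
    replace ((2 * L + 1) * (e / (2 * L + 1))) with e in H by (field; lra).
    assert (0 <= q ^ S n) by (apply pow_le; lra). lra.
Qed.

Lemma pseries_bounded_terms (a : nat -> C) (z s : C) :
  is_pseries (K := C_AbsRing) (V := C_NormedModule) a z s ->
  exists M, 0 < M /\ forall n, Cmod (a n) * Cmod z ^ n <= M.
Proof.
  intros H. rewrite is_pseries_psum in H. destruct (H 1) as [N HN]; [lra|].
  assert (B : exists M, forall n, (n <= S N)%nat -> Cmod (a n) * Cmod z ^ n <= M).
  { generalize (S N). intros m. induction m as [|m [M IH]].
    - exists (Cmod (a O) * Cmod z ^ 0). intros n Hn. replace n with O by lia. lra.
    - exists (Rmax M (Cmod (a (S m)) * Cmod z ^ S m)). intros n Hn.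
      destruct (Nat.eq_dec n (S m)) as [->|Hm]; [apply Rmax_r|].
      eapply Rle_trans; [apply IH; lia|apply Rmax_l]. }
  destruct B as [M HM]. exists (Rmax M 2). split; [eapply Rlt_le_trans; [|apply Rmax_r]; lra|].
  intros n. destruct (le_dec n (S N)) as [Hn|Hn].
  - eapply Rle_trans; [now apply HM|apply Rmax_l].
  - eapply Rle_trans; [|apply Rmax_r]. destruct n as [|n]; [lia|].
    rewrite <- Cmod_pow, <- Cmod_mult.
    replace (a (S n) * z ^ S n)%C with (psum a z (S n) - psum a z n)%C by (rewrite psum_S; ring).
    assert (A1 := HN (S n) ltac:(lia)). assert (A2 := HN n ltac:(lia)).
    assert (T := Cmod_sub_triangle (psum a z (S n)) s (psum a z n)).
    rewrite (Cmod_sub_sym s) in T. lra.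
Qed.

Lemma pseries_first_order (a : nat -> C) (r : R) (s : C -> C) :
  0 < r -> (forall z, 0 < Cmod z < r -> is_pseries (K := C_AbsRing) (V := C_NormedModule) a z (s z)) ->
  exists M d, 0 < d /\ forall z, 0 < Cmod z < d ->
    Cmod (s z - (a 0%nat + a 1%nat * z)) <= M * (Cmod z * Cmod z).
Proof.
  intros Hr H.
  assert (Er : Cmod (RtoC (r / 2)) = r / 2) by (rewrite Cmod_R, Rabs_pos_eq; lra).
  destruct (pseries_bounded_terms a (RtoC (r / 2)) (s (RtoC (r / 2)))) as [M [M0 HM]].
  { apply H. rewrite Er. lra. }
  rewrite Er in HM.
  exists (8 * M / (r * r)), (r / 4). split; [lra|]. intros z Hz.
  set (q := Cmod z / (r / 2)).
  assert (Q0 : 0 <= q) by (unfold q; apply Rmult_le_pos; [lra|left; apply Rinv_0_lt_compat; lra]).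
  assert (Q1 : q <= 1 / 2).
  { unfold q. apply Rmult_le_reg_r with (r / 2); [lra|].
    unfold Rdiv at 1. rewrite Rmult_assoc, Rinv_l; lra. }
  assert (Term : forall n, Cmod (a n * z ^ n) <= M * q ^ n).
  { intros n. rewrite Cmod_mult, Cmod_pow. unfold q.
    replace (Cmod z) with (Cmod z / (r / 2) * (r / 2)) at 1 by (field; lra).
    rewrite Rpow_mult_distr. fold q. specialize (HM n).
    replace (Cmod (a n) * (q ^ n * (r / 2) ^ n)) with (Cmod (a n) * (r / 2) ^ n * q ^ n) by ring.
    apply Rmult_le_compat_r; [now apply pow_le|exact HM]. }
  assert (B : forall n, Cmod (psum a z (S n) - (a 0%nat + a 1%nat * z)) <= 2 * M * q ^ 2 * (1 - q ^ n)).
  { induction n as [|n IH].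
    - rewrite psum_S, psum_0. simpl.
      replace (a 0%nat + a 1%nat * (z * 1) - (a 0%nat + a 1%nat * z))%C with (RtoC 0) by ring.
      rewrite Cmod_0. lra.
    - rewrite psum_S.
      replace (psum a z (S n) + a (S (S n)) * z ^ S (S n) - (a 0%nat + a 1%nat * z))%C
        with ((psum a z (S n) - (a 0%nat + a 1%nat * z)) + a (S (S n)) * z ^ S (S n))%C by ring.
      eapply Rle_trans; [apply Cmod_triangle|].
      assert (T := Term (S (S n))).
      assert (E : q ^ S (S n) = q ^ 2 * q ^ n) by (simpl; ring). rewrite E in T.
      replace (q ^ S n) with (q * q ^ n) by (simpl; ring).
      assert (0 <= q ^ n) by now apply pow_le. assert (0 <= q ^ 2) by now apply pow_le.
      assert (X0 : 0 <= M * q ^ 2 * q ^ n) by (apply Rmult_le_pos; [apply Rmult_le_pos; lra|lra]).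
      assert (X1 : 0 <= (1 - 2 * q) * (M * q ^ 2 * q ^ n)) by (apply Rmult_le_pos; lra).
      lra. }
  assert (B2 : forall n, Cmod (psum a z (S n) - (a 0%nat + a 1%nat * z)) <= 2 * M * q ^ 2).
  { intros n. eapply Rle_trans; [apply B|]. assert (0 <= q ^ n) by now apply pow_le.
    assert (0 <= M * q ^ 2) by (apply Rmult_le_pos; [lra|now apply pow_le]). nra. }
  replace (8 * M / (r * r) * (Cmod z * Cmod z)) with (2 * M * q ^ 2) by (unfold q; field; lra).
  apply le_epsilon. intros e He.
  assert (HH := H z ltac:(lra)). rewrite is_pseries_psum in HH.
  destruct (HH e He) as [N HN]. specialize (HN (S N) ltac:(lia)). specialize (B2 N).
  assert (T := Cmod_sub_triangle (s z) (psum a z (S N)) (a 0%nat + a 1%nat * z)).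
  rewrite (Cmod_sub_sym (s z) (psum a z (S N))) in T. lra.
Qed.

(** * Convexity of the complement *)

Definition omitted (N : C -> C) (k : C) : Prop :=
  forall z, Cmod z < 1 -> N z <> (k * z)%C.

(** A concave function with its pole at the origin, written [N z / z].
    Numerators let the pole be treated like the other points: [N z <> k * z]
    says that the value [k] is not taken at [z], also when [z = 0]. *)
Record concave_numerator (N : C -> C) : Prop := {
  cn_diff : forall z, Cmod z < 1 -> cdiff N z;
  cn_pole : N 0 <> 0;
  cn_inj : forall z w, Cmod z < 1 -> Cmod w < 1 -> (N z * w = N w * z)%C -> z = w;
  cn_convex : convex_C (omitted N) }.

(** A value that is not taken near [z0] stays away from [F z0]: this form of
    the open mapping theorem for injective functions is uniform in the value.
    On the circle, [F] differs from [F z0] by injectivity; a value [k] too close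
    to [F z0] would make [N - k z] large on the circle and small at [z0]. *)
Lemma omitted_near_bound (N : C -> C) (z0 : C) (rho : R) :
  concave_numerator N -> 0 < rho -> Cmod z0 + rho < 1 ->
  exists m, 0 < m /\ forall k, (forall z, Cmod (z - z0) <= rho -> N z <> (k * z)%C) ->
    m <= Cmod (N z0 - k * z0).
Proof.
  intros HN Hrho Hz0. assert (Z0 := Cmod_ge_0 z0).
  assert (In : forall y, Cmod y <= rho -> Cmod (z0 + y) < 1).
  { intros y Hy. assert (T := Cmod_triangle z0 y). lra. }
  assert (In2 : forall w, Cmod (w - z0) <= rho -> Cmod w < 1).
  { intros w Hw. replace w with (z0 + (w - z0))%C by ring. now apply In. }
  destruct (positive_min_circle rho (fun y => N (z0 + y) * z0 - N z0 * (z0 + y))%C) as [m [Hm H]].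
  - intros y Hy. apply cdiff_cont.
    assert (S : cdiff (fun y => z0 + y)%C y) by (apply cdiff_plus; [apply cdiff_const|apply cdiff_id]).
    apply cdiff_minus; apply cdiff_mult; try apply cdiff_const; [|exact S].
    apply (cdiff_comp N (fun y => z0 + y)%C); [exact S|]. apply (cn_diff N HN). auto.
  - intros y Hy E.
    assert (E2 : (z0 + y)%C = z0).
    { apply (cn_inj N HN); [apply In; lra|lra|].
      replace (N (z0 + y)%C * z0)%C with (N (z0 + y)%C * z0 - N z0 * (z0 + y) + N z0 * (z0 + y))%C by ring.
      rewrite E. ring. }
    assert (Y : y = 0). { replace y with (z0 + y - z0)%C by ring. rewrite E2. ring. }
    rewrite Y, Cmod_0 in Hy. lra.
  - exists (m / 2). split; [lra|]. intros k Hk.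
    apply Rnot_lt_le. intros Hlt. set (e0 := Cmod (N z0 - k * z0)) in *.
    assert (K : m - e0 <= e0); [|lra].
    apply (minimum_modulus (fun z => N z - k * z)%C z0 rho (m - e0) z0).
    + lra.
    + intros w Hw. apply cdiff_minus; [apply (cn_diff N HN); auto|].
      apply cdiff_mult; [apply cdiff_const|apply cdiff_id].
    + intros w Hw. apply Csub_neq_0. now apply Hk.
    + intros w Hw. assert (W1 := In2 w ltac:(lra)).
      specialize (H (w - z0)%C Hw). cbv beta in H.
      replace (z0 + (w - z0))%C with w in H by ring.
      replace (N w * z0 - N z0 * w)%C with ((N w - k * w) * z0 - (N z0 - k * z0) * w)%C in H by ring.
      assert (T := Cmod_triangle_sub ((N w - k * w) * z0) ((N z0 - k * z0) * w)).
      rewrite !Cmod_mult in T. fold e0 in T.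
      assert (0 <= e0) by apply Cmod_ge_0.
      assert (0 <= Cmod (N w - k * w)) by apply Cmod_ge_0. assert (0 <= Cmod w) by apply Cmod_ge_0.
      nra.
    + rewrite Cmod_sub_diag. lra.
Qed.

(** Only values that are not taken in a disc around the pole are concerned, so
    that the bound also applies to the values of [F] away from the pole. *)
Lemma omitted_bounded (N : C -> C) :
  concave_numerator N ->
  exists M, 0 < M /\ forall k, (forall z, Cmod z <= 1 / 3 -> N z <> (k * z)%C) -> Cmod k <= M.
Proof.
  intros HN.
  destruct (bounded_on_disc (1/3) N) as [B [HB H]].
  { intros z Hz. apply cdiff_cont, (cn_diff N HN). lra. }
  exists (3 * (2 * B + 1)). split; [lra|]. intros k Hk.
  apply Rnot_lt_le. intros Hlt.
  assert (K : B + 1 <= Cmod (N 0 - k * 0)).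
  { apply (minimum_modulus (fun z => N z - k * z)%C 0 (1/3)).
    - lra.
    - intros w Hw. replace (w - 0)%C with w in Hw by ring.
      apply cdiff_minus; [apply (cn_diff N HN); lra|].
      apply cdiff_mult; [apply cdiff_const|apply cdiff_id].
    - intros w Hw. replace (w - 0)%C with w in Hw by ring. apply Csub_neq_0. now apply Hk.
    - intros w Hw. replace (w - 0)%C with w in Hw by ring.
      specialize (H w ltac:(lra)).
      assert (T := Cmod_triangle_rev (k * w) (N w)). rewrite Cmod_mult, Hw, Cmod_sub_sym in T. lra.
    - rewrite Cmod_sub_diag. lra. }
  replace (N 0 - k * 0)%C with (N 0) in K by ring.
  assert (T := H 0 ltac:(rewrite Cmod_0; lra)). lra.
Qed.

Lemma value_not_elsewhere (N : C -> C) (s z : C) :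
  concave_numerator N -> Cmod s < 1 -> Cmod z < 1 -> s <> 0 -> z <> s -> N z <> (N s / s * z)%C.
Proof.
  intros HN Hs Hz Hs0 Hzs E. apply Hzs. apply (cn_inj N HN); auto.
  rewrite E. field. exact Hs0.
Qed.

(** A limit [F z] with [Cmod z < 1] is impossible: the values [F (s n)] are
    not taken near [z], by injectivity. *)
Lemma boundary_cluster_omitted (N : C -> C) (s : nat -> C) (k : C) :
  concave_numerator N -> (forall n, Cmod (s n) < 1) ->
  (forall rho, rho < 1 -> exists n0, forall n, (n0 <= n)%nat -> rho < Cmod (s n)) ->
  (forall e (n0 : nat), 0 < e -> exists n, (n0 <= n)%nat /\ Cmod (N (s n) / s n - k) < e) ->
  omitted N k.
Proof.
  intros HN Hs Hlim Hk z Hz E. assert (Z0 := Cmod_ge_0 z).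
  set (rho := (1 - Cmod z) / 2).
  destruct (omitted_near_bound N z rho HN) as [m [Hm H]]; [unfold rho; lra|unfold rho; lra|].
  destruct (Hlim (Cmod z + rho)) as [n0 Hn0]; [unfold rho; lra|].
  destruct (Hk m n0 Hm) as [n [Hn Hnk]]. specialize (Hn0 n Hn).
  assert (S0 : s n <> 0) by (apply Cmod_pos_neq; unfold rho in *; lra).
  assert (B : m <= Cmod (N z - N (s n) / s n * z)).
  { apply H. intros w Hw. assert (T := Cmod_triangle_rev w z).
    apply value_not_elsewhere; auto; [unfold rho in *; lra|].
    intros ->. lra. }
  rewrite E in B. replace (k * z - N (s n) / s n * z)%C with (- ((N (s n) / s n - k) * z))%C in B by ring.
  rewrite Cmod_opp, Cmod_mult in B.
  assert (0 <= Cmod (N (s n) / s n - k)) by apply Cmod_ge_0. nra.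
Qed.

Lemma near_boundary_near_omitted (N : C -> C) (e : R) :
  concave_numerator N -> 0 < e ->
  exists rho, 0 < rho < 1 /\ forall s, rho <= Cmod s < 1 ->
    exists k, omitted N k /\ Cmod (N s / s - k) < e.
Proof.
  intros HN He. apply NNPP. intros NH.
  assert (Seq : forall n : nat, exists s : C, 1 - / (INR n + 2) <= Cmod s < 1 /\
            forall k, omitted N k -> e <= Cmod (N s / s - k)).
  { intros n. apply NNPP. intros Nn. apply NH.
    assert (I := pos_INR n).
    assert (J : 0 < / (INR n + 2)) by (apply Rinv_0_lt_compat; lra).
    assert (J2 : / (INR n + 2) <= / 2) by (apply Rinv_le_contravar; lra).
    exists (1 - / (INR n + 2)). split; [lra|]. intros s Hs.
    apply NNPP. intros Nk. apply Nn. exists s. split; [exact Hs|].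
    intros k Hk. apply Rnot_lt_le. intros Hlt. apply Nk. now exists k. }
  set (s := fun n => proj1_sig (constructive_indefinite_description _ (Seq n))).
  assert (Hs : forall n, 1 - / (INR n + 2) <= Cmod (s n) < 1 /\
            forall k, omitted N k -> e <= Cmod (N (s n) / s n - k)).
  { intros n. exact (proj2_sig (constructive_indefinite_description _ (Seq n))). }
  assert (Low : forall n, 1/2 <= Cmod (s n)).
  { intros n. destruct (Hs n) as [[A _] _]. assert (I := pos_INR n).
    assert (J2 : / (INR n + 2) <= / 2) by (apply Rinv_le_contravar; lra). lra. }
  destruct (omitted_bounded N HN) as [M [HM HB]].
  destruct (bounded_cluster M (fun n => N (s n) / s n)%C) as [k [_ Hk]].
  { intros n. apply HB. intros z Hz. specialize (Low n).
    apply value_not_elsewhere; auto; [apply Hs|lra|apply Cmod_pos_neq; lra|].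
    intros ->. lra. }
  assert (Ok : omitted N k).
  { apply boundary_cluster_omitted with s; auto; [intros n; apply Hs|].
    intros rho Hrho. destruct (archimed_cor1 (1 - rho)) as [n0 [Hn0 Hn1]]; [lra|].
    exists n0. intros n Hn. destruct (Hs n) as [[A _] _].
    assert (I : INR n0 <= INR n) by now apply le_INR.
    assert (I0 : 0 < INR n0) by now apply lt_0_INR.
    assert (/ (INR n + 2) < / INR n0) by (apply Rinv_lt_contravar; nra). lra. }
  destruct (Hk e O He) as [n [_ Hn]].
  destruct (Hs n) as [_ A]. specialize (A k Ok). lra.
Qed.

Lemma omitted_uniformly_far (N : C -> C) (r : R) :
  concave_numerator N -> r < 1 ->
  exists e, 0 < e /\ forall k z, omitted N k -> Cmod z <= r -> e <= Cmod (N z - k * z).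
Proof.
  intros HN Hr. destruct (omitted_bounded N HN) as [M [HM HB]].
  destruct (disc_compact r (fun z e => forall k, omitted N k -> e <= Cmod (N z - k * z)))
    as [e [He H]].
  - intros z e e' H Hee k Hk. specialize (H k Hk). lra.
  - intros z Hz. assert (Z0 := Cmod_ge_0 z).
    destruct (omitted_near_bound N z ((1 - Cmod z) / 2) HN) as [m [Hm H]]; [lra|lra|].
    destruct (cdiff_cont N z) with (eps := m / 4) as [d [Hd Hc]];
      [apply (cn_diff N HN); lra|lra|].
    set (d' := Rmin (Rmin d (m / 4 / M)) (m / 2)).
    assert (D0 : 0 < m / 4 / M) by (apply Rdiv_lt_0_compat; lra).
    exists d'. split; [unfold d'; repeat apply Rmin_glb_lt; lra|].
    intros y Hy k Hk.
    assert (Y1 : Cmod (y - z) < d).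
    { eapply Rlt_le_trans; [exact Hy|]. eapply Rle_trans; apply Rmin_l. }
    assert (Y2 : Cmod (y - z) < m / 4 / M).
    { eapply Rlt_le_trans; [exact Hy|]. eapply Rle_trans; [apply Rmin_l|apply Rmin_r]. }
    assert (Y3 : d' <= m / 2) by apply Rmin_r.
    specialize (Hc y Y1).
    assert (Kb : Cmod k <= M) by (apply HB; intros w Hw; apply Hk; lra).
    assert (B : m <= Cmod (N z - k * z)).
    { apply H. intros w Hw. apply Hk. assert (T := Cmod_triangle_rev w z). lra. }
    assert (T : Cmod (N z - k * z) <= Cmod (N y - k * y) + (Cmod (N y - N z) + Cmod k * Cmod (y - z))).
    { replace (N z - k * z)%C with ((N y - k * y) - ((N y - N z) - k * (y - z)))%C by ring.
      eapply Rle_trans; [apply Cmod_triangle_sub|]. apply Rplus_le_compat_l.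
      eapply Rle_trans; [apply Cmod_triangle_sub|]. rewrite Cmod_mult. lra. }
    assert (Q : Cmod k * Cmod (y - z) <= m / 4).
    { apply Rle_trans with (M * (m / 4 / M)).
      - apply Rmult_le_compat; try apply Cmod_ge_0; lra.
      - right. field. lra. }
    lra.
  - exists e. split; [exact He|]. intros k z Hk Hz. now apply H.
Qed.

(** The complements of the images of the discs [Cmod z < r] are convex as well;
    this is the case of two points on a common circle and of their midpoint.

    If [(F (e1 z) + F (e2 z)) / 2 = F (l z)] held for some [z], consider in [s]
    the quotient of [(F (e1 s) + F (e2 s)) / 2 - F (l s)] by [k - F (l s)], for
    an omitted value [k]. It vanishes at [z]; let [- tau0] be the most negative
    value that it takes. Near the unit circle it stays away from the negative
    half-axis, since there the midpoint is close to omitted values, whose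
    segment to [k] does not meet the compact set of the values [F (l s)]. Hence
    adding [tau] slightly larger than [tau0] gives a function that is bounded
    below on a circle, has no zero inside, but is small there, against the
    minimum modulus principle. *)
Lemma midpoint_not_inside (N : C -> C) (e1 e2 l z : C) :
  concave_numerator N -> Cmod e1 = 1 -> Cmod e2 = 1 -> 0 < Cmod l < 1 -> Cmod z < 1 ->
  ((N (e1 * z) / e1 + N (e2 * z) / e2) / 2 <> N (l * z) / l)%C.
Proof.
  intros HN He1 He2 Hl Hz Ez.
  assert (N1 : e1 <> 0) by (apply Cmod_pos_neq; lra).
  assert (N2 : e2 <> 0) by (apply Cmod_pos_neq; lra).
  assert (Nl : l <> 0) by (apply Cmod_pos_neq; lra).
  assert (N22 : RtoC 2 <> RtoC 0) by (apply RtoC_pos_neq; lra).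
  destruct (omitted_uniformly_far N (Cmod l) HN) as [e [He Hfar]]; [lra|].
  destruct (near_boundary_near_omitted N (e / 2) HN) as [rho [Hrho Hnear]]; [lra|].
  destruct (Hnear (RtoC rho)) as [k [Hk _]]; [rewrite Cmod_R, Rabs_pos_eq; lra|].
  set (A := fun s => ((N (e1 * s) / e1 + N (e2 * s) / e2) / 2 - N (l * s) / l)%C).
  set (D := fun s => (k * s - N (l * s) / l)%C).
  assert (dN : forall c s, Cmod c <= 1 -> Cmod s < 1 -> cdiff (fun s => N (c * s)%C) s).
  { intros c s Hc Hs. apply (cdiff_comp N (fun s => c * s)%C).
    - apply cdiff_mult; [apply cdiff_const|apply cdiff_id].
    - apply (cn_diff N HN). rewrite Cmod_mult. assert (T := Cmod_ge_0 s). assert (T2 := Cmod_ge_0 c). nra. }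
  assert (dA : forall s, Cmod s < 1 -> cdiff A s).
  { intros s Hs. apply cdiff_minus; [|apply cdiff_div; auto; [apply dN; lra|apply cdiff_const]].
    apply cdiff_div; [|apply cdiff_const|exact N22].
    apply cdiff_plus; apply cdiff_div; auto; try apply cdiff_const; apply dN; lra. }
  assert (dD : forall s, Cmod s < 1 -> cdiff D s).
  { intros s Hs. apply cdiff_minus; [|apply cdiff_div; auto; [apply dN; lra|apply cdiff_const]].
    apply cdiff_mult; [apply cdiff_const|apply cdiff_id]. }
  assert (Far : forall c s, omitted N c -> Cmod s < 1 -> e <= Cmod (c * s - N (l * s)%C / l)).
  { intros c s Hc Hs.
    assert (F := Hfar c (l * s)%C Hc).
    rewrite Cmod_mult in F. specialize (F ltac:(assert (T := Cmod_ge_0 s); nra)).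
    replace (c * s - N (l * s) / l)%C with (- (N (l * s) - c * (l * s)) / l)%C by (field; exact Nl).
    rewrite Cmod_div, Cmod_opp by exact Nl.
    apply Rmult_le_reg_r with (Cmod l); [lra|]. unfold Rdiv. rewrite Rmult_assoc, Rinv_l by lra. nra. }
  assert (Edge : forall s tau, rho <= Cmod s < 1 -> 0 <= tau -> e / 2 <= Cmod (A s + tau * D s)).
  { intros s tau Hs Ht.
    assert (S0 : s <> 0) by (apply Cmod_pos_neq; lra).
    assert (M1 : Cmod (e1 * s) = Cmod s) by (rewrite Cmod_mult, He1; ring).
    assert (M2 : Cmod (e2 * s) = Cmod s) by (rewrite Cmod_mult, He2; ring).
    destruct (Hnear (e1 * s)%C) as [k1 [K1 D1]]; [lra|].
    destruct (Hnear (e2 * s)%C) as [k2 [K2 D2]]; [lra|].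
    assert (K3 := cn_convex N HN k1 k2 (1/2) K1 K2 ltac:(lra)).
    set (k3 := (RtoC (1/2) * k1 + (1 - RtoC (1/2)) * k2)%C) in *.
    assert (U : 0 <= / (1 + tau) <= 1).
    { split; [left; apply Rinv_0_lt_compat; lra|]. assert (I1 : / (1 + tau) <= / 1) by (apply Rinv_le_contravar; lra). lra. }
    assert (K4 := cn_convex N HN k3 k (/ (1 + tau)) K3 Hk U).
    set (k4 := (RtoC (/ (1 + tau)) * k3 + (1 - RtoC (/ (1 + tau))) * k)%C) in *.
    assert (NT : RtoC (1 + tau) <> RtoC 0) by (apply RtoC_pos_neq; lra).
    assert (E4 : (RtoC (1 + tau) * k4 = k3 + tau * k)%C).
    { unfold k4. rewrite RtoC_inv by lra. rewrite RtoC_plus in *. field. exact NT. }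
    set (d1 := (N (e1 * s) / (e1 * s) - k1)%C) in *. set (d2 := (N (e2 * s) / (e2 * s) - k2)%C) in *.
    assert (EA : (A s + tau * D s)%C
              = (RtoC (1 + tau) * (k4 * s - N (l * s) / l) + s * ((d1 + d2) / 2))%C).
    { replace (RtoC (1 + tau) * (k4 * s - N (l * s) / l))%C
        with (RtoC (1 + tau) * k4 * s - (1 + tau) * (N (l * s) / l))%C
        by (rewrite RtoC_plus; ring).
      rewrite E4. unfold A, D, d1, d2, k3. rewrite RtoC_div by lra. field. auto. }
    rewrite EA.
    assert (F := Far k4 s K4 (proj2 Hs)).
    set (u := (k4 * s - N (l * s) / l)%C) in *. set (v := (s * ((d1 + d2) / 2))%C).
    assert (T := Cmod_triangle_rev (RtoC (1 + tau) * u) (- v)).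
    replace (RtoC (1 + tau) * u - - v)%C with (RtoC (1 + tau) * u + v)%C in T by ring.
    unfold v in T at 1.
    rewrite Cmod_opp, !Cmod_mult, (Cmod_R (1 + tau)), Rabs_pos_eq, Cmod_div, Cmod_R, Rabs_pos_eq in T
      by (auto; lra).
    assert (T2 := Cmod_triangle d1 d2).
    assert (0 <= Cmod (d1 + d2)) by apply Cmod_ge_0.
    nra. }
  assert (cA : forall s, Cmod s <= rho -> ccont A s) by (intros; apply cdiff_cont, dA; lra).
  assert (cD : forall s, Cmod s <= rho -> ccont D s) by (intros; apply cdiff_cont, dD; lra).
  destruct (bounded_on_disc rho A cA) as [MA [HMA BA]].
  destruct (bounded_on_disc rho D cD) as [MD [HMD BD]].
  set (T := fun tau => 0 <= tau /\ exists s, Cmod s <= rho /\ (A s + tau * D s)%C = 0).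
  assert (T0 : T 0).
  { split; [lra|]. exists z.
    assert (Az : A z = 0) by (unfold A; rewrite Ez; ring).
    split; [|rewrite Az; ring].
    apply Rnot_lt_le. intros Hlt.
    assert (Q := Edge z 0 ltac:(lra) ltac:(lra)). rewrite Az in Q.
    replace (0 + 0 * D z)%C with (RtoC 0) in Q by ring. rewrite Cmod_0 in Q. lra. }
  assert (Tb : bound T).
  { exists (MA / e). intros tau [Ht [s [Hs Es]]].
    assert (B1 := BA s Hs). assert (B2 := Far k s Hk ltac:(lra)).
    change (k * s - N (l * s) / l)%C with (D s) in B2.
    assert (EA : A s = (- (tau * D s))%C).
    { replace (A s) with (A s + tau * D s - tau * D s)%C by ring. rewrite Es. ring. }
    rewrite EA, Cmod_opp, Cmod_mult, Cmod_R, Rabs_pos_eq in B1 by exact Ht.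
    apply Rmult_le_reg_r with e; [exact He|].
    replace (MA / e * e) with MA by (field; lra). nra. }
  destruct (completeness T Tb (ex_intro _ 0 T0)) as [tau0 [Up Least]].
  assert (P0 : 0 <= tau0) by (now apply Up).
  set (h := e / (8 * MD)). assert (H0 : 0 < h) by (apply Rdiv_lt_0_compat; lra).
  assert (Close : exists tau, T tau /\ tau0 - h < tau).
  { apply NNPP. intros NC. assert (Q : tau0 <= tau0 - h); [|lra].
    apply Least. intros tau Htau. apply Rnot_lt_le. intros Hlt. apply NC. now exists tau. }
  destruct Close as [tau [[Ht [s [Hs Es]]] Hclose]].
  assert (Htau : tau <= tau0) by (apply Up; split; [exact Ht|now exists s]).
  assert (Q : e / 2 <= Cmod (A s + RtoC (tau0 + h) * D s)).
  { apply (minimum_modulus (fun s => A s + RtoC (tau0 + h) * D s)%C 0 rho).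
    - lra.
    - intros w Hw. replace (w - 0)%C with w in Hw by ring.
      apply cdiff_plus; [apply dA; lra|]. apply cdiff_mult; [apply cdiff_const|apply dD; lra].
    - intros w Hw Ew. replace (w - 0)%C with w in Hw by ring.
      assert (tau0 + h <= tau0); [|lra]. apply Up. split; [lra|now exists w].
    - intros w Hw. replace (w - 0)%C with w in Hw by ring. apply Edge; lra.
    - replace (s - 0)%C with s by ring. exact Hs. }
  replace (A s + RtoC (tau0 + h) * D s)%C with (A s + tau * D s + RtoC (tau0 + h - tau) * D s)%C in Q
    by (rewrite RtoC_minus; ring).
  rewrite Es, Cplus_0_l, Cmod_mult, Cmod_R, Rabs_pos_eq in Q by lra.
  specialize (BD s Hs).
  assert (E : h * MD = e / 8) by (unfold h; field; lra).
  assert (0 <= Cmod (D s)) by apply Cmod_ge_0. nra.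
Qed.

(** * The differential inequality *)

Lemma derivative_on_open_disc (g : C -> C) (R : R) :
  0 < R -> (forall z, Cmod z < R -> cdiff g z) ->
  exists g' : C -> C, forall z, Cmod z < R -> cderiv g z (g' z) /\ cdiff g' z.
Proof.
  intros HR Hg.
  assert (Ex : forall z, exists l, Cmod z < R -> cderiv g z l).
  { intros z. destruct (classic (Cmod z < R)) as [H|H].
    - destruct (Hg z H) as [l Hl]. now exists l.
    - exists (RtoC 0). contradiction. }
  set (g' := fun z => proj1_sig (constructive_indefinite_description _ (Ex z))).
  assert (Hg' : forall z, Cmod z < R -> cderiv g z (g' z)).
  { intros z. exact (proj2_sig (constructive_indefinite_description _ (Ex z))). }
  exists g'. intros z Hz. split; [now apply Hg'|]. assert (Z0 := Cmod_ge_0 z).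
  destruct (holomorphic_derivative g ((Cmod z + R) / 2)) as [g1 H1].
  - lra.
  - intros w Hw. apply cdiff_cont, Hg. lra.
  - intros w Hw _. apply Hg. lra.
  - apply cdiff_ext_near with g1 ((R - Cmod z) / 2).
    + lra.
    + intros y Hy. assert (T := Cmod_triangle_rev y z).
      apply (cderiv_unique g y); [apply H1|apply Hg']; lra.
    + apply H1. lra.
Qed.

Lemma second_order_quotient (E E1 : C -> C) (e2 : C) (r : R) :
  0 < r -> (forall v, Cmod v <= r -> cderiv E v (E1 v)) -> cderiv E1 0 e2 ->
  exists q : C -> C, (forall v, E v = E 0 + E1 0 * v + v * v * q v)%C /\
    (forall v, Cmod v <= r -> cdiff q v) /\ q 0 = (e2 / 2)%C.
Proof.
  intros Hr HE HE1.
  assert (N22 : RtoC 2 <> RtoC 0) by (apply RtoC_pos_neq; lra).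
  assert (H0 : Cmod 0 < r) by (rewrite Cmod_0; lra).
  destruct (holomorphic_quotient E r Hr) as [q1 [Q1 [D1 H1]]].
  { intros w Hw. exists (E1 w). now apply HE. }
  destruct (holomorphic_quotient q1 r Hr H1) as [q2 [Q2 [D2 H2]]].
  destruct (holomorphic_derivative q1 r Hr) as [p1 P1].
  { intros w Hw. now apply cdiff_cont, H1. }
  { auto. }
  assert (Ee1 : E1 0 = q1 0) by (apply (cderiv_unique E 0); [apply HE; lra|exact D1]).
  assert (F1 : forall w, Cmod w < r -> E1 w = (q1 w + w * p1 w)%C).
  { intros w Hw. apply (cderiv_unique E w); [apply HE; lra|].
    apply cderiv_ext with (fun w => E 0 + w * q1 w)%C; [intros; now rewrite <- Q1|].
    eapply cderiv_eq; [|apply cderiv_plus; [apply cderiv_const|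
      apply cderiv_mult; [apply cderiv_id|apply P1, Hw]]]. cbv beta. ring. }
  exists q2. split; [|split].
  - intros w. rewrite Ee1, (Q1 w), (Q2 w). ring.
  - exact H2.
  - assert (e2 = (q2 0 + q2 0)%C).
    { apply (cderiv_unique E1 0); [exact HE1|].
      apply cderiv_ext_near with (fun w => q1 w + w * p1 w)%C r.
      - exact Hr.
      - intros y Hy. replace (y - 0)%C with y in Hy by ring. now rewrite F1.
      - destruct (P1 0 H0) as [A [m B]].
        assert (Ep : p1 0 = q2 0) by (apply (cderiv_unique q1 0); [exact A|exact D2]).
        eapply cderiv_eq; [|apply cderiv_plus; [exact D2|apply cderiv_mult; [apply cderiv_id|exact B]]].
        cbv beta. rewrite Ep. ring. }
    rewrite H. field.
Qed.

Lemma second_order_expansion (E E1 : C -> C) (e2 : C) (r : R) :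
  0 < r -> (forall v, Cmod v <= r -> cderiv E v (E1 v)) -> cderiv E1 0 e2 ->
  exists M, 0 < M /\ forall v, Cmod v <= r ->
    Cmod (E v - (E 0 + E1 0 * v + e2 / 2 * (v * v))) <= M * Cmod v ^ 3.
Proof.
  intros Hr HE HE1.
  destruct (second_order_quotient E E1 e2 r Hr HE HE1) as [q2 [Q2 [H2 E2]]].
  destruct (holomorphic_quotient q2 r Hr H2) as [q3 [Q3 [_ H3]]].
  destruct (bounded_on_disc r q3) as [M [HM BM]].
  { intros w Hw. now apply cdiff_cont, H3. }
  exists M. split; [exact HM|]. intros v Hv.
  rewrite <- E2, (Q2 v), (Q3 v).
  replace (E 0 + E1 0 * v + v * v * (q2 0 + v * q3 v) - (E 0 + E1 0 * v + q2 0 * (v * v)))%C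
    with (q3 v * v ^ 3)%C by (simpl; ring).
  rewrite Cmod_mult, Cmod_pow. apply Rmult_le_compat_r; [apply pow_le, Cmod_ge_0|now apply BM].
Qed.

Lemma Re_mult_conj_div (a b : C) : b <> 0 -> Re (a * Cconj b) = Re (a / b) * Cmod b ^ 2.
Proof.
  intros Hb. rewrite Cmod2_alt. destruct a as [x y], b as [u v]. unfold Re, Im, Cdiv, Cmult, Cinv, Cconj.
  simpl. field. intros E. apply Hb.
  assert (u = 0) by nra. assert (v = 0) by nra. subst. reflexivity.
Qed.

(** With [F = N z / z] in the logarithmic coordinate, [E v = F (z exp v)], the
    midpoint of [E (i t)] and [E (- i t)] is [E 0 - E'' 0 t^2 / 2 + ...], and
    it is not of the form [E (- t^2 s)] for any [s] with positive real part.
    Dividing by [t^2], the functions [s |-> (mean - E (- t^2 s)) / t^2] have no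
    zeros in the right half-plane and converge to [E' 0 s - E'' 0 / 2]; so
    neither does their limit. *)
Lemma concave_inequality (N N1 N2 : C -> C) (z : C) :
  concave_numerator N ->
  (forall w, Cmod w < 1 -> cderiv N w (N1 w)) -> (forall w, Cmod w < 1 -> cderiv N1 w (N2 w)) ->
  Cmod z < 1 ->
  0 <= Re ((N z - z * N1 z + z * z * N2 z) * Cconj (N z - z * N1 z)).
Proof.
  intros HN HN1 HN2 Hz.
  assert (N22 : RtoC 2 <> RtoC 0) by (apply RtoC_pos_neq; lra).
  destruct (classic (z = 0)) as [Ez|Hz0].
  { rewrite Ez. replace (N 0 - 0 * N1 0 + 0 * 0 * N2 0)%C with (N 0) by ring.
    replace (N 0 - 0 * N1 0)%C with (N 0) by ring.
    destruct (N 0) as [x y]. unfold Re, Cmult, Cconj. simpl. nra. }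
  set (A := (N z - z * N1 z)%C). set (B := (A + z * z * N2 z)%C).
  apply Rnot_lt_le. intros Hneg.
  destruct (classic (A = 0)) as [EA|HA].
  { rewrite EA in Hneg. destruct B as [x y]. unfold Re, Cmult, Cconj in Hneg. simpl in Hneg. lra. }
  assert (Zp := proj1 (Cmod_gt_0 z) Hz0).
  set (E := fun v => (N (z * Cexp v) / (z * Cexp v))%C).
  set (r := - ln (Cmod z) / 2).
  assert (Ln : ln (Cmod z) < 0) by (rewrite <- ln_1; apply ln_increasing; lra).
  assert (Hr : 0 < r) by (unfold r; lra).
  assert (In : forall v, Cmod v <= r -> Cmod (z * Cexp v) < 1).
  { intros v Hv. rewrite Cmod_mult, Cmod_Cexp.
    rewrite <- (exp_ln (Cmod z)), <- exp_plus, <- exp_0 by exact Zp. apply exp_increasing.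
    assert (T := Rmax_Cmod v). assert (T2 := Rmax_l (Rabs (fst v)) (Rabs (snd v))).
    assert (T3 := Rle_abs (fst v)). unfold r in *. lra. }
  assert (W0 : forall v, (z * Cexp v)%C <> 0) by (intros; apply Cmult_neq_0; [exact Hz0|apply Cexp_neq_0]).
  set (E1 := fun v => (N1 (z * Cexp v) - N (z * Cexp v) / (z * Cexp v))%C).
  assert (DW : forall v, cderiv (fun v => z * Cexp v)%C v (z * Cexp v)).
  { intros v. eapply cderiv_eq; [|apply cderiv_mult; [apply cderiv_const|apply cderiv_Cexp]].
    cbv beta. ring. }
  assert (DE : forall v, Cmod v <= r -> cderiv E v (E1 v)).
  { intros v Hv. eapply cderiv_eq; [|apply cderiv_div; [|apply DW|apply W0]].
    2:{ apply (cderiv_comp N (fun v => z * Cexp v)%C); [apply DW|apply HN1, In, Hv]. }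
    cbv beta. unfold E1. field. split; [apply Cexp_neq_0|exact Hz0]. }
  assert (r0 : Cmod 0 <= r) by (rewrite Cmod_0; lra).
  assert (Ez1 : (z * Cexp 0)%C = z) by (rewrite Cexp_0; ring).
  set (e2 := (B / z)%C).
  assert (DE1 : cderiv E1 0 e2).
  { eapply cderiv_eq; [|apply cderiv_minus; [|apply (DE 0 r0)]].
    2:{ apply (cderiv_comp N1 (fun v => z * Cexp v)%C); [apply DW|apply HN2, In, r0]. }
    cbv beta. unfold E1, e2, B, A. rewrite !Ez1. field. exact Hz0. }
  assert (Ee1 : E1 0 = (- A / z)%C).
  { unfold E1, A. rewrite Ez1. field. exact Hz0. }
  set (e1 := E1 0) in *.
  assert (He1 : e1 <> 0).
  { rewrite Ee1. intros Q. apply HA.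
    replace A with (- z * (- A / z))%C by (field; exact Hz0). rewrite Q. ring. }
  destruct (second_order_expansion E E1 e2 r Hr DE DE1) as [M [HM Exp]]. fold e1 in Exp.
  set (s0 := (e2 / (2 * e1))%C).
  assert (Hs0 : 0 < Re s0).
  { assert (Q : s0 = (RtoC (- / 2) * (B / A))%C).
    { unfold s0, e2. rewrite Ee1, RtoC_opp, RtoC_inv by lra. field. auto. }
    rewrite Q. rewrite Re_mult_conj_div in Hneg by exact HA.
    assert (P := proj1 (Cmod_gt_0 A) HA). assert (P2 : 0 < Cmod A ^ 2) by (apply pow_lt; exact P).
    destruct (B / A)%C as [x y]. unfold Re in *. simpl in *. nra. }
  set (rho := Re s0 / 2). assert (Hrho : 0 < rho) by (unfold rho; lra).
  set (S := Cmod s0 + rho).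
  assert (S0 : 0 < S) by (unfold S; assert (T := Cmod_ge_0 s0); lra).
  assert (InS : forall s, Cmod (s - s0) <= rho -> rho <= Re s /\ Cmod s <= S).
  { intros s Hs. split.
    - assert (T := re_le_Cmod (s0 - s)). rewrite Cmod_sub_sym in Hs.
      assert (T2 := Rle_abs (Re (s0 - s))). unfold Re, Cminus, Cplus, Copp in *. simpl in *.
      unfold rho, Re in *. lra.
    - assert (T := Cmod_triangle_rev s s0). unfold S. lra. }
  set (K := M + Cmod e2 * S ^ 2 + M * S ^ 3).
  assert (HK : 0 < K).
  { unfold K. assert (0 <= Cmod e2 * S ^ 2) by (apply Rmult_le_pos; [apply Cmod_ge_0|apply pow_le; lra]).
    assert (0 <= M * S ^ 3) by (apply Rmult_le_pos; [lra|apply pow_le; lra]). lra. }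
  assert (P1 := proj1 (Cmod_gt_0 e1) He1).
  (* a parameter so small that the cubic error is dominated on the circle around [s0] *)
  assert (Ht : exists t, 0 < t /\ t <= 1 /\ t <= r /\ t * S <= r /\ t * (4 * K) <= Cmod e1 * rho).
  { set (t := Rmin (Rmin 1 r) (Rmin (r / S) (Cmod e1 * rho / (4 * K)))).
    assert (t1 : t <= 1) by (eapply Rle_trans; [apply Rmin_l|apply Rmin_l]).
    assert (t2 : t <= r) by (eapply Rle_trans; [apply Rmin_l|apply Rmin_r]).
    assert (t3 : t <= r / S) by (eapply Rle_trans; [apply Rmin_r|apply Rmin_l]).
    assert (t4 : t <= Cmod e1 * rho / (4 * K)) by (eapply Rle_trans; [apply Rmin_r|apply Rmin_r]).
    exists t. repeat split; try assumption.
    - assert (Q1 : 0 < r / S) by (apply Rdiv_lt_0_compat; lra).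
      assert (Q2 : 0 < Cmod e1 * rho / (4 * K)) by (apply Rdiv_lt_0_compat; nra).
      unfold t. repeat apply Rmin_glb_lt; lra.
    - apply (Rmult_le_compat_r S) in t3; [|lra]. replace (r / S * S) with r in t3 by (field; lra). exact t3.
    - apply (Rmult_le_compat_r (4 * K)) in t4; [|lra].
      replace (Cmod e1 * rho / (4 * K) * (4 * K)) with (Cmod e1 * rho) in t4 by (field; lra). exact t4. }
  destruct Ht as [t [t0 [t1 [tr [tS tK]]]]].
  assert (Tt : t * t <= t) by nra.
  set (u := fun s => (RtoC (- (t * t)) * s)%C).
  set (L := fun s => ((E (Ci * t) + E (Ci * (- t)%R)) / 2 - E (u s))%C).
  assert (Cu : forall s, Cmod (u s) = t * t * Cmod s).
  { intros s. unfold u. rewrite Cmod_mult, Cmod_R, Rabs_Ropp, Rabs_pos_eq by nra. reflexivity. }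
  assert (Ur : forall s, Cmod (s - s0) <= rho -> Cmod (u s) <= r).
  { intros s Hs. rewrite Cu. destruct (InS s Hs) as [_ Q]. assert (Q0 := Cmod_ge_0 s). nra. }
  assert (Cit : forall x, Cmod (Ci * RtoC x) = Rabs x).
  { intros x. rewrite Cmod_mult, Cmod_Ci, Cmod_R. ring. }
  assert (App : forall s, Cmod (s - s0) <= rho ->
            Cmod (L s - RtoC (t * t) * (e1 * (s - s0))) <= K * t ^ 3).
  { intros s Hs. destruct (InS s Hs) as [_ Qs]. assert (Q0 := Cmod_ge_0 s).
    assert (X1 := Exp (Ci * t)%C ltac:(rewrite Cit, Rabs_pos_eq; lra)).
    assert (X2 := Exp (Ci * (- t)%R)%C ltac:(rewrite Cit, Rabs_Ropp, Rabs_pos_eq; lra)).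
    assert (X3 := Exp (u s) (Ur s Hs)).
    rewrite Cit, Rabs_pos_eq in X1 by lra. rewrite Cit, Rabs_Ropp, Rabs_pos_eq in X2 by lra.
    rewrite Cu in X3.
    set (R1 := (E (Ci * t) - _)%C) in X1. set (R2 := (E (Ci * (- t)%R) - _)%C) in X2.
    set (R3 := (E (u s) - _)%C) in X3.
    assert (Id : (L s - RtoC (t * t) * (e1 * (s - s0)))%C
             = ((R1 + R2) / 2 - e2 / 2 * (RtoC (t * t) * RtoC (t * t)) * (s * s) - R3)%C).
    { unfold L, R1, R2, R3, u, s0. rewrite !RtoC_opp, RtoC_mult.
      replace (Ci * t * (Ci * t))%C with (- (t * t))%C.
      2:{ replace (Ci * t * (Ci * t))%C with (Ci * Ci * (t * t))%C by ring.
          replace (Ci * Ci)%C with (- (1))%C by (unfold Cmult, Copp, Ci, RtoC; simpl; f_equal; ring). ring. }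
      replace (Ci * - t * (Ci * - t))%C with (- (t * t))%C.
      2:{ replace (Ci * - t * (Ci * - t))%C with (Ci * Ci * (t * t))%C by ring.
          replace (Ci * Ci)%C with (- (1))%C by (unfold Cmult, Copp, Ci, RtoC; simpl; f_equal; ring). ring. }
      field. exact He1. }
    rewrite Id.
    eapply Rle_trans; [apply Cmod_triangle_sub|].
    eapply Rle_trans; [apply Rplus_le_compat_r, Cmod_triangle_sub|].
    assert (Y1 : Cmod ((R1 + R2) / 2) <= M * t ^ 3).
    { rewrite Cmod_div, Cmod_R, Rabs_pos_eq by (auto; lra).
      assert (T := Cmod_triangle R1 R2). lra. }
    assert (Y2 : Cmod (e2 / 2 * (RtoC (t * t) * RtoC (t * t)) * (s * s)) <= Cmod e2 * S ^ 2 * t ^ 3).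
    { rewrite !Cmod_mult, Cmod_div, !Cmod_R, (Rabs_pos_eq 2), Rabs_pos_eq by (auto; nra).
      assert (G1 : Cmod s * Cmod s <= S ^ 2) by (simpl; nra).
      assert (G2 : t * t * (t * t) <= t ^ 3) by (simpl; nra).
      assert (G3 : 0 <= Cmod e2) by apply Cmod_ge_0.
      replace (Cmod e2 * S ^ 2 * t ^ 3) with (Cmod e2 * t ^ 3 * S ^ 2) by ring.
      apply Rmult_le_compat.
      - apply Rmult_le_pos; [lra|nra].
      - nra.
      - apply Rmult_le_compat; [lra|nra|lra|exact G2].
      - exact G1. }
    assert (Y3 : M * (t * t * Cmod s) ^ 3 <= M * S ^ 3 * t ^ 3).
    { rewrite Rpow_mult_distr. rewrite Rmult_assoc. apply Rmult_le_compat_l; [lra|].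
      rewrite Rmult_comm. apply Rmult_le_compat.
      - now apply pow_le.
      - apply pow_le. nra.
      - apply pow_incr. lra.
      - apply pow_incr. split; [nra|exact Tt]. }
    unfold K. lra. }
  assert (Lne : forall s, Cmod (s - s0) <= rho -> L s <> 0).
  { intros s Hs E0. destruct (InS s Hs) as [Q _].
    assert (C1 : Cmod (Cexp (Ci * t)) = 1).
    { rewrite Cmod_Cexp. simpl. rewrite <- exp_0. f_equal. ring. }
    assert (C2 : Cmod (Cexp (Ci * (- t)%R)) = 1).
    { rewrite Cmod_Cexp. simpl. rewrite <- exp_0. f_equal. ring. }
    assert (C3 : 0 < Cmod (Cexp (u s)) < 1).
    { rewrite Cmod_Cexp. split; [apply exp_pos|]. rewrite <- exp_0. apply exp_increasing.
      assert (0 < t * t) by nra. unfold Re in Q. simpl. nra. }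
    apply (midpoint_not_inside N _ _ _ z HN C1 C2 C3 Hz).
    assert (Sc : forall v, (N (Cexp v * z) / Cexp v)%C = (z * E v)%C).
    { intros v. unfold E. rewrite (Cmult_comm (Cexp v) z). field. split; [apply Cexp_neq_0|exact Hz0]. }
    rewrite !Sc.
    replace ((z * E (Ci * t) + z * E (Ci * (- t)%R)) / 2)%C with (z * (L s + E (u s)))%C
      by (unfold L; field).
    rewrite E0. ring. }
  assert (Low : t * t * (Cmod e1 * rho) - K * t ^ 3 <= Cmod (L s0)).
  { apply (minimum_modulus L s0 rho).
    - assert (t * t * (t * (4 * K)) <= t * t * (Cmod e1 * rho)) by (apply Rmult_le_compat_l; nra).
      assert (0 < t * t * (t * K)) by (repeat apply Rmult_lt_0_compat; lra). simpl. nra.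
    - intros w Hw. apply cdiff_minus; [apply cdiff_const|].
      apply (cdiff_comp E u).
      + apply cdiff_mult; [apply cdiff_const|apply cdiff_id].
      + eexists. apply DE, Ur, Hw.
    - exact Lne.
    - intros w Hw. assert (Q := App w ltac:(lra)).
      assert (T := Cmod_triangle_rev (RtoC (t * t) * (e1 * (w - s0))) (L w)).
      rewrite Cmod_sub_sym in T. rewrite !Cmod_mult, Cmod_R, Hw, Rabs_pos_eq in T by nra. lra.
    - rewrite Cmod_sub_diag. lra. }
  assert (Up := App s0 ltac:(rewrite Cmod_sub_diag; lra)).
  replace (L s0 - RtoC (t * t) * (e1 * (s0 - s0)))%C with (L s0) in Up by ring.
  assert (t * t * (t * (4 * K)) <= t * t * (Cmod e1 * rho)) by (apply Rmult_le_compat_l; nra).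
  assert (0 < t * t * (t * K)) by (repeat apply Rmult_lt_0_compat; lra). simpl in *. nra.
Qed.

(** * Derivatives along segments *)

Lemma path_derive (g : C -> C) (a b : C) (t : R) (l : C) :
  cderiv g (a + RtoC t * b)%C l ->
  is_derive (fun s => fst (g (a + RtoC s * b)%C)) t (fst (l * b)%C) /\
  is_derive (fun s => snd (g (a + RtoC s * b)%C)) t (snd (l * b)%C).
Proof.
  intros Hl.
  assert (H : cderiv (fun s => g (a + s * b)%C) (RtoC t) (l * b)).
  { eapply cderiv_eq; [|apply (cderiv_comp g (fun s => a + s * b)%C); [|exact Hl]].
    2:{ apply cderiv_plus; [apply cderiv_const|apply cderiv_mult; [apply cderiv_id|apply cderiv_const]]. }
    cbv beta. ring. }
  destruct H as [phi [Hp [Ep H]]].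
  assert (Q : forall h, (g (a + RtoC (t + h) * b) - g (a + RtoC t * b) = RtoC h * phi (RtoC (t + h)))%C).
  { intros h. rewrite (H (RtoC (t + h))). rewrite RtoC_plus. ring. }
  split; apply is_derive_Reals; intros e He; destruct (Hp e He) as [d [Hd Hb]];
    exists (mkposreal d Hd); intros h Hh0 Hh; simpl in Hh;
    specialize (Q h); specialize (Hb (RtoC (t + h)));
    rewrite <- RtoC_minus, Cmod_R in Hb; replace (t + h - t) with h in Hb by ring;
    specialize (Hb Hh); rewrite Ep in Hb;
    (eapply Rle_lt_trans; [|exact Hb]); (eapply Rle_trans; [|apply Rmax_Cmod]).
  - eapply Rle_trans; [|apply Rmax_l]. right. f_equal.
    apply (f_equal fst) in Q. simpl in *. 
    unfold Rminus at 2. rewrite Q. field. exact Hh0.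
  - eapply Rle_trans; [|apply Rmax_r]. right. f_equal.
    apply (f_equal snd) in Q. simpl in *.
    unfold Rminus at 2. rewrite Q. field. exact Hh0.
Qed.

(** The factor 2 accounts for the two real components. *)
Lemma segment_mean_value (g g' : C -> C) (a b : C) (K : R) :
  (forall t, 0 <= t <= 1 -> cderiv g (a + RtoC t * b)%C (g' (a + RtoC t * b)%C)) ->
  (forall t, 0 <= t <= 1 -> Cmod (g' (a + RtoC t * b)%C * b) <= K) ->
  Cmod (g (a + b)%C - g a) <= 2 * K.
Proof.
  intros Hg HK.
  assert (Part : forall f df : R -> R,
            (forall t, 0 <= t <= 1 -> is_derive f t (df t)) -> (forall t, 0 <= t <= 1 -> Rabs (df t) <= K) ->
            Rabs (f 1 - f 0) <= K).
  { intros f df Hf Hdf. destruct (MVT_gen f 0 1 df) as [c [Hc Ec]].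
    - intros t Ht. rewrite Rmin_left, Rmax_right in Ht by lra. apply Hf. lra.
    - intros t Ht. rewrite Rmin_left, Rmax_right in Ht by lra.
      apply continuity_pt_filterlim. apply (ex_derive_continuous (V := R_NormedModule)).
      exists (df t). now apply Hf.
    - rewrite Rmin_left, Rmax_right in Hc by lra. rewrite Ec, Rminus_0_r, Rmult_1_r. now apply Hdf. }
  assert (E1 : (a + RtoC 1 * b)%C = (a + b)%C) by ring.
  assert (E0 : (a + RtoC 0 * b)%C = a) by ring.
  assert (Q1 := Part (fun t => fst (g (a + RtoC t * b)%C)) (fun t => fst (g' (a + RtoC t * b)%C * b)%C)).
  assert (Q2 := Part (fun t => snd (g (a + RtoC t * b)%C)) (fun t => snd (g' (a + RtoC t * b)%C * b)%C)).
  cbv beta in Q1, Q2. rewrite E1, E0 in Q1, Q2.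
  eapply Rle_trans; [apply Cmod_le_2Rmax|].
  assert (M : Rmax (Rabs (fst (g (a + b)%C - g a)%C)) (Rabs (snd (g (a + b)%C - g a)%C)) <= K).
  { apply Rmax_lub.
    - apply Q1; intros t Ht; [now apply path_derive, Hg|].
      eapply Rle_trans; [apply Rmax_l|]. eapply Rle_trans; [apply Rmax_Cmod|now apply HK].
    - apply Q2; intros t Ht; [now apply path_derive, Hg|].
      eapply Rle_trans; [apply Rmax_r|]. eapply Rle_trans; [apply Rmax_Cmod|now apply HK]. }
  lra.
Qed.

Lemma Cmod_segment (t : R) (b : C) : 0 <= t <= 1 -> Cmod (0 + RtoC t * b) <= Cmod b.
Proof.
  intros Ht. rewrite Cplus_0_l, Cmod_mult, Cmod_R, Rabs_pos_eq by lra.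
  assert (B := Cmod_ge_0 b). nra.
Qed.

Lemma constant_on_disc (g g' : C -> C) (z : C) :
  (forall w, Cmod w < 1 -> cderiv g w (g' w)) -> (forall w, Cmod w < 1 -> g' w = 0) ->
  Cmod z < 1 -> g z = g 0.
Proof.
  intros Hg H0 Hz.
  assert (In : forall t, 0 <= t <= 1 -> Cmod (0 + RtoC t * z) < 1).
  { intros t Ht. assert (T := Cmod_segment t z Ht). lra. }
  assert (B : Cmod (g (0 + z)%C - g 0) <= 2 * 0).
  { apply segment_mean_value with g'.
    - intros t Ht. now apply Hg, In.
    - intros t Ht. rewrite H0 by now apply In. rewrite Cmult_0_l, Cmod_0. lra. }
  rewrite Cplus_0_l in B.
  assert (E : (g z - g 0)%C = 0) by (apply Cmod_eq_0; assert (T := Cmod_ge_0 (g z - g 0)); lra).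
  replace (g z) with (g z - g 0 + g 0)%C by ring. rewrite E. ring.
Qed.

(** * The Schwarz-Pick estimate *)

Lemma Cmod_sqr (z : C) : Cmod z ^ 2 = Re z * Re z + Im z * Im z.
Proof. rewrite Cmod2_alt. ring. Qed.

Lemma Cmod_le_sqr (z w : C) : Cmod z ^ 2 <= Cmod w ^ 2 -> Cmod z <= Cmod w.
Proof.
  intros H. apply Rnot_lt_le. intros Hlt. assert (T := Cmod_ge_0 w). simpl in H. nra.
Qed.

Lemma schwarz_lemma (m : C -> C) (z : C) :
  (forall w, Cmod w < 1 -> cdiff m w) -> (forall w, Cmod w < 1 -> Cmod (m w) <= 1) -> m 0 = 0 ->
  Cmod z < 1 -> Cmod (m z) <= Cmod z.
Proof.
  intros Hm Hb H0 Hz. assert (Z0 := Cmod_ge_0 z).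
  assert (K : forall r, Cmod z < r < 1 -> r * Cmod (m z) <= Cmod z).
  { intros r Hr. destruct (holomorphic_quotient m r) as [q [Q [_ Hq]]]; [lra|intros; apply Hm; lra|].
    assert (B : Cmod (q z) <= / r).
    { apply (maximum_modulus q r); [exact Hq| |lra].
      intros w Hw. assert (Bw := Hb w ltac:(lra)). rewrite (Q w), H0, Cplus_0_l, Cmod_mult, Hw in Bw.
      apply Rmult_le_reg_l with r; [lra|]. rewrite Rinv_r; lra. }
    rewrite (Q z), H0, Cplus_0_l, Cmod_mult.
    apply (Rmult_le_compat_l r) in B; [|lra]. rewrite Rinv_r in B by lra. nra. }
  apply Rnot_lt_le. intros Hlt. set (v := Cmod (m z)) in *.
  assert (Hv : v <= 1) by (apply Hb; exact Hz).
  assert (Q := K ((Cmod z / v + 1) / 2)).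
  assert (D1 : Cmod z <= Cmod z / v).
  { apply Rmult_le_reg_r with v; [lra|]. unfold Rdiv. rewrite Rmult_assoc, Rinv_l by lra. nra. }
  assert (D2 : Cmod z / v < 1).
  { apply Rmult_lt_reg_r with v; [lra|]. unfold Rdiv. rewrite Rmult_assoc, Rinv_l by lra. lra. }
  specialize (Q ltac:(lra)).
  replace ((Cmod z / v + 1) / 2 * v) with ((Cmod z + v) / 2) in Q by (field; lra). lra.
Qed.

(** Passing through [c * chi] with [c < 1] covers the case of modulus 1 at the
    origin, where the conclusion forces [chi] to be constant. *)
Lemma schwarz_pick (chi : C -> C) (z : C) :
  (forall w, Cmod w < 1 -> cdiff chi w) -> (forall w, Cmod w < 1 -> Cmod (chi w) <= 1) ->
  Cmod z < 1 ->
  Cmod (chi z - chi 0) * (1 - Cmod z * Cmod (chi 0)) <= Cmod z * (1 - Cmod (chi 0) ^ 2).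
Proof.
  intros Hd Hb Hz. set (x := chi 0). assert (Z0 := Cmod_ge_0 z).
  assert (X1 : Cmod x <= 1) by (apply Hb; rewrite Cmod_0; lra). assert (X0 := Cmod_ge_0 x).
  set (d := Cmod (chi z - x)). assert (D0 : 0 <= d) by apply Cmod_ge_0.
  assert (K : forall c, 0 < c < 1 -> c * d * (1 - Cmod z * (c * Cmod x)) <= Cmod z * (1 - (c * Cmod x) ^ 2)).
  { intros c Hc. set (v := (RtoC c * x)%C).
    assert (Vm : Cmod v = c * Cmod x) by (unfold v; rewrite Cmod_mult, Cmod_R, Rabs_pos_eq; lra).
    assert (V1 : Cmod v < 1) by (rewrite Vm; nra).
    assert (Um : forall w, Cmod w < 1 -> Cmod (RtoC c * chi w) < 1).
    { intros w Hw. rewrite Cmod_mult, Cmod_R, Rabs_pos_eq by lra.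
      assert (T := Hb w Hw). assert (T2 := Cmod_ge_0 (chi w)). nra. }
    assert (Ne : forall w, Cmod w < 1 -> (1 - Cconj v * (RtoC c * chi w))%C <> 0).
    { intros w Hw. apply Csub_neq_0. intros E.
      assert (T : Cmod (Cconj v * (RtoC c * chi w)) < 1).
      { rewrite Cmod_mult, Cmod_conj. assert (T := Um w Hw).
        assert (T2 := Cmod_ge_0 (RtoC c * chi w)). assert (T3 := Cmod_ge_0 v). nra. }
      rewrite <- E, Cmod_1 in T. lra. }
    assert (Sc := schwarz_lemma (fun w => (RtoC c * chi w - v) / (1 - Cconj v * (RtoC c * chi w)))%C z).
    cbv beta in Sc.
    assert (Sd : forall w, Cmod w < 1 -> cdiff (fun w => RtoC c * chi w)%C w).
    { intros w Hw. apply cdiff_mult; [apply cdiff_const|now apply Hd]. }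
    assert (Q : Cmod ((RtoC c * chi z - v) / (1 - Cconj v * (RtoC c * chi z))) <= Cmod z).
    { apply Sc; [| | |exact Hz].
      - intros w Hw. apply cdiff_div; [| |now apply Ne].
        + apply cdiff_minus; [now apply Sd|apply cdiff_const].
        + apply cdiff_minus; [apply cdiff_const|]. apply cdiff_mult; [apply cdiff_const|now apply Sd].
      - intros w Hw. assert (N := proj1 (Cmod_gt_0 _) (Ne w Hw)).
        rewrite Cmod_div by now apply Ne.
        apply Rmult_le_reg_r with (Cmod (1 - Cconj v * (RtoC c * chi w))); [exact N|].
        unfold Rdiv. rewrite Rmult_assoc, Rinv_l, Rmult_1_l, Rmult_1_r by lra.
        apply Cmod_le_sqr.
        assert (T := Um w Hw). set (u := (RtoC c * chi w)%C) in *.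
        assert (U0 := Cmod_ge_0 u). assert (V0 := Cmod_ge_0 v).
        assert (U2 : Cmod u ^ 2 <= 1) by (simpl; nra). assert (V2 : Cmod v ^ 2 <= 1) by (simpl; nra).
        rewrite Cmod_sqr in U2, V2. rewrite !Cmod_sqr.
        destruct u as [u1 u2], v as [v1 v2]. unfold Re, Im in *. simpl in *.
        assert (0 <= (1 - (u1 * u1 + u2 * u2)) * (1 - (v1 * v1 + v2 * v2))) by (apply Rmult_le_pos; lra).
        lra.
      - fold x v. replace (v - v)%C with (RtoC 0) by ring. unfold Cdiv. ring. }
    rewrite Cmod_div in Q by now apply Ne.
    assert (N := proj1 (Cmod_gt_0 _) (Ne z Hz)).
    apply (Rmult_le_compat_r (Cmod (1 - Cconj v * (RtoC c * chi z)))) in Q; [|lra].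
    unfold Rdiv in Q. rewrite Rmult_assoc, Rinv_l, Rmult_1_r in Q by lra.
    assert (E1 : Cmod (RtoC c * chi z - v) = c * d).
    { unfold v. replace (RtoC c * chi z - RtoC c * x)%C with (RtoC c * (chi z - x))%C by ring.
      rewrite Cmod_mult, Cmod_R, Rabs_pos_eq; [reflexivity|lra]. }
    assert (E2 : Cmod (1 - Cconj v * (RtoC c * chi z)) <= 1 - Cmod v ^ 2 + Cmod v * (c * d)).
    { replace (1 - Cconj v * (RtoC c * chi z))%C
        with ((1 - v * Cconj v) - Cconj v * (RtoC c * chi z - v))%C by ring.
      eapply Rle_trans; [apply Cmod_triangle_sub|].
      rewrite Cmod_mult, Cmod_conj, E1, <- Cmod2_conj, <- RtoC_minus, Cmod_R, Rabs_pos_eq.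
      - lra.
      - assert (V0 := Cmod_ge_0 v). simpl. nra. }
    rewrite E1 in Q. rewrite Vm in E2.
    assert (Q2 : c * d <= Cmod z * (1 - (c * Cmod x) ^ 2 + c * Cmod x * (c * d))).
    { eapply Rle_trans; [exact Q|]. apply Rmult_le_compat_l; [exact Z0|exact E2]. }
    lra. }
  set (y := Cmod x) in *. set (q := Cmod z) in *.
  apply Rnot_lt_le. intros Hlt.
  set (gap := d * (1 - q * y) - q * (1 - y ^ 2)) in *.
  assert (G0 : 0 < gap) by (unfold gap; lra).
  set (L := 2 * q * y ^ 2 + d + 1).
  assert (L0 : 0 < L) by (unfold L; assert (0 <= q * y ^ 2) by (apply Rmult_le_pos; [lra|apply pow_le; lra]); lra).
  set (h := Rmin (1/2) (gap / (2 * L))).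
  assert (Hh : 0 < h) by (apply Rmin_glb_lt; [lra|apply Rdiv_lt_0_compat; lra]).
  assert (Hh2 : h <= 1/2) by apply Rmin_l.
  assert (Hh3 : h * (2 * L) <= gap).
  { assert (T : h <= gap / (2 * L)) by apply Rmin_r.
    apply (Rmult_le_compat_r (2 * L)) in T; [|lra].
    replace (gap / (2 * L) * (2 * L)) with gap in T by (field; lra). exact T. }
  specialize (K (1 - h) ltac:(lra)).
  assert (A1 : 0 <= q * y) by nra.
  assert (A2 : 0 <= q * y ^ 2) by (apply Rmult_le_pos; [lra|apply pow_le; lra]).
  assert (A3 : 0 <= d * (q * y)) by nra.
  assert (F : q * (1 - ((1 - h) * y) ^ 2) - (1 - h) * d * (1 - q * ((1 - h) * y))
            = - gap + q * y ^ 2 * (2 * h - h * h) + d * h - d * (q * y) * (2 * h - h * h))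
    by (unfold gap; ring).
  assert (B1 : q * y ^ 2 * (2 * h - h * h) <= q * y ^ 2 * (2 * h)) by (apply Rmult_le_compat_l; nra).
  assert (B2 : 0 <= d * (q * y) * (2 * h - h * h)) by (apply Rmult_le_pos; nra).
  unfold L in *. nra.
Qed.

(** * The sharp inequality *)

(** If [A = N - z N' = - z^2 F'] vanished at [z0], then, since the
    differential inequality makes [|A (t z0)| / t] nonincreasing in [t], it
    would vanish on the rest of the radius, and [F] would be constant there. *)
Lemma concave_derivative_nonzero (N N1 N2 : C -> C) (z : C) :
  concave_numerator N ->
  (forall w, Cmod w < 1 -> cderiv N w (N1 w)) -> (forall w, Cmod w < 1 -> cderiv N1 w (N2 w)) ->
  Cmod z < 1 -> (N z - z * N1 z)%C <> 0.
Proof.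
  intros HN HN1 HN2 Hz E0. set (A := fun w => (N w - w * N1 w)%C).
  assert (Hz0 : z <> 0).
  { intros Ez. rewrite Ez in E0. apply (cn_pole N HN). replace (N 0) with (N 0 - 0 * N1 0)%C by ring. exact E0. }
  assert (Zp := proj1 (Cmod_gt_0 z) Hz0).
  assert (DA : forall w, Cmod w < 1 -> cderiv A w (- (w * N2 w))%C).
  { intros w Hw. eapply cderiv_eq; [|apply cderiv_minus; [now apply HN1|
      apply cderiv_mult; [apply cderiv_id|now apply HN2]]]. cbv beta. ring. }
  set (T := (1 + / Cmod z) / 2).
  assert (HI : 1 < / Cmod z) by (rewrite <- Rinv_1; apply Rinv_lt_contravar; lra).
  assert (HT : 1 < T) by (unfold T; lra).
  assert (TZ : T * Cmod z < 1).
  { unfold T. replace ((1 + / Cmod z) / 2 * Cmod z) with ((Cmod z + 1) / 2) by (field; lra). lra. }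
  assert (In : forall t, 1 <= t <= T -> Cmod (RtoC t * z) < 1).
  { intros t Ht. rewrite Cmod_mult, Cmod_R, Rabs_pos_eq by lra. nra. }
  set (X := fun t => fst (A (0 + RtoC t * z)%C)). set (Y := fun t => snd (A (0 + RtoC t * z)%C)).
  set (phi := fun t => (X t * X t + Y t * Y t) / (t * t)).
  assert (E0t : forall t, (0 + RtoC t * z)%C = (RtoC t * z)%C) by (intros; ring).
  set (W := fun t => (- ((RtoC t * z) * N2 (RtoC t * z)) * z)%C).
  set (dphi := fun t => ((2 * X t * fst (W t) + 2 * Y t * snd (W t)) * (t * t)
                         - (X t * X t + Y t * Y t) * (2 * t)) / ((t * t) * (t * t))).
  assert (Dphi : forall t, 1 <= t <= T -> is_derive phi t (dphi t)).
  { intros t Ht.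
    assert (Hp : is_derive X t (fst (W t)) /\ is_derive Y t (snd (W t))).
    { apply path_derive. rewrite E0t. now apply DA, In. }
    destruct Hp as [HX HY].
    unfold phi, dphi.
    assert (Dn : is_derive (fun t => t * t) t (2 * t)) by (auto_derive; [auto|ring]).
    assert (Nm : is_derive (fun t => X t * X t + Y t * Y t) t (2 * X t * fst (W t) + 2 * Y t * snd (W t))).
    { replace (2 * X t * fst (W t) + 2 * Y t * snd (W t))
        with ((fst (W t) * X t + X t * fst (W t)) + (snd (W t) * Y t + Y t * snd (W t))) by ring.
      apply (is_derive_plus (V := R_NormedModule) (fun t => X t * X t) (fun t => Y t * Y t));
        apply (Derive.is_derive_mult); assumption || (intros; apply Rmult_comm). }
    replace (((2 * X t * fst (W t) + 2 * Y t * snd (W t)) * (t * t)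
              - (X t * X t + Y t * Y t) * (2 * t)) / ((t * t) * (t * t)))
      with (((2 * X t * fst (W t) + 2 * Y t * snd (W t)) * (t * t)
              - (X t * X t + Y t * Y t) * (2 * t)) / (t * t) ^ 2) by (field; lra).
    apply (is_derive_div (fun t => X t * X t + Y t * Y t) (fun t => t * t)); auto. nra. }
  assert (Sphi : forall t, 1 <= t <= T -> dphi t <= 0).
  { intros t Ht. assert (CI := concave_inequality N N1 N2 (RtoC t * z) HN HN1 HN2 (In t Ht)).
    fold (A (RtoC t * z)%C) in CI.
    assert (EA : A (RtoC t * z)%C = (X t, Y t)).
    { unfold X, Y. rewrite E0t. now destruct (A (RtoC t * z)%C). }
    rewrite EA in CI.
    assert (EW : (RtoC t * z * (RtoC t * z) * N2 (RtoC t * z))%C = (RtoC (- t) * W t)%C).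
    { unfold W. rewrite RtoC_opp. ring. }
    rewrite EW in CI. unfold dphi. destruct (W t) as [w1 w2]. unfold Re in CI. simpl in CI. simpl.
    assert (t3 : 0 < t * t * t) by (assert (0 < t * t) by nra; nra).
    set (x := X t) in *. set (y := Y t) in *.
    replace (((2 * x * w1 + 2 * y * w2) * (t * t) - (x * x + y * y) * (2 * t)) / (t * t * (t * t)))
      with (- (2 * ((x * x + y * y) - t * (x * w1 + y * w2)) / (t * t * t))) by (field; lra).
    assert (0 <= 2 * (x * x + y * y - t * (x * w1 + y * w2)) / (t * t * t)); [|lra].
    apply Rmult_le_pos; [nra|]. left. now apply Rinv_0_lt_compat. }
  assert (Zero : forall t, 1 <= t <= T -> A (RtoC t * z)%C = 0).
  { intros t Ht. destruct (MVT_gen phi 1 t dphi) as [c [Hc Ec]].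
    - intros s Hs. rewrite Rmin_left, Rmax_right in Hs by lra. apply Dphi. lra.
    - intros s Hs. rewrite Rmin_left, Rmax_right in Hs by lra.
      apply continuity_pt_filterlim. apply (ex_derive_continuous (V := R_NormedModule)).
      exists (dphi s). apply Dphi. lra.
    - rewrite Rmin_left, Rmax_right in Hc by lra.
      assert (Sc := Sphi c ltac:(lra)).
      assert (P1 : phi 1 = 0).
      { unfold phi, X, Y. replace (0 + 1 * z)%C with z by ring.
        unfold A at 1 2 3 4. rewrite E0. simpl. field. }
      assert (Le : phi t <= 0) by nra.
      unfold phi in Le.
      assert (S0 : X t * X t + Y t * Y t <= 0).
      { apply Rmult_le_reg_r with (/ (t * t)); [apply Rinv_0_lt_compat; nra|]. rewrite Rmult_0_l. exact Le. }
      assert (EA : A (RtoC t * z)%C = (X t, Y t)).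
      { unfold X, Y. rewrite E0t. now destruct (A (RtoC t * z)%C). }
      rewrite EA. assert (X t = 0) by nra. assert (Y t = 0) by nra. rewrite H, H0. reflexivity. }
  assert (Const : Cmod (N (RtoC T * z)%C / (RtoC T * z) - N z / z) <= 2 * 0).
  { replace (RtoC T * z)%C with (z + RtoC (T - 1) * z)%C by (rewrite RtoC_minus; ring).
    assert (Seg : forall t, 0 <= t <= 1 -> (z + RtoC t * (RtoC (T - 1) * z))%C = (RtoC (1 + t * (T - 1)) * z)%C).
    { intros t Ht. rewrite RtoC_plus, RtoC_mult. ring. }
    apply (segment_mean_value (fun w => N w / w)%C (fun w => - A w / (w * w))%C).
    - intros t Ht. rewrite Seg by exact Ht. set (w := (RtoC (1 + t * (T - 1)) * z)%C).
      assert (Ht2 : 1 <= 1 + t * (T - 1) <= T) by nra.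
      assert (Wn : w <> 0).
      { apply Cmult_neq_0; [|exact Hz0]. apply Cmod_pos_neq. rewrite Cmod_R, Rabs_pos_eq; lra. }
      eapply cderiv_eq; [|apply cderiv_div; [apply HN1, In, Ht2|apply cderiv_id|exact Wn]].
      unfold A. field. exact Wn.
    - intros t Ht. rewrite Seg by exact Ht. rewrite Zero by nra.
      replace (- 0 / (RtoC (1 + t * (T - 1)) * z * (RtoC (1 + t * (T - 1)) * z)) * (RtoC (T - 1) * z))%C
        with (RtoC 0) by (unfold Cdiv; ring). rewrite Cmod_0. lra. }
  set (D := (N (RtoC T * z) / (RtoC T * z) - N z / z)%C) in *.
  assert (D0 : D = 0) by (apply Cmod_eq_0; assert (Q := Cmod_ge_0 D); lra).
  assert (Tn : RtoC T <> 0) by (apply RtoC_pos_neq; lra).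
  assert (Eq : (RtoC T * z)%C = z).
  { apply (cn_inj N HN); [apply In; lra|exact Hz|].
    replace (N (RtoC T * z) * z)%C with (D * (RtoC T * z) * z + N z * (RtoC T * z))%C
      by (unfold D; field; auto). rewrite D0. ring. }
  apply (f_equal Cmod) in Eq. rewrite Cmod_mult, Cmod_R, Rabs_pos_eq in Eq by lra. nra.
Qed.

(** Up to the factor [z^2] the Cayley transform of [- 1 - z F'' / F'], a
    function of nonnegative real part, is a function [chi] bounded by 1; it
    determines [N] through a linear differential equation. *)
Lemma concave_schwarz_function (N N1 N2 : C -> C) :
  concave_numerator N ->
  (forall w, Cmod w < 1 -> cderiv N w (N1 w)) ->
  (forall w, Cmod w < 1 -> cderiv N1 w (N2 w) /\ cdiff N2 w) ->
  exists chi : C -> C,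
    (forall w, Cmod w < 1 -> cdiff chi w /\ Cmod (chi w) <= 1) /\
    chi 0 = (N2 0 / (2 * N 0))%C /\
    forall w, Cmod w < 1 -> (N2 w * (1 - w * w * chi w) = 2 * chi w * (N w - w * N1 w))%C.
Proof.
  intros HN HN1 HN2'.
  assert (HN2 : forall w, Cmod w < 1 -> cderiv N1 w (N2 w)) by (intros; now apply HN2').
  set (A := fun w => (N w - w * N1 w)%C). set (D := fun w => (2 * A w + w * w * N2 w)%C).
  set (chi := fun w => (N2 w / D w)%C).
  assert (Ineq : forall w, Cmod w < 1 -> Cmod (w * w * N2 w) <= Cmod (D w) /\ D w <> 0).
  { intros w Hw. assert (CI := concave_inequality N N1 N2 w HN HN1 HN2 Hw).
    assert (An := concave_derivative_nonzero N N1 N2 w HN HN1 HN2 Hw).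
    fold (A w) in CI, An. unfold D. set (b := (w * w * N2 w)%C) in *.
    assert (Ap := proj1 (Cmod_gt_0 _) An). assert (Ap2 : 0 < Cmod (A w) ^ 2) by (apply pow_lt; exact Ap).
    rewrite Cmod_sqr in Ap2.
    assert (Key : Cmod b ^ 2 + 4 * Re ((A w + b) * Cconj (A w)) = Cmod (2 * A w + b) ^ 2).
    { rewrite !Cmod_sqr. destruct (A w) as [x y], b as [u v]. unfold Re, Im. simpl. ring. }
    split.
    - apply Cmod_le_sqr. lra.
    - intros E. assert (Eb : b = (- (2 * A w))%C).
      { replace b with (2 * A w + b - 2 * A w)%C by ring. rewrite E. ring. }
      rewrite Eb in CI. destruct (A w) as [x y]. unfold Re, Im in *. simpl in *. nra. }
  assert (Dchi : forall w, Cmod w < 1 -> cdiff chi w).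
  { intros w Hw. apply cdiff_div; [now apply HN2'| |now apply Ineq].
    assert (cdiff A w).
    { apply cdiff_minus; [eexists; now apply HN1|]. apply cdiff_mult; [apply cdiff_id|].
      eexists; now apply HN2. }
    apply cdiff_plus; [apply cdiff_mult; [apply cdiff_const|assumption]|].
    apply cdiff_mult; [apply cdiff_mult; apply cdiff_id|now apply HN2']. }
  assert (Bz : forall w, Cmod w < 1 -> Cmod w ^ 2 * Cmod (chi w) <= 1).
  { intros w Hw. destruct (Ineq w Hw) as [I1 I2]. assert (Dp := proj1 (Cmod_gt_0 _) I2).
    unfold chi. rewrite Cmod_div by exact I2. rewrite !Cmod_mult in I1.
    apply Rmult_le_reg_r with (Cmod (D w)); [exact Dp|].
    replace (Cmod w ^ 2 * (Cmod (N2 w) / Cmod (D w)) * Cmod (D w))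
      with (Cmod w * Cmod w * Cmod (N2 w)) by (field; lra). lra. }
  exists chi. split; [|split].
  - intros w Hw. split; [now apply Dchi|]. assert (W0 := Cmod_ge_0 w).
    assert (K : forall r, Cmod w < r < 1 -> r ^ 2 * Cmod (chi w) <= 1).
    { intros r Hr. assert (r2 : 0 < r ^ 2) by (apply pow_lt; lra).
      assert (B : Cmod (chi w) <= / r ^ 2).
      { apply (maximum_modulus chi r); [intros; apply Dchi; lra| |lra].
        intros y Hy. assert (By := Bz y ltac:(lra)). rewrite Hy in By.
        apply Rmult_le_reg_l with (r ^ 2); [exact r2|]. rewrite Rinv_r; lra. }
      apply (Rmult_le_compat_l (r ^ 2)) in B; [|lra]. rewrite Rinv_r in B; lra. }
    apply Rnot_lt_le. intros Hlt. set (v := Cmod (chi w)) in *.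
    set (r := (1 + Rmax (Cmod w) (/ v)) / 2).
    assert (V1 : / v < 1) by (rewrite <- Rinv_1; apply Rinv_lt_contravar; lra).
    assert (V0 : 0 < / v) by (apply Rinv_0_lt_compat; lra).
    assert (M1 : Rmax (Cmod w) (/ v) < 1) by (apply Rmax_lub_lt; lra).
    assert (M2 := Rmax_l (Cmod w) (/ v)). assert (M3 := Rmax_r (Cmod w) (/ v)).
    specialize (K r ltac:(unfold r; lra)).
    (* [r > (1 + 1/v) / 2], so [r^2 v > 1] by the arithmetic-geometric inequality *)
    assert (R1 : (1 + / v) / 2 <= r) by (unfold r; lra).
    assert (V2 : v * / v = 1) by (apply Rinv_r; lra).
    set (q := / v) in *.
    assert (R2 : ((1 + q) / 2) ^ 2 <= r ^ 2) by (apply pow_incr; lra).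
    assert (R3 : ((1 + q) / 2) ^ 2 * v <= r ^ 2 * v) by (apply Rmult_le_compat_r; lra).
    assert (R4 : 0 < (1 - q) * (1 - q)) by nra.
    assert (R5 : 0 < (1 - q) * (1 - q) * v) by nra.
    simpl in *. nra.
  - unfold chi, D, A.
    replace (2 * (N 0 - 0 * N1 0) + 0 * 0 * N2 0)%C with (2 * N 0)%C by ring. reflexivity.
  - intros w Hw. change (N w - w * N1 w)%C with (A w).
    destruct (Ineq w Hw) as [_ I2]. unfold chi. replace (2 * A w)%C with (D w - w * w * N2 w)%C by (unfold D; ring).
    replace (2 * (N2 w / D w) * A w)%C with ((N2 w / D w) * (2 * A w))%C by ring.
    replace (2 * A w)%C with (D w - w * w * N2 w)%C by (unfold D; ring).
    field. exact I2.
Qed.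

(** Compare [N] with the extremal numerators [a + b z + a x z^2], for which
    [N - z N' = a (1 - x z^2)]: the logarithmic derivative of the quotient of
    the two is, by Schwarz-Pick, at most of the order of [1 - |x|]. The linear
    dependence on [1 - |x|] makes the estimate sharp up to [|x| = 1]. *)
Theorem concave_coefficient_inequality (N N1 N2 : C -> C) (p : R) :
  concave_numerator N ->
  (forall w, Cmod w < 1 -> cderiv N w (N1 w)) ->
  (forall w, Cmod w < 1 -> cderiv N1 w (N2 w) /\ cdiff N2 w) ->
  0 < p <= 3 / 10 ->
  let x := (N2 0 / (2 * N 0))%C in
  let H := ((N (- p)%R + p * N1 (- p)%R) / N 0)%C in
  Cmod x <= 1 /\
  Cmod x <= Cmod (H + p * p * x) /\
  (Cmod (H + p * p * x) = Cmod x -> Cmod x = 1) /\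
  (Cmod x = 1 -> forall z, Cmod z < 1 -> N z = (N 0 + N1 0 * z + N 0 * x * (z * z))%C).
Proof.
  intros HN HN1 HN2 Hp x H.
  destruct (concave_schwarz_function N N1 N2 HN HN1 HN2) as [chi [Hchi [E0 Eq]]].
  fold x in E0. set (a := N 0) in *. assert (Ha : a <> 0) by apply (cn_pole N HN).
  set (y := Cmod x).
  assert (Y0 : 0 <= y) by apply Cmod_ge_0.
  assert (Y1 : y <= 1) by (unfold y; rewrite <- E0; apply Hchi; rewrite Cmod_0; lra).
  assert (N22 : RtoC 2 <> RtoC 0) by (apply RtoC_pos_neq; lra).
  assert (SP : forall z, Cmod z < 1 -> Cmod (chi z - x) * (1 - Cmod z * y) <= Cmod z * (1 - y ^ 2)).
  { intros z Hz. unfold y. rewrite <- E0. apply schwarz_pick; [apply Hchi|apply Hchi|exact Hz]. }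
  assert (Low : forall w c : C, Cmod w < 1 -> Cmod c <= 1 -> 1 - Cmod w ^ 2 <= Cmod (1 - w * w * c)).
  { intros w c Hw Hc. assert (T := Cmod_triangle_rev 1 (w * w * c)). rewrite Cmod_1, !Cmod_mult in T.
    assert (W := Cmod_ge_0 w). assert (Cp := Cmod_ge_0 c).
    assert (Cmod w * Cmod w * Cmod c <= Cmod w * Cmod w) by nra. simpl. lra. }
  assert (Ne : forall w c : C, Cmod w < 1 -> Cmod c <= 1 -> (1 - w * w * c)%C <> 0).
  { intros w c Hw Hc. apply Cmod_pos_neq. assert (L := Low w c Hw Hc).
    assert (W := Cmod_ge_0 w). simpl in L. nra. }
  set (A := fun w => (N w - w * N1 w)%C).
  set (R := fun w => (A w / (a * (1 - w * w * x)))%C).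
  set (g := fun w => (- (2 * w * (chi w - x)) / ((1 - w * w * chi w) * (1 - w * w * x)))%C).
  assert (DR : forall w, Cmod w < 1 -> cderiv R w (R w * g w)).
  { intros w Hw. destruct (HN2 w Hw) as [H2 _].
    assert (C1 := Ne w (chi w) Hw (proj2 (Hchi w Hw))). assert (C2 := Ne w x Hw Y1).
    assert (DA : cderiv A w (- (w * N2 w))).
    { eapply cderiv_eq; [|apply cderiv_minus; [now apply HN1|
        apply cderiv_mult; [apply cderiv_id|exact H2]]]. cbv beta. ring. }
    eapply cderiv_eq; [|apply cderiv_div; [exact DA| |now apply Cmult_neq_0]].
    2:{ apply cderiv_mult; [apply cderiv_const|]. apply cderiv_minus; [apply cderiv_const|].
        apply cderiv_mult; [apply cderiv_mult; apply cderiv_id|apply cderiv_const]. }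
    cbv beta. assert (E := Eq w Hw). fold (A w) in E.
    assert (EN : N2 w = (2 * chi w * A w / (1 - w * w * chi w))%C).
    { rewrite <- E. field. exact C1. }
    rewrite EN. unfold R, g. field. auto. }
  assert (R0 : R 0 = 1).
  { unfold R, A. fold a. replace (a - 0 * N1 0)%C with a by ring. field. exact Ha. }
  set (G := 2 * p * p * (1 - y ^ 2) / ((1 - p) * ((1 - p ^ 2) * (1 - p ^ 2)))).
  assert (Y2 : 0 <= 1 - y ^ 2 <= 1) by (simpl; nra).
  assert (pp : 0 < 1 - p ^ 2) by (simpl; nra).
  assert (DG : 0 < (1 - p) * ((1 - p ^ 2) * (1 - p ^ 2))).
  { apply Rmult_lt_0_compat; [lra|]. now apply Rmult_lt_0_compat. }
  assert (DG2 : 57 / 100 <= (1 - p) * ((1 - p ^ 2) * (1 - p ^ 2))).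
  { assert (91/100 <= 1 - p ^ 2) by (simpl; nra).
    assert (8281/10000 <= (1 - p ^ 2) * (1 - p ^ 2)) by nra. nra. }
  (* this is where [p <= 3/10] enters: [2 p^3 <= 0.054] and [0.054 / 0.57 < 1/10] *)
  assert (Gs : 0 <= p * G <= (1 - y ^ 2) / 10).
  { assert (pG : p * G = 2 * (p * p * p) * (1 - y ^ 2) / ((1 - p) * ((1 - p ^ 2) * (1 - p ^ 2))))
      by (unfold G; field; repeat split; lra).
    rewrite pG.
    assert (p3 : 0 <= p * p * p <= 27 / 1000) by (assert (0 <= p * p <= 9/100) by nra; nra).
    split.
    - apply Rmult_le_pos; [|left; now apply Rinv_0_lt_compat]. apply Rmult_le_pos; lra.
    - apply Rmult_le_reg_r with ((1 - p) * ((1 - p ^ 2) * (1 - p ^ 2))); [exact DG|].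
      unfold Rdiv at 1. rewrite Rmult_assoc, Rinv_l, Rmult_1_r by lra. nra. }
  assert (Bg : forall w, Cmod w <= p -> Cmod (g w) <= G).
  { intros w Hw. assert (W0 := Cmod_ge_0 w). assert (Hw1 : Cmod w < 1) by lra.
    assert (L1 := Low w (chi w) Hw1 (proj2 (Hchi w Hw1))). assert (L2 := Low w x Hw1 Y1).
    assert (Cmod w ^ 2 <= p ^ 2) by (apply pow_incr; lra).
    assert (S1 := SP w Hw1).
    assert (S2 : Cmod (chi w - x) * (1 - p) <= p * (1 - y ^ 2)).
    { assert (D0 := Cmod_ge_0 (chi w - x)).
      apply Rle_trans with (Cmod (chi w - x) * (1 - Cmod w * y)).
      - apply Rmult_le_compat_l; [exact D0|]. nra.
      - eapply Rle_trans; [exact S1|]. apply Rmult_le_compat_r; lra. }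
    unfold g. rewrite Cmod_div, Cmod_opp, !Cmod_mult, Cmod_R, Rabs_pos_eq
      by (try lra; apply Cmult_neq_0; apply Ne; auto; now apply Hchi).
    set (d := Cmod (chi w - x)) in *. assert (D0 : 0 <= d) by apply Cmod_ge_0.
    set (d1 := Cmod (1 - w * w * chi w)) in *. set (d2 := Cmod (1 - w * w * x)) in *.
    assert (Q1 : (1 - p ^ 2) * (1 - p ^ 2) <= d1 * d2) by (apply Rmult_le_compat; lra).
    apply Rle_trans with (2 * p * d / ((1 - p ^ 2) * (1 - p ^ 2))).
    - apply Rmult_le_compat.
      + nra.
      + left. apply Rinv_0_lt_compat. apply Rmult_lt_0_compat; lra.
      + apply Rmult_le_compat_r; lra.
      + apply Rinv_le_contravar; [now apply Rmult_lt_0_compat|exact Q1].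
    - unfold G.
      replace (2 * p * p * (1 - y ^ 2) / ((1 - p) * ((1 - p ^ 2) * (1 - p ^ 2))))
        with (2 * p * (p * (1 - y ^ 2) / (1 - p)) / ((1 - p ^ 2) * (1 - p ^ 2)))
        by (field; repeat split; lra).
      apply Rmult_le_compat_r; [left; apply Rinv_0_lt_compat; now apply Rmult_lt_0_compat|].
      apply Rmult_le_compat_l; [lra|].
      apply Rmult_le_reg_r with (1 - p); [lra|].
      replace (p * (1 - y ^ 2) / (1 - p) * (1 - p)) with (p * (1 - y ^ 2)) by (field; lra). exact S2. }
  assert (Step : forall M, (forall w, Cmod w <= p -> Cmod (R w) <= M) ->
            forall w, Cmod w <= p -> Cmod (R w - 1) <= 2 * (p * G * M)).
  { intros M HM w Hw. rewrite <- R0. replace w with (0 + w)%C at 1 by ring.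
    assert (In : forall t, 0 <= t <= 1 -> Cmod (0 + RtoC t * w) <= p).
    { intros t Ht. assert (T := Cmod_segment t w Ht). lra. }
    apply segment_mean_value with (fun w => R w * g w)%C.
    - intros t Ht. apply DR. assert (T := In t Ht). lra.
    - intros t Ht. specialize (In t Ht). rewrite !Cmod_mult.
      assert (T1 := HM _ In). assert (T2 := Bg _ In).
      assert (T3 := Cmod_ge_0 (R (0 + RtoC t * w)%C)). assert (T4 := Cmod_ge_0 (g (0 + RtoC t * w)%C)).
      assert (T5 := Cmod_ge_0 w).
      replace (p * G * M) with (M * G * p) by ring.
      apply Rmult_le_compat; [nra|lra| |lra]. apply Rmult_le_compat; lra. }
  (* [Step] with the supremum [M] of [|R|] gives [M <= 1 + M / 5], hence [M <= 5/4] *)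
  assert (Fin : forall w, Cmod w <= p -> Cmod (R w - 1) <= (1 - y ^ 2) / 4).
  { destruct (bounded_on_disc p R) as [M0 [HM0 BM0]].
    { intros w Hw. eapply cderiv_cont. apply DR. lra. }
    destruct (completeness (fun v => exists w, Cmod w <= p /\ v = Cmod (R w))) as [M [Up Least]].
    - exists M0. intros v [w [Hw ->]]. now apply BM0.
    - exists (Cmod (R 0)), 0. rewrite Cmod_0. split; [lra|reflexivity].
    - assert (HM : forall w, Cmod w <= p -> Cmod (R w) <= M) by (intros w Hw; apply Up; now exists w).
      assert (St := Step M HM).
      assert (M1 : M <= 1 + 2 * (p * G * M)).
      { apply Least. intros v [w [Hw ->]]. assert (T := St w Hw).
        assert (T2 := Cmod_triangle_rev (R w) 1). rewrite Cmod_1 in T2. lra. }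
      assert (M5 : M <= 5 / 4) by nra.
      assert (Mp : 1 <= M).
      { rewrite <- Cmod_1, <- R0. apply HM. rewrite Cmod_0. lra. }
      intros w Hw. eapply Rle_trans; [now apply St|]. nra. }
  assert (Mp : Cmod (RtoC (- p)) = p) by (rewrite Cmod_R, Rabs_Ropp, Rabs_pos_eq; lra).
  assert (EH : (H + p * p * x)%C = (1 + (1 - p * p * x) * (R (RtoC (- p)) - 1))%C).
  { unfold R, A, H. rewrite RtoC_opp.
    assert (C2 := Ne (RtoC (- p)) x ltac:(lra) Y1). rewrite RtoC_opp in C2.
    field. split; [|exact Ha].
    intros E. apply C2. rewrite <- E. ring. }
  assert (Main : 1 - 3 / 5 * (1 - y) <= Cmod (H + p * p * x)).
  { rewrite EH. set (e := (R (RtoC (- p)) - 1)%C).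
    assert (He : Cmod e <= (1 - y ^ 2) / 4) by (apply Fin; lra).
    assert (T := Cmod_triangle_rev 1 (- ((1 - p * p * x) * e))).
    replace (1 - - ((1 - p * p * x) * e))%C with (1 + (1 - p * p * x) * e)%C in T by ring.
    rewrite Cmod_opp, Cmod_1, Cmod_mult in T.
    assert (T2 := Cmod_triangle_sub 1 (p * p * x)).
    rewrite Cmod_1, !Cmod_mult, Cmod_R, Rabs_pos_eq in T2 by lra. fold y in T2.
    assert (P2 : p * p * y <= 9 / 100) by (assert (0 <= p * p <= 9/100) by nra; nra).
    assert (E0' := Cmod_ge_0 e). assert (D0 := Cmod_ge_0 (1 - p * p * x)).
    assert (Q : Cmod (1 - p * p * x) * Cmod e <= (109/100) * ((1 - y ^ 2) / 4))
      by (apply Rmult_le_compat; lra).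
    simpl in *. nra. }
  split; [exact Y1|]. split; [lra|]. split; [intros E; fold y in E; rewrite E in Main; fold y; lra|].
  intros Yeq z Hz. fold y in Yeq.
  assert (Chi : forall w, Cmod w < 1 -> chi w = x).
  { intros w Hw. assert (T := SP w Hw). rewrite Yeq in T.
    assert (D0 := Cmod_ge_0 (chi w - x)).
    assert (E : (chi w - x)%C = 0) by (apply Cmod_eq_0; nra).
    replace (chi w) with (chi w - x + x)%C by ring. rewrite E. ring. }
  assert (Rc : forall w, Cmod w < 1 -> R w = 1).
  { intros w Hw. rewrite <- R0. apply constant_on_disc with (fun w => R w * g w)%C; auto.
    intros v Hv. unfold g. rewrite (Chi v Hv). unfold Cdiv. ring. }
  assert (N2c : forall w, Cmod w < 1 -> N2 w = (2 * a * x)%C).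
  { intros w Hw. assert (E := Eq w Hw). fold (A w) in E. rewrite (Chi w Hw) in E.
    assert (C2 := Ne w x Hw Y1).
    assert (EA : A w = (a * (1 - w * w * x))%C).
    { replace (A w) with (R w * (a * (1 - w * w * x)))%C by (unfold R; field; auto).
      rewrite (Rc w Hw). ring. }
    rewrite EA in E.
    replace (N2 w) with (N2 w * (1 - w * w * x) / (1 - w * w * x))%C by (field; exact C2).
    rewrite E. field. exact C2. }
  assert (N1c : forall w, Cmod w < 1 -> N1 w = (N1 0 + 2 * a * x * w)%C).
  { intros w Hw.
    assert (E := constant_on_disc (fun w => N1 w - 2 * a * x * w)%C (fun w => N2 w - 2 * a * x)%C w).
    cbv beta in E.
    replace (N1 w) with (N1 w - 2 * a * x * w + 2 * a * x * w)%C by ring. rewrite E; auto.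
    - ring.
    - intros v Hv. eapply cderiv_eq; [|apply cderiv_minus; [now apply HN2|
        apply cderiv_mult; [apply cderiv_const|apply cderiv_id]]]. cbv beta. ring.
    - intros v Hv. rewrite (N2c v Hv). ring. }
  assert (E := constant_on_disc (fun w => N w - (N1 0 * w + a * x * (w * w)))%C
                 (fun w => N1 w - (N1 0 + 2 * a * x * w))%C z).
  cbv beta in E.
  replace (N z) with (N z - (N1 0 * z + a * x * (z * z)) + (N1 0 * z + a * x * (z * z)))%C by ring.
  rewrite E; auto.
  - fold a. ring.
  - intros v Hv. eapply cderiv_eq; [|apply cderiv_minus; [now apply HN1|apply cderiv_plus;
      [apply cderiv_mult; [apply cderiv_const|apply cderiv_id]|
       apply cderiv_mult; [apply cderiv_const|apply cderiv_mult; apply cderiv_id]]]].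
    cbv beta. ring.
  - intros v Hv. rewrite (N1c v Hv). ring.
Qed.

(** * The Laurent coefficient *)

Lemma Some_C_inj (a b : C) : Some a = Some b -> a = b.
Proof. intros H. exact (f_equal (fun o => match o with Some w => w | None => a end) H). Qed.

Lemma Cmod_zero_limit (d : C) (K r : R) :
  0 < r -> (forall h, 0 < Cmod h < r -> Cmod d <= K * Cmod h) -> d = 0.
Proof.
  intros Hr H. apply Cmod_eq_0. apply eps_zero with (Rabs K); [apply Cmod_ge_0|]. intros e He.
  set (t := Rmin e (r / 2)). assert (Ht : 0 < t) by (apply Rmin_glb_lt; lra).
  assert (T1 : t <= e) by apply Rmin_l. assert (T2 : t <= r / 2) by apply Rmin_r.
  assert (Q := H (RtoC t)). rewrite Cmod_R, Rabs_pos_eq in Q by lra.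
  specialize (Q ltac:(lra)). assert (A := Rle_abs K). assert (A0 := Rabs_pos K). nra.
Qed.

(** The two lower coefficients vanish in turn, on division by [h]. *)
Lemma expansion_unique (d0 d1 : C) (u : C -> C) (M r : R) :
  0 < r -> ccont u 0 ->
  (forall h, 0 < Cmod h < r -> Cmod (d0 + d1 * h + h * h * u h) <= M * Cmod h ^ 3) ->
  u 0 = 0.
Proof.
  intros Hr Hu H.
  destruct (Hu 1) as [r1 [Hr1 Hb]]; [lra|].
  set (B := Cmod (u 0) + 1). assert (B0 : 0 < B) by (unfold B; assert (T := Cmod_ge_0 (u 0)); lra).
  assert (Bu : forall h, Cmod h < r1 -> Cmod (u h) <= B).
  { intros h Hh. assert (Q := Hb h). replace (h - 0)%C with h in Q by ring. specialize (Q Hh).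
    assert (T := Cmod_triangle_rev (u h) (u 0)). unfold B. lra. }
  assert (M0 : forall h, 0 < Cmod h < r -> M * Cmod h ^ 3 <= Rabs M * Cmod h ^ 3).
  { intros h Hh. apply Rmult_le_compat_r; [apply pow_le; lra|apply Rle_abs]. }
  set (s := Rmin (Rmin r r1) 1). assert (Hs : 0 < s) by (unfold s; repeat apply Rmin_glb_lt; lra).
  assert (S1 : s <= r) by (eapply Rle_trans; [apply Rmin_l|apply Rmin_l]).
  assert (S2 : s <= r1) by (eapply Rle_trans; [apply Rmin_l|apply Rmin_r]).
  assert (S3 : s <= 1) by apply Rmin_r.
  assert (AM := Rabs_pos M).
  assert (E0 : d0 = 0).
  { apply Cmod_zero_limit with (Rabs M + Cmod d1 + B) s; [exact Hs|]. intros h Hh.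
    assert (Q := H h ltac:(lra)). assert (Q2 := M0 h ltac:(lra)). assert (Q3 := Bu h ltac:(lra)).
    replace d0 with ((d0 + d1 * h + h * h * u h) - (d1 * h + h * h * u h))%C at 1 by ring.
    eapply Rle_trans; [apply Cmod_triangle_sub|].
    assert (Q4 := Cmod_triangle (d1 * h) (h * h * u h)). rewrite !Cmod_mult in Q4.
    set (t := Cmod h) in *. assert (t2 : t * t <= t) by nra.
    assert (t3 : t ^ 3 <= t) by (simpl; nra).
    assert (U0 := Cmod_ge_0 (u h)).
    assert (t * t * Cmod (u h) <= t * B) by (apply Rmult_le_compat; nra).
    assert (Rabs M * t ^ 3 <= Rabs M * t) by (apply Rmult_le_compat_l; lra). lra. }
  assert (E1 : d1 = 0).
  { apply Cmod_zero_limit with (Rabs M + B) s; [exact Hs|]. intros h Hh.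
    assert (Q := H h ltac:(lra)). assert (Q2 := M0 h ltac:(lra)). assert (Q3 := Bu h ltac:(lra)).
    rewrite E0 in Q. replace (0 + d1 * h + h * h * u h)%C with (h * (d1 + h * u h))%C in Q by ring.
    rewrite Cmod_mult in Q.
    replace d1 with ((d1 + h * u h) - h * u h)%C at 1 by ring.
    eapply Rle_trans; [apply Cmod_triangle_sub|]. rewrite Cmod_mult.
    set (t := Cmod h) in *. set (v := Cmod (d1 + h * u h)) in *.
    assert (v <= Rabs M * (t * t)).
    { apply Rmult_le_reg_l with t; [lra|]. simpl in *. lra. }
    assert (t2 : t * t <= t) by nra. nra. }
  apply Cmod_eq_0. apply eps_zero with (Rabs M + 1); [apply Cmod_ge_0|]. intros e He.
  destruct (Hu e He) as [r2 [Hr2 Hb2]].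
  set (t := Rmin (Rmin e (r2 / 2)) (r / 2)).
  assert (T0 : 0 < t) by (unfold t; repeat apply Rmin_glb_lt; lra).
  assert (T1 : t <= e) by (eapply Rle_trans; [apply Rmin_l|apply Rmin_l]).
  assert (T2 : t <= r2 / 2) by (eapply Rle_trans; [apply Rmin_l|apply Rmin_r]).
  assert (T3 : t <= r / 2) by apply Rmin_r.
  set (h := RtoC t). assert (Hh : Cmod h = t) by (unfold h; rewrite Cmod_R, Rabs_pos_eq; lra).
  assert (Q := H h ltac:(lra)). assert (Q2 := M0 h ltac:(lra)).
  rewrite E0, E1 in Q. replace (0 + 0 * h + h * h * u h)%C with (h * h * u h)%C in Q by ring.
  rewrite !Cmod_mult, Hh in Q. rewrite Hh in Q2.
  assert (Q3 := Hb2 h). replace (h - 0)%C with h in Q3 by ring. specialize (Q3 ltac:(lra)).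
  assert (V : Cmod (u h) <= Rabs M * t).
  { apply Rmult_le_reg_l with (t * t); [nra|]. simpl in *. lra. }
  assert (T := Cmod_triangle_rev (u 0) (u h)). rewrite Cmod_sub_sym in T. nra.
Qed.

Lemma laurent_exists (p : R) (f : C -> sphere) (J : C -> C) :
  0 < p < 1 -> (forall z, Cmod z < 1 -> cdiff J z) ->
  (forall z, Cmod z < 1 -> z <> RtoC p -> f z = Some (J z / (z - p))%C) ->
  exists a, is_laurent p f a.
Proof.
  intros Hp HJ Hf.
  assert (In : forall h, Cmod h < 1 - p -> Cmod (p + h) < 1).
  { intros h Hh. assert (T := Cmod_triangle p h). rewrite Cmod_R, Rabs_pos_eq in T by lra. lra. }
  destruct (taylor_series (fun h => J (p + h)%C) (1 - p)) as [b Hb]; [lra| |].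
  { intros h Hh. apply (cdiff_comp J (fun h => p + h)%C); [|now apply HJ, In].
    apply cdiff_plus; [apply cdiff_const|apply cdiff_id]. }
  exists (fun n => if Z_lt_dec n (-1) then RtoC 0 else b (Z.to_nat (n + 1))).
  split.
  - intros n Hn. destruct (Z_lt_dec n (-1)); [reflexivity|contradiction].
  - intros z Hz. set (h := (z - p)%C) in *.
    assert (Hh : h <> 0) by (apply Cmod_pos_neq; lra).
    assert (Ez : z = (p + h)%C) by (unfold h; ring).
    exists ((J z - b O) / h)%C. split.
    + assert (S := Hb h ltac:(lra)). rewrite <- Ez in S. rewrite is_pseries_psum in *.
      intros e He. destruct (S (e * Cmod h)) as [n0 Hn0]; [nra|].
      exists n0. intros n Hn. specialize (Hn0 (Datatypes.S n) ltac:(lia)).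
      set (c := fun n : nat => _).
      assert (Ec : forall k, c k = b (Datatypes.S k)).
      { intros k. unfold c. destruct (Z_lt_dec (Z.of_nat k) (-1)); [lia|].
        f_equal. lia. }
      assert (Sh : forall m, psum b h (Datatypes.S m) = (b O + h * psum c h m)%C).
      { induction m as [|m IH].
        - rewrite psum_S, !psum_0, Ec. simpl. ring.
        - rewrite psum_S, IH, psum_S, Ec. simpl. ring. }
      rewrite Sh in Hn0.
      replace (b O + h * psum c h n - J z)%C with (h * (psum c h n - (J z - b O) / h))%C in Hn0
        by (field; exact Hh).
      rewrite Cmod_mult in Hn0. apply Rmult_lt_reg_l with (Cmod h); lra.
    + rewrite Hf.
      * simpl. f_equal. fold h. field. exact Hh.
      * rewrite Ez. apply In. lra.
      * intros E. apply Hh. unfold h. rewrite E. ring.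
Qed.

(** Any expansion of [J = (z - p) f] to second order determines the
    coefficient; the third term need only be continuous at the pole. *)
Lemma laurent_coeff_1 (p : R) (f : C -> sphere) (J : C -> C) (c0 c1 : C) (Q : C -> C) (r : R) :
  0 < p < 1 -> (forall z, Cmod z < 1 -> cdiff J z) ->
  (forall z, Cmod z < 1 -> z <> RtoC p -> f z = Some (J z / (z - p))%C) ->
  0 < r -> ccont Q 0 -> (forall h, 0 < Cmod h < r -> J (p + h)%C = (c0 + c1 * h + h * h * Q h)%C) ->
  laurent_coeff p f 1 = Q 0.
Proof.
  intros Hp HJ Hf Hr HQ Exp. unfold laurent_coeff.
  assert (L := epsilon_spec (inhabits (fun _ : Z => RtoC 0)) (is_laurent p f) (laurent_exists p f J Hp HJ Hf)).
  set (a := epsilon _ _) in *. destruct L as [_ L].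
  assert (In : forall h, Cmod h < 1 - p -> Cmod (p + h) < 1).
  { intros h Hh. assert (T := Cmod_triangle p h). rewrite Cmod_R, Rabs_pos_eq in T by lra. lra. }
  set (s := fun h => (J (p + h) / h - a (-1)%Z / h)%C).
  destruct (pseries_first_order (fun n => a (Z.of_nat n)) (1 - p) s) as [M [d [Hd HM]]].
  - lra.
  - intros h Hh. assert (Hh0 : h <> 0) by (apply Cmod_pos_neq; lra).
    destruct (L (p + h)%C) as [t [S E]].
    + replace (p + h - p)%C with h by ring. exact Hh.
    + replace (p + h - p)%C with h in * by ring.
      rewrite Hf in E; [|apply In; lra|].
      * apply Some_C_inj in E. rename E into E'. replace (p + h - p)%C with h in E' by ring.
        replace (s h) with t; [exact S|]. unfold s. rewrite E'. ring.
      * intros E'. apply Hh0. replace h with (p + h - p)%C by ring. rewrite E'. ring.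
  - assert (Z : (Q 0 - a 1%Z)%C = 0).
    { apply (expansion_unique (c0 - a (-1)%Z) (c1 - a 0%Z) (fun h => Q h - a 1%Z)%C M (Rmin r d)).
      - now apply Rmin_glb_lt.
      - apply ccont_minus; [exact HQ|apply ccont_const].
      - intros h Hh. assert (R1 := Rmin_l r d). assert (R2 := Rmin_r r d).
        assert (Hh0 : h <> 0) by (apply Cmod_pos_neq; lra).
        assert (K := HM h ltac:(lra)). simpl in K. unfold s in K. rewrite Exp in K by lra.
        replace (c0 - a (-1)%Z + (c1 - a 0%Z) * h + h * h * (Q h - a 1%Z))%C
          with (h * ((c0 + c1 * h + h * h * Q h) / h - a (-1)%Z / h - (a 0%Z + a 1%Z * h)))%C
          by (field; exact Hh0).
        rewrite Cmod_mult. simpl. assert (H0 := Cmod_ge_0 h). nra. }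
    replace (Q 0) with (Q 0 - a 1%Z + a 1%Z)%C by ring. rewrite Z. ring.
Qed.

(** * From concave functions to concave numerators *)

(** By injectivity the pole at [p] is the only one. *)
Lemma Co_numerator (p : R) (f : C -> sphere) :
  0 < p < 1 -> Co p f ->
  exists J : C -> C, (forall z, Cmod z < 1 -> cdiff J z) /\ J p <> 0 /\ f p = None /\
    forall z, Cmod z < 1 -> z <> RtoC p -> f z = Some (J z / (z - p))%C.
Proof.
  intros Hp [Mer [Pole [_ [_ [Inj _]]]]].
  destruct Pole as [_ [Np [g [r [Hr [Gp Hg]]]]]].
  assert (Up : unit_disc p) by (unfold unit_disc; rewrite Cmod_R, Rabs_pos_eq; lra).
  set (J := fun z => if Ceq_dec z p then g p else ((z - p) * finite_part f z)%C).
  assert (Jg : forall z, Cmod (z - p) < r -> g z = J z).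
  { intros z Hz. unfold J. destruct (Ceq_dec z p) as [->|Hn]; [reflexivity|].
    destruct (Hg z Hz) as [_ E]. unfold finite_part. rewrite (E Hn). simpl.
    field. now apply Csub_neq_0. }
  assert (Hol : forall z, Cmod z < 1 -> z <> RtoC p ->
            exists w, f z = Some w /\ cdiff (finite_part f) z).
  { intros z Hz Hn. destruct (Mer z Hz) as [[h [r' [Hr' Hh]]]|[m [_ [Nz _]]]].
    - exists (h z). split.
      + apply Hh. now rewrite Cmod_sub_diag.
      + apply cdiff_ext_near with h r'; [exact Hr'| |].
        * intros y Hy. unfold finite_part. now rewrite (proj2 (Hh y Hy)).
        * apply cdiff_iff, Hh. now rewrite Cmod_sub_diag.
    - exfalso. apply Hn. apply Inj; auto. now rewrite Nz. }
  exists J. split; [|split; [|split; [exact Np|]]].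
  - intros z Hz. destruct (classic (z = p)) as [->|Hn].
    + apply cdiff_ext_near with g r; [exact Hr|exact Jg|].
      apply cdiff_iff, Hg. now rewrite Cmod_sub_diag.
    + apply cdiff_ext_near with (fun z => (z - p) * finite_part f z)%C (Cmod (z - p)).
      * now apply Cmod_diff_neq.
      * intros y Hy. unfold J. destruct (Ceq_dec y p) as [->|_]; [|reflexivity].
        rewrite Cmod_sub_sym in Hy. lra.
      * apply cdiff_mult; [apply cdiff_minus; [apply cdiff_id|apply cdiff_const]|].
        now destruct (Hol z Hz Hn) as [_ [_ Hd]].
  - unfold J. destruct (Ceq_dec p p); [exact Gp|congruence].
  - intros z Hz Hn. destruct (Hol z Hz Hn) as [w [E _]].
    unfold J. destruct (Ceq_dec z p); [contradiction|]. unfold finite_part. rewrite E.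
    f_equal. field. now apply Csub_neq_0.
Qed.

(** The automorphism of the disc moving the pole from [0] to [p]; its inverse
    is [moebius (- p)]. *)
Definition moebius (p : R) (z : C) : C := ((z + p) / (1 + p * z))%C.

Lemma moebius_den (p : R) (z : C) : -1 < p < 1 -> Cmod z < 1 -> (1 + p * z)%C <> 0.
Proof.
  intros Hp Hz. replace (1 + p * z)%C with (1 - - (p * z))%C by ring.
  apply Csub_neq_0. intros E. apply (f_equal Cmod) in E.
  rewrite Cmod_1, Cmod_opp, Cmod_mult, Cmod_R in E.
  assert (A : Rabs p < 1) by (apply Rabs_def1; lra).
  assert (A0 := Rabs_pos p). assert (Z0 := Cmod_ge_0 z). nra.
Qed.

Lemma moebius_disc (p : R) (z : C) : -1 < p < 1 -> Cmod z < 1 -> Cmod (moebius p z) < 1.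
Proof.
  intros Hp Hz. unfold moebius. assert (D := moebius_den p z Hp Hz).
  assert (D0 := proj1 (Cmod_gt_0 _) D). rewrite Cmod_div by exact D.
  apply Rmult_lt_reg_r with (Cmod (1 + p * z)); [exact D0|].
  unfold Rdiv. rewrite Rmult_assoc, Rinv_l, Rmult_1_l, Rmult_1_r by lra.
  assert (Z2 : Cmod z ^ 2 < 1) by (assert (T := Cmod_ge_0 z); simpl; nra).
  assert (K : Cmod (z + p) ^ 2 < Cmod (1 + p * z) ^ 2).
  { rewrite Cmod_sqr in *. rewrite Cmod_sqr. destruct z as [x y]. unfold Re, Im in *. simpl in *.
    assert (0 < (1 - p * p) * (1 - (x * x + y * y))) by (apply Rmult_lt_0_compat; nra). lra. }
  apply Rnot_le_lt. intros Hle. simpl in K. nra.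
Qed.

Lemma moebius_inv (p : R) (z : C) : -1 < p < 1 -> Cmod z < 1 -> moebius p (moebius (- p) z) = z.
Proof.
  intros Hp Hz. unfold moebius. assert (D := moebius_den (- p) z ltac:(lra) Hz).
  rewrite RtoC_opp in *.
  assert (E : (1 - p * p)%C <> 0).
  { rewrite <- RtoC_mult, <- RtoC_minus. apply Cmod_pos_neq. rewrite Cmod_R, Rabs_pos_eq; nra. }
  field. split; [exact D|].
  replace (1 + - p * z + p * (z + - p))%C with (1 - p * p)%C by ring. exact E.
Qed.

Lemma cderiv_moebius (p : R) (z : C) :
  -1 < p < 1 -> Cmod z < 1 -> cderiv (moebius p) z ((1 - p * p) / ((1 + p * z) * (1 + p * z)))%C.
Proof.
  intros Hp Hz. assert (D := moebius_den p z Hp Hz).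
  eapply cderiv_eq; [|apply cderiv_div; [| |exact D]].
  2:{ apply cderiv_plus; [apply cderiv_id|apply cderiv_const]. }
  2:{ apply cderiv_plus; [apply cderiv_const|apply cderiv_mult; [apply cderiv_const|apply cderiv_id]]. }
  cbv beta. field. exact D.
Qed.

(** [z F z] for [F z = f (moebius p z)] and [J = (z - p) f]. *)
Definition shifted_numerator (p : R) (J : C -> C) (z : C) : C :=
  ((1 + p * z) / (1 - p * p) * J (moebius p z))%C.

Lemma one_minus_sqr_neq (p : R) : 0 < p < 1 -> (1 - p * p)%C <> 0.
Proof.
  intros Hp. rewrite <- RtoC_mult, <- RtoC_minus.
  apply Cmod_pos_neq. rewrite Cmod_R, Rabs_pos_eq; nra.
Qed.

Lemma moebius_sub (p : R) (z : C) :
  0 < p < 1 -> Cmod z < 1 -> (moebius p z - p = z * (1 - p * p) / (1 + p * z))%C.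
Proof. intros Hp Hz. unfold moebius. field. apply moebius_den; [lra|exact Hz]. Qed.

Lemma shifted_value (p : R) (f : C -> sphere) (J : C -> C) (z : C) :
  0 < p < 1 -> (forall z, Cmod z < 1 -> z <> RtoC p -> f z = Some (J z / (z - p))%C) ->
  Cmod z < 1 -> z <> 0 -> f (moebius p z) = Some (shifted_numerator p J z / z)%C.
Proof.
  intros Hp Hf Hz Hz0. assert (D := moebius_den p z ltac:(lra) Hz).
  assert (E := one_minus_sqr_neq p Hp). assert (S := moebius_sub p z Hp Hz).
  rewrite Hf.
  - f_equal. rewrite S. unfold shifted_numerator. field. auto.
  - apply moebius_disc; [lra|exact Hz].
  - intros E'. rewrite E' in S. apply Hz0.
    replace z with ((z * (1 - p * p) / (1 + p * z)) * ((1 + p * z) / (1 - p * p)))%C by (field; auto).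
    rewrite <- S. ring.
Qed.

Lemma shifted_numerator_concave (p : R) (f : C -> sphere) (J : C -> C) :
  0 < p < 1 -> Co p f -> (forall z, Cmod z < 1 -> cdiff J z) -> J p <> 0 -> f p = None ->
  (forall z, Cmod z < 1 -> z <> RtoC p -> f z = Some (J z / (z - p))%C) ->
  concave_numerator (shifted_numerator p J).
Proof.
  intros Hp Hco HJ Jp Np Hf. destruct Hco as [_ [_ [_ [_ [Inj Conv]]]]].
  assert (E := one_minus_sqr_neq p Hp). set (N := shifted_numerator p J).
  assert (Hp' : -1 < p < 1) by lra.
  assert (N0 : N 0 <> 0).
  { unfold N, shifted_numerator, moebius.
    replace ((0 + p) / (1 + p * 0))%C with (RtoC p) by field.
    intros Z. apply Jp.
    replace (J p) with ((1 - p * p) * ((1 + p * 0) / (1 - p * p) * J p))%C by (field; exact E).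
    rewrite Z. ring. }
  assert (Val : forall z, Cmod z < 1 -> z <> 0 -> f (moebius p z) = Some (N z / z)%C)
    by (intros; now apply shifted_value).
  assert (Back : forall z, Cmod z < 1 -> moebius (- p) (moebius p z) = z).
  { intros z Hz. rewrite <- (Ropp_involutive p) at 2. apply moebius_inv; [lra|exact Hz]. }
  assert (Om : forall k, omitted N k <-> ~ image_of_disc f (Some k)).
  { intros k. split.
    - intros Ho [z [Hz Ez]].
      assert (Hn : z <> RtoC p) by (intros ->; rewrite Np in Ez; discriminate).
      set (w := moebius (- p) z).
      assert (Hw : Cmod w < 1) by (apply moebius_disc; [lra|exact Hz]).
      assert (Ew : moebius p w = z) by (apply moebius_inv; [lra|exact Hz]).
      assert (W0 : w <> 0).
      { intros W. apply Hn. rewrite <- Ew, W. unfold moebius. field. }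
      apply (Ho w Hw). assert (V := Val w Hw W0). rewrite Ew, Ez in V. apply Some_C_inj in V. rewrite V.
      field. exact W0.
    - intros Hi z Hz Ez. apply Hi.
      assert (Z0 : z <> 0).
      { intros ->. apply N0. rewrite Ez. ring. }
      exists (moebius p z). split; [now apply moebius_disc|].
      rewrite Val, Ez by assumption. f_equal. field. exact Z0. }
  constructor.
  - intros z Hz. assert (D := moebius_den p z Hp' Hz). apply cdiff_mult.
    + apply cdiff_div; [|apply cdiff_const|exact E].
      apply cdiff_plus; [apply cdiff_const|apply cdiff_mult; [apply cdiff_const|apply cdiff_id]].
    + apply (cdiff_comp J (moebius p)); [eexists; now apply cderiv_moebius|].
      apply HJ. now apply moebius_disc.
  - exact N0.
  - intros z w Hz Hw Eq.
    destruct (classic (z = 0)) as [Z0|Z0], (classic (w = 0)) as [W0|W0].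
    + congruence.
    + exfalso. rewrite Z0 in Eq. apply N0.
      replace (N 0) with (N 0 * w / w)%C by (field; exact W0). rewrite Eq. unfold Cdiv. ring.
    + exfalso. rewrite W0 in Eq. apply N0.
      replace (N 0) with (N 0 * z / z)%C by (field; exact Z0). rewrite <- Eq. unfold Cdiv. ring.
    + assert (T : moebius p z = moebius p w).
      { apply Inj; [now apply moebius_disc|now apply moebius_disc|].
        rewrite !Val by assumption. f_equal.
        replace (N z / z)%C with (N z * w / (z * w))%C by (field; auto). rewrite Eq. field. auto. }
      rewrite <- (Back z Hz), T. now apply Back.
  - destruct Conv as [K [HK HE]].
    assert (OK : forall k, omitted N k <-> K k).
    { intros k. rewrite Om, HE. split; [|intros; now exists k].
      intros [u [Hu Eu]]. apply Some_C_inj in Eu. now rewrite Eu. }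
    intros u v t Hu Hv Ht. apply OK. apply HK; [now apply OK|now apply OK|exact Ht].
Qed.

(** * The functions with constant parameter *)

Lemma Csqrt_exists (w : C) : exists s : C, (s * s = w)%C.
Proof.
  set (m := Cmod w). destruct w as [x y].
  assert (M2 : m * m = x * x + y * y).
  { assert (T := Cmod_sqr (x, y)). fold m in T. unfold Re, Im in T. simpl in T. lra. }
  assert (M0 : 0 <= m) by apply Cmod_ge_0.
  assert (Hx1 : 0 <= (m + x) / 2) by nra. assert (Hx2 : 0 <= (m - x) / 2) by nra.
  set (u := sqrt ((m + x) / 2)). set (v := sqrt ((m - x) / 2)).
  assert (U2 : u * u = (m + x) / 2) by now apply sqrt_sqrt.
  assert (V2 : v * v = (m - x) / 2) by now apply sqrt_sqrt.
  assert (U0 : 0 <= u) by apply sqrt_pos. assert (V0 : 0 <= v) by apply sqrt_pos.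
  assert (UV : (2 * (u * v)) * (2 * (u * v)) = y * y).
  { replace ((2 * (u * v)) * (2 * (u * v))) with (4 * (u * u) * (v * v)) by ring. rewrite U2, V2.
    replace (4 * ((m + x) / 2) * ((m - x) / 2)) with (m * m - x * x) by field. lra. }
  assert (UV0 : 0 <= u * v) by now apply Rmult_le_pos.
  destruct (Rle_dec 0 y) as [Hy|Hy].
  - exists (u, v). unfold Cmult. simpl. f_equal; [lra|]. nra.
  - exists (u, - v). unfold Cmult. simpl. f_equal; [lra|]. nra.
Qed.

(** Half of the Schur-Cohn criterion. In terms of the roots [z1], [z2] the
    inequality is [r1^2 r2^2 - 1 >= (r1^2 - 1) r2 + (r2^2 - 1) r1], with
    [ri = |zi| >= 1], and [|c| = |a|] means [r1 r2 = 1]. *)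
Lemma no_root_in_disc (a b c : C) :
  (forall z, Cmod z < 1 -> (a * (z * z) - b * z + c)%C <> 0) ->
  Cmod (Cconj c * b - a * Cconj b) <= Cmod c ^ 2 - Cmod a ^ 2 /\
  (a <> 0 -> Cmod c = Cmod a -> exists z, Cmod z = 1 /\ (a * (z * z) - b * z + c)%C = 0).
Proof.
  intros H. destruct (classic (a = 0)) as [Ea|Na].
  - split; [|contradiction]. rewrite Ea.
    replace (Cconj c * b - 0 * Cconj b)%C with (Cconj c * b)%C by ring.
    rewrite Cmod_mult, Cmod_conj, Cmod_0.
    assert (C0 := Cmod_ge_0 c).
    destruct (classic (b = 0)) as [Eb|Nb]; [rewrite Eb, Cmod_0; simpl; nra|].
    assert (B0 := proj1 (Cmod_gt_0 b) Nb).
    assert (Cmod b <= Cmod c); [|simpl; nra].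
    apply Rnot_lt_le. intros Hlt. apply (H (c / b)%C).
    + rewrite Cmod_div by exact Nb. apply Rmult_lt_reg_r with (Cmod b); [exact B0|].
      unfold Rdiv. rewrite Rmult_assoc, Rinv_l by lra. lra.
    + rewrite Ea. field. exact Nb.
  - destruct (Csqrt_exists (b * b - 4 * a * c)) as [s Hs].
    assert (N22 : RtoC 2 <> RtoC 0) by (apply RtoC_pos_neq; lra).
    set (z1 := ((b + s) / (2 * a))%C). set (z2 := ((b - s) / (2 * a))%C).
    assert (Eb : b = (a * (z1 + z2))%C) by (unfold z1, z2; field; auto).
    assert (Ec : c = (a * (z1 * z2))%C).
    { replace (a * (z1 * z2))%C with ((b * b - s * s) / (4 * a))%C by (unfold z1, z2; field; auto).
      rewrite Hs. field. exact Na. }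
    assert (Root : forall z, (a * (z * z) - b * z + c)%C = (a * ((z - z1) * (z - z2)))%C).
    { intros z. rewrite Eb, Ec. ring. }
    assert (R1 : 1 <= Cmod z1).
    { apply Rnot_lt_le. intros Hl. apply (H z1 Hl). rewrite Root. ring. }
    assert (R2 : 1 <= Cmod z2).
    { apply Rnot_lt_le. intros Hl. apply (H z2 Hl). rewrite Root. ring. }
    split.
    + assert (E : (Cconj c * b - a * Cconj b)%C
                  = (RtoC (Cmod a ^ 2) * (RtoC (Cmod z1 ^ 2 - 1) * Cconj z2 + RtoC (Cmod z2 ^ 2 - 1) * Cconj z1))%C).
      { rewrite Eb, Ec, !RtoC_minus, !Cmod2_conj, !Cmult_conj, Cplus_conj. ring. }
      rewrite E, Ec, Cmod_mult, Cmod_R, Rabs_pos_eq by (apply pow_le, Cmod_ge_0).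
      rewrite !Cmod_mult.
      assert (T := Cmod_triangle (RtoC (Cmod z1 ^ 2 - 1) * Cconj z2) (RtoC (Cmod z2 ^ 2 - 1) * Cconj z1)).
      rewrite !Cmod_mult, !Cmod_conj, !Cmod_R, !Rabs_pos_eq in T by (simpl; nra).
      set (r1 := Cmod z1) in *. set (r2 := Cmod z2) in *. set (q := Cmod a).
      assert (Q : 0 <= q ^ 2) by (apply pow_le, Cmod_ge_0).
      replace ((q * (r1 * r2)) ^ 2 - q ^ 2) with (q ^ 2 * ((r1 * r2) ^ 2 - 1)) by ring.
      apply Rmult_le_compat_l; [exact Q|]. eapply Rle_trans; [exact T|].
      replace ((r1 ^ 2 - 1) * r2 + (r2 ^ 2 - 1) * r1) with ((r1 + r2) * (r1 * r2 - 1)) by ring.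
      replace ((r1 * r2) ^ 2 - 1) with ((r1 * r2 + 1) * (r1 * r2 - 1)) by ring.
      apply Rmult_le_compat_r; nra.
    + intros _ Em. exists z1. split; [|rewrite Root; ring].
      assert (A0 := proj1 (Cmod_gt_0 a) Na). rewrite Ec, !Cmod_mult in Em.
      assert (P : Cmod z1 * Cmod z2 = 1).
      { apply Rmult_eq_reg_l with (Cmod a); lra. }
      nra.
Qed.

(** [1 - k z + z^2] with [k = p + 1/p] is the denominator [(1 - z/p) (1 - p z)];
    for [z] on the unit circle and [v = - z / (k - 2 Re z)] the condition
    [k |v| <= 1 - 2 Re v] is an equality. It describes a filled ellipse, which
    [v |-> conj v - c v] maps to the complement of the image, up to an affine
    map. *)
Lemma ellipse_omitted (k : R) (c v z : C) :
  2 < k -> Cmod c <= 1 -> k * Cmod v <= 1 - 2 * Re v -> Cmod z < 1 ->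
  ((Cconj v - c * v) * (1 - k * z + z * z) <> 1 - c * (z * z))%C.
Proof.
  intros Hk Hc Hv Hz E.
  set (q := (1 - k * z + z * z)%C) in *.
  assert (E2 : (Cconj v * q - 1)%C = (c * (v * q - z * z))%C).
  { replace (Cconj v * q - 1)%C with ((Cconj v - c * v) * q + c * (v * q) - 1)%C by ring. rewrite E. ring. }
  assert (M : Cmod (Cconj v * q - 1) <= Cmod (v * q - z * z)).
  { rewrite E2, Cmod_mult. assert (T := Cmod_ge_0 (v * q - z * z)). nra. }
  assert (Z0 := Cmod_ge_0 z). assert (V0 := Cmod_ge_0 v).
  assert (D : Cmod (Cconj v * q - 1) ^ 2 - Cmod (v * q - z * z) ^ 2
          = (1 - Cmod z ^ 2) * ((1 + Cmod z ^ 2) * (1 - 2 * Re v) + 2 * k * Re (Cconj v * z))).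
  { rewrite !Cmod_sqr. unfold q. destruct v as [v1 v2], z as [x y]. unfold Re, Im. simpl. ring. }
  assert (M2 : Cmod (Cconj v * q - 1) ^ 2 <= Cmod (v * q - z * z) ^ 2)
    by (apply pow_incr; split; [apply Cmod_ge_0|exact M]).
  assert (R1 : - (Cmod v * Cmod z) <= Re (Cconj v * z)).
  { assert (T := re_le_Cmod (Cconj v * z)). rewrite Cmod_mult, Cmod_conj in T.
    apply Rabs_le_between in T. lra. }
  set (r := Cmod z) in *. set (t := 1 - 2 * Re v) in *.
  assert (T0 : 0 < t).
  { destruct (Rle_lt_dec t 0) as [Ht|Ht]; [|exact Ht]. exfalso.
    assert (V : Cmod v = 0) by (apply Rle_antisym; [apply Rnot_lt_le; intros Hl; nra|exact V0]). apply Cmod_eq_0 in V. unfold t in Ht. rewrite V in Ht.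
    unfold Re in Ht. simpl in Ht. lra. }
  assert (S1 : 0 < 1 - r ^ 2) by (simpl; nra).
  assert (S2 : 0 < (1 + r ^ 2) * t + 2 * k * Re (Cconj v * z)).
  { assert (A1 : 2 * k * - (Cmod v * r) <= 2 * k * Re (Cconj v * z)) by (apply Rmult_le_compat_l; lra).
    assert (A2 : 2 * r * (k * Cmod v) <= 2 * r * t) by (apply Rmult_le_compat_l; lra).
    assert (A3 : 0 < (1 - r) * (1 - r) * t) by (apply Rmult_lt_0_compat; [nra|exact T0]).
    replace (r ^ 2) with (r * r) by ring. lra. }
  assert (S3 := Rmult_lt_0_compat _ _ S1 S2). lra.
Qed.

(** For [Cmod c < 1] the linear map [v |-> conj v - c v] is inverted, and the
    Schur-Cohn inequality becomes the equation of the ellipse. *)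
Lemma omitted_in_ellipse (k : R) (c w : C) :
  2 < k -> Cmod c <= 1 ->
  (forall z, Cmod z < 1 -> (w * (1 - k * z + z * z) <> 1 - c * (z * z))%C) ->
  exists v, k * Cmod v <= 1 - 2 * Re v /\ w = (Cconj v - c * v)%C.
Proof.
  intros Hk Hc H.
  destruct (no_root_in_disc (c + w) (k * w) (w - 1)) as [Ineq Circ].
  { intros z Hz E. apply (H z Hz).
    replace (w * (1 - k * z + z * z))%C
      with ((c + w) * (z * z) - k * w * z + (w - 1) + (1 - c * (z * z)))%C by ring.
    rewrite E. ring. }
  set (q := (w + c * Cconj w)%C).
  assert (E1 : (Cconj (w - 1) * (k * w) - (c + w) * Cconj (k * w))%C = (- (k * q))%C).
  { unfold q. destruct c as [c1 c2], w as [w1 w2]. unfold Cconj, Cmult, Cminus, Cplus, Copp, RtoC. simpl.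
    f_equal; ring. }
  assert (E2 : Cmod (w - 1) ^ 2 - Cmod (c + w) ^ 2 = 1 - Cmod c ^ 2 - 2 * Re q).
  { rewrite !Cmod_sqr. unfold q. destruct c as [c1 c2], w as [w1 w2]. unfold Re, Im. simpl. ring. }
  rewrite E1, E2, Cmod_opp, Cmod_mult, Cmod_R, Rabs_pos_eq in Ineq by lra.
  destruct Hc as [Hc|Hc].
  - assert (C0 := Cmod_ge_0 c). set (d := 1 - Cmod c ^ 2) in *.
    assert (D0 : 0 < d) by (unfold d; simpl; nra).
    assert (Dn : RtoC d <> RtoC 0) by (apply RtoC_pos_neq; lra).
    exists (Cconj q / d)%C. split.
    + rewrite Cmod_div, Cmod_conj, Cmod_R, Rabs_pos_eq by (auto; lra).
      assert (ER : Re (Cconj q / d) = Re q / d).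
      { destruct q as [q1 q2]. unfold Re, Cdiv, Cconj, Cmult, Cinv, RtoC. simpl. field. lra. }
      rewrite ER. apply Rmult_le_reg_r with d; [exact D0|].
      replace (k * (Cmod q / d) * d) with (k * Cmod q) by (field; lra).
      replace ((1 - 2 * (Re q / d)) * d) with (d - 2 * Re q) by (field; lra). exact Ineq.
    + assert (EC : Cconj (Cconj q / d) = (q / d)%C).
      { destruct q as [q1 q2]. unfold Cdiv, Cconj, Cmult, Cinv, RtoC. simpl. f_equal; field; lra. }
      rewrite EC.
      assert (Ed : RtoC d = (1 - c * Cconj c)%C) by (unfold d; now rewrite RtoC_minus, Cmod2_conj).
      assert (EQ : (q - c * Cconj q)%C = (w * d)%C).
      { rewrite Ed. unfold q. destruct c as [c1 c2], w as [w1 w2].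
        unfold Cconj, Cmult, Cminus, Cplus, Copp, RtoC. simpl. f_equal; ring. }
      replace (q / d - c * (Cconj q / d))%C with ((q - c * Cconj q) / d)%C by (field; exact Dn).
      rewrite EQ. field. exact Dn.
  - (* the ellipse degenerates to a segment, covered twice by its boundary *)
    rewrite Hc in Ineq. assert (Q0 := Cmod_ge_0 q).
    assert (T := re_le_Cmod q). apply Rabs_le_between in T.
    assert (Qz : Cmod q = 0) by nra.
    assert (Qe := Cmod_eq_0 _ Qz).
    assert (Mod : Cmod (w - 1) = Cmod (c + w)).
    { rewrite Hc, Qe in E2. unfold Re in E2. simpl in E2.
      assert (A := Cmod_ge_0 (w - 1)). assert (B := Cmod_ge_0 (c + w)). nra. }
    assert (Na : (c + w)%C <> 0).
    { intros Ea. rewrite Ea, Cmod_0 in Mod. apply Cmod_eq_0 in Mod.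
      apply (H 0); [rewrite Cmod_0; lra|].
      replace w with (w - 1 + 1)%C by ring. rewrite Mod. ring. }
    destruct (Circ Na Mod) as [z [Hz Ez]].
    assert (Z2 : (z * Cconj z)%C = 1) by (rewrite <- Cmod2_conj, Hz; f_equal; ring).
    assert (X : Rabs (Re z) <= 1) by (rewrite <- Hz; apply re_le_Cmod). apply Rabs_le_between in X.
    set (d := 2 * Re z - k). assert (D0 : d < 0) by (unfold d; lra).
    assert (Dn : RtoC d <> RtoC 0) by (apply Cmod_pos_neq; rewrite Cmod_R, Rabs_left; lra).
    assert (Dz : RtoC d = (z + Cconj z - k)%C).
    { unfold d. destruct z as [x y]. unfold Re, Cconj, Cminus, Cplus, Copp, RtoC. simpl. f_equal; ring. }
    assert (Wd : (w * d)%C = (Cconj z - c * z)%C).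
    { rewrite Dz.
      replace (w * (z + Cconj z - k))%C
        with (Cconj z * ((c + w) * (z * z) - k * w * z + (w - 1)) + Cconj z
              - c * z * (z * Cconj z) + w * z * (1 - z * Cconj z) - k * w * (1 - z * Cconj z))%C by ring.
      rewrite Ez, Z2. ring. }
    exists (z / d)%C. split.
    + rewrite Cmod_div, Hz, Cmod_R, Rabs_left by (auto; lra).
      assert (ER : Re (z / d) = Re z / d).
      { destruct z as [x y]. unfold Re, Cdiv, Cmult, Cinv, RtoC. simpl. field. lra. }
      rewrite ER. right. unfold d. field. unfold d in D0. lra.
    + assert (EC : Cconj (z / d) = (Cconj z / d)%C).
      { destruct z as [x y]. unfold Cdiv, Cconj, Cmult, Cinv, RtoC. simpl. f_equal; field; lra. }
      rewrite EC. replace (Cconj z / d - c * (z / d))%C with ((Cconj z - c * z) / d)%C by (field; exact Dn).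
      rewrite <- Wd. field. exact Dn.
Qed.

Lemma ellipse_convex (k t : R) (u v : C) :
  0 <= k -> 0 <= t <= 1 -> k * Cmod u <= 1 - 2 * Re u -> k * Cmod v <= 1 - 2 * Re v ->
  k * Cmod (t * u + (1 - t) * v) <= 1 - 2 * Re (t * u + (1 - t) * v).
Proof.
  intros Hk Ht Hu Hv.
  assert (T := Cmod_triangle (t * u) ((1 - t) * v)).
  rewrite <- RtoC_minus, !Cmod_mult, !Cmod_R, !Rabs_pos_eq in T by lra.
  assert (E : Re (t * u + (1 - t) * v) = t * Re u + (1 - t) * Re v).
  { destruct u as [u1 u2], v as [v1 v2]. unfold Re. simpl. ring. }
  rewrite <- RtoC_minus in *. rewrite E.
  assert (A1 := Rmult_le_compat_l k _ _ Hk T).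
  assert (A2 := Rmult_le_compat_l t _ _ (proj1 Ht) Hu).
  assert (A3 := Rmult_le_compat_l (1 - t) _ _ ltac:(lra) Hv). lra.
Qed.

(** The cofactor of [z - w] in the difference of the values at [z] and [w],
    cleared of denominators: it governs injectivity. *)
Lemma two_point_nonzero (k : R) (c z w : C) :
  2 < k -> Cmod c <= 1 -> Cmod z < 1 -> Cmod w < 1 ->
  (k - (z + w) + c * (k * (z * w) - (z + w)))%C <> 0.
Proof.
  intros Hk Hc Hz Hw E.
  set (a := (k - (z + w))%C) in *. set (b := (k * (z * w) - (z + w))%C) in *.
  assert (M : Cmod a <= Cmod b).
  { assert (Ea : a = (- (c * b))%C) by (replace a with (a + c * b - c * b)%C by ring; rewrite E; ring).
    rewrite Ea, Cmod_opp, Cmod_mult. assert (T := Cmod_ge_0 b). nra. }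
  assert (Z0 := Cmod_ge_0 z). assert (W0 := Cmod_ge_0 w).
  assert (D : Cmod a ^ 2 - Cmod b ^ 2 = k * (k * (1 - Cmod z ^ 2 * Cmod w ^ 2)
              - 2 * (Re z * (1 - Cmod w ^ 2) + Re w * (1 - Cmod z ^ 2)))).
  { unfold a, b. rewrite !Cmod_sqr. destruct z as [x y], w as [u v]. unfold Re, Im. simpl. ring. }
  assert (X1 := re_le_Cmod z). apply Rabs_le_between in X1.
  assert (X2 := re_le_Cmod w). apply Rabs_le_between in X2.
  set (r := Cmod z) in *. set (s := Cmod w) in *.
  assert (B1 : Re z * (1 - s ^ 2) <= r * (1 - s ^ 2)) by (apply Rmult_le_compat_r; [simpl; nra|lra]).
  assert (B2 : Re w * (1 - r ^ 2) <= s * (1 - r ^ 2)) by (apply Rmult_le_compat_r; [simpl; nra|lra]).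
  assert (B3 : r * (1 - s ^ 2) + s * (1 - r ^ 2) <= 1 - r ^ 2 * s ^ 2).
  { replace (r * (1 - s ^ 2) + s * (1 - r ^ 2)) with ((r + s) * (1 - r * s)) by ring.
    replace (1 - r ^ 2 * s ^ 2) with ((1 + r * s) * (1 - r * s)) by ring.
    apply Rmult_le_compat_r; nra. }
  assert (B4 : 0 < 1 - r ^ 2 * s ^ 2).
  { replace (1 - r ^ 2 * s ^ 2) with ((1 + r * s) * (1 - r * s)) by ring. apply Rmult_lt_0_compat; nra. }
  assert (B5 : 0 < k * (1 - r ^ 2 * s ^ 2) - 2 * (Re z * (1 - s ^ 2) + Re w * (1 - r ^ 2))) by nra.
  assert (B6 : 0 < Cmod a ^ 2 - Cmod b ^ 2) by (rewrite D; apply Rmult_lt_0_compat; lra).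
  assert (Cmod a ^ 2 <= Cmod b ^ 2) by (apply pow_incr; split; [apply Cmod_ge_0|exact M]). lra.
Qed.

Definition ellipse_map (p : R) (c z : C) : sphere :=
  sphere_div (z - p / (1 + p ^ 2) * (1 + c) * z ^ 2)%C ((1 - z / p) * (1 - z * p))%C.

Lemma pole_factor_neq (p : R) (z : C) : 0 < p < 1 -> Cmod z < 1 -> (1 - z * p)%C <> 0.
Proof.
  intros Hp Hz. replace (1 - z * p)%C with (1 + RtoC (- p) * z)%C by (rewrite RtoC_opp; ring).
  apply moebius_den; [lra|exact Hz].
Qed.

Lemma ellipse_map_finite (p : R) (c z : C) :
  0 < p < 1 -> Cmod z < 1 -> z <> RtoC p ->
  ((1 - z / p) * (1 - z * p))%C <> 0 /\
  ellipse_map p c z = Some ((z - p / (1 + p ^ 2) * (1 + c) * z ^ 2) / ((1 - z / p) * (1 - z * p)))%C.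
Proof.
  intros Hp Hz Hn.
  assert (Pn : RtoC p <> RtoC 0) by (apply RtoC_pos_neq; lra).
  assert (D : ((1 - z / p) * (1 - z * p))%C <> 0).
  { apply Cmult_neq_0; [|now apply pole_factor_neq].
    intros E. apply Hn. replace z with (p - p * (1 - z / p))%C by (field; exact Pn). rewrite E. ring. }
  split; [exact D|]. unfold ellipse_map, sphere_div.
  destruct (Ceq_dec _ 0); [contradiction|reflexivity].
Qed.

Lemma ellipse_map_pole (p : R) (c : C) : 0 < p < 1 -> ellipse_map p c p = None.
Proof.
  intros Hp. unfold ellipse_map, sphere_div.
  assert (Pn : RtoC p <> RtoC 0) by (apply RtoC_pos_neq; lra).
  destruct (Ceq_dec _ 0) as [_|n]; [reflexivity|]. exfalso. apply n. field. exact Pn.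
Qed.

Theorem ellipse_map_Co (p : R) (c : C) : 0 < p < 1 -> Cmod c <= 1 -> Co p (ellipse_map p c).
Proof.
  intros Hp Hc. set (f := ellipse_map p c).
  assert (Pn : RtoC p <> RtoC 0) by (apply RtoC_pos_neq; lra).
  assert (P2 : (1 + p ^ 2)%C <> 0).
  { rewrite <- RtoC_pow, <- RtoC_plus. apply Cmod_pos_neq. rewrite Cmod_R, Rabs_pos_eq; simpl; nra. }
  set (num := fun z => (z - p / (1 + p ^ 2) * (1 + c) * z ^ 2)%C).
  set (den := fun z => ((1 - z / p) * (1 - z * p))%C).
  set (k := p + / p).
  assert (Hk : 2 < k).
  { unfold k. assert (0 < / p) by (apply Rinv_0_lt_compat; lra).
    assert (p * / p = 1) by (apply Rinv_r; lra). nra. }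
  assert (Ek : RtoC k = (p + / p)%C) by (unfold k; now rewrite RtoC_plus, RtoC_inv by lra).
  assert (Eden : forall z, den z = (1 - k * z + z * z)%C) by (intros z; unfold den; rewrite Ek; field; exact Pn).
  assert (Enum : forall z, (k * num z + den z)%C = (1 - c * (z * z))%C).
  { intros z. unfold num, den. rewrite Ek. field. auto. }
  assert (Up : Cmod p < 1) by (rewrite Cmod_R, Rabs_pos_eq; lra).
  assert (Denp : den p = 0) by (unfold den; field; exact Pn).
  assert (kn : RtoC k <> RtoC 0) by (apply RtoC_pos_neq; lra).
  assert (Nump : num p <> 0).
  { intros E. assert (Q := Enum p). rewrite E, Denp in Q.
    assert (A : Cmod (c * (p * p)) < 1).
    { rewrite !Cmod_mult, Cmod_R, Rabs_pos_eq by lra. assert (T := Cmod_ge_0 c). nra. }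
    replace (c * (p * p))%C with (1 - (1 - c * (p * p)))%C in A by ring.
    rewrite <- Q in A. replace (1 - (k * 0 + 0))%C with (RtoC 1) in A by ring. rewrite Cmod_1 in A. lra. }
  assert (Fin : forall z, Cmod z < 1 -> z <> RtoC p -> den z <> 0 /\ f z = Some (num z / den z)%C)
    by (intros; now apply ellipse_map_finite).
  assert (Fp : f p = None) by now apply ellipse_map_pole.
  assert (Cnum : forall z, cdiff num z).
  { intros z. apply cdiff_minus; [apply cdiff_id|].
    apply cdiff_mult; [apply cdiff_const|apply cdiff_pow, cdiff_id]. }
  assert (Cden : forall z, cdiff den z).
  { intros z. apply cdiff_mult; apply cdiff_minus; try apply cdiff_const.
    - apply cdiff_div; [apply cdiff_id|apply cdiff_const|exact Pn].
    - apply cdiff_mult; [apply cdiff_id|apply cdiff_const]. }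
  assert (Pole : pole_at 1 f p).
  { split; [lia|]. split; [exact Fp|].
    exists (fun z => (- p * num z / (1 - z * p))%C), (1 - p). split; [lra|].
    assert (Dp := pole_factor_neq p p Hp Up). split.
    { intros E. apply Nump.
      replace (num p) with (- p * num p / (1 - p * p) * (- (1 - p * p) / p))%C by (field; auto).
      rewrite E. ring. }
    intros z Hz.
    assert (Hz1 : Cmod z < 1).
    { assert (T := Cmod_triangle_rev z p). rewrite (Cmod_R p), Rabs_pos_eq in T; lra. }
    split.
    - apply cdiff_iff. apply cdiff_div; [| |now apply pole_factor_neq].
      + apply cdiff_mult; [apply cdiff_const|apply Cnum].
      + apply cdiff_minus; [apply cdiff_const|apply cdiff_mult; [apply cdiff_id|apply cdiff_const]].
    - intros Hn. destruct (Fin z Hz1 Hn) as [D E]. rewrite E. f_equal. unfold den in *. simpl.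
      assert (D2 := pole_factor_neq p z Hp Hz1). assert (D3 := Csub_neq_0 _ _ Hn).
      field. repeat split; auto.
      intros E3. apply D3. replace (z - p)%C with (- (p - z))%C by ring. rewrite E3. ring. }
  assert (Sol : forall z u, Cmod z < 1 -> (f z = Some u <-> ((1 + k * u) * (1 - k * z + z * z) = 1 - c * (z * z))%C)).
  { intros z u Hz. rewrite <- Eden, <- Enum.
    assert (Lin : ((1 + k * u) * den z = k * num z + den z)%C <-> num z = (u * den z)%C).
    { split; intros E.
      - replace (num z) with ((k * num z + den z - den z) / k)%C by (field; exact kn).
        rewrite <- E. field. exact kn.
      - rewrite E. ring. }
    rewrite Lin. destruct (classic (z = p)) as [->|Hn].
    - rewrite Fp, Denp. split; [discriminate|]. intros E. exfalso. apply Nump. rewrite E. ring.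
    - destruct (Fin z Hz Hn) as [D E]. rewrite E. split; intros Q.
      + apply Some_C_inj in Q. rewrite <- Q. field. exact D.
      + f_equal. rewrite Q. field. exact D. }
  split; [|split; [exact Pole|split; [|split; [|split]]]].
  - intros z Hz. destruct (classic (z = p)) as [->|Hn]; [right; now exists 1%nat|left].
    assert (D0 := Cmod_diff_neq _ _ Hn).
    exists (fun z => num z / den z)%C, (Rmin (1 - Cmod z) (Cmod (z - p))). split.
    { apply Rmin_glb_lt; [unfold unit_disc in Hz; lra|exact D0]. }
    intros y Hy.
    assert (Y1 := Rlt_le_trans _ _ _ Hy (Rmin_l _ _)). assert (Y2 := Rlt_le_trans _ _ _ Hy (Rmin_r _ _)).
    assert (Yd : Cmod y < 1) by (assert (T := Cmod_triangle_rev y z); lra).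
    assert (Yn : y <> RtoC p) by (intros ->; rewrite Cmod_sub_sym in Y2; lra).
    destruct (Fin y Yd Yn) as [D E]. split; [|exact E].
    apply cdiff_iff. now apply cdiff_div.
  - destruct (Fin 0) as [D E]; [rewrite Cmod_0; lra|auto|]. rewrite E. f_equal.
    unfold num, den in *. field. auto.
  - apply is_derive_cderiv.
    apply cderiv_ext_near with (fun z => num z / den z)%C p; [lra| |].
    + intros y Hy. replace (y - 0)%C with y in Hy by ring.
      assert (Yn : y <> RtoC p) by (intros ->; rewrite Cmod_R, Rabs_pos_eq in Hy; lra).
      destruct (Fin y ltac:(lra) Yn) as [_ E]. unfold finite_part. now rewrite E.
    + assert (D0 : den 0 <> 0) by (rewrite Eden; replace (1 - k * 0 + 0 * 0)%C with (RtoC 1) by ring;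
                                   apply Cmod_pos_neq; rewrite Cmod_1; lra).
      assert (Dn : cderiv num 0 1).
      { eapply cderiv_eq; [|apply cderiv_minus; [apply cderiv_id|apply cderiv_mult; [apply cderiv_const|]]].
        2:{ apply (cderiv_ext (fun y => y * y)%C); [intros; simpl; ring|].
            apply cderiv_mult; apply cderiv_id. }
        cbv beta. simpl. ring. }
      destruct (Cden 0) as [l Hl].
      eapply cderiv_eq; [|apply cderiv_div; [exact Dn|exact Hl|exact D0]].
      rewrite Eden. unfold num. generalize (p / (1 + p ^ 2) * (1 + c))%C. intros b. simpl. field.
  - intros z w Hz Hw E.
    destruct (classic (w = p)) as [Ew|Nw].
    + destruct (classic (z = p)) as [Ez|Nz]; [congruence|].
      destruct (Fin z Hz Nz) as [_ Q]. rewrite Q, Ew, Fp in E. discriminate.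
    + destruct (Fin w Hw Nw) as [_ Q]. rewrite Q in E.
      assert (S1 := proj1 (Sol z _ Hz) E). assert (S2 := proj1 (Sol w _ Hw) Q).
      set (u := (1 + k * (num w / den w))%C) in *.
      assert (T := two_point_nonzero k c z w Hk Hc Hz Hw).
      assert (Cr : ((1 - c * (z * z)) * (1 - k * w + w * w) = (1 - c * (w * w)) * (1 - k * z + z * z))%C)
        by (rewrite <- S1, <- S2; ring).
      assert (Z : ((z - w) * (k - (z + w) + c * (k * (z * w) - (z + w))))%C = 0).
      { replace ((z - w) * (k - (z + w) + c * (k * (z * w) - (z + w))))%C
          with ((1 - c * (z * z)) * (1 - k * w + w * w) - (1 - c * (w * w)) * (1 - k * z + z * z))%C by ring.
        rewrite Cr. ring. }
      apply NNPP. intros Hne. apply (Cmult_neq_0 (z - w) _ (Csub_neq_0 _ _ Hne) T). exact Z.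
  - exists (fun u => exists v, k * Cmod v <= 1 - 2 * Re v /\ (1 + k * u)%C = (Cconj v - c * v)%C).
    split.
    + intros u1 u2 t [v1 [V1 E1]] [v2 [V2 E2]] Ht.
      exists (t * v1 + (1 - t) * v2)%C. split; [now apply ellipse_convex; [lra| | |]|].
      replace (1 + k * (t * u1 + (1 - t) * u2))%C
        with (t * (1 + k * u1) + (1 - t) * (1 + k * u2))%C by ring.
      rewrite E1, E2. destruct c as [c1 c2], v1 as [x1 y1], v2 as [x2 y2].
      unfold Cconj, Cmult, Cminus, Cplus, Copp, RtoC. simpl. f_equal; ring.
    + intros [u|].
      * split.
        -- intros Ho. exists u. split; [|reflexivity].
           apply omitted_in_ellipse; [exact Hk|exact Hc|]. intros z Hz E.
           apply Ho. exists z. split; [exact Hz|]. now apply Sol.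
        -- intros [u' [[v [Hv Ev]] Eu]] [z [Hz Ez]]. apply Some_C_inj in Eu. subst u'.
           apply (Sol z u Hz) in Ez. rewrite Ev in Ez.
           now apply (ellipse_omitted k c v z).
      * split.
        -- intros Ho. exfalso. apply Ho. now exists (RtoC p).
        -- intros [u' [_ Eu]]. discriminate.
Qed.

(** * The domain of variability *)

(** The two normalizations at the point [0 = moebius p (- p)], and the first
    Laurent coefficient, in terms of the numerator. *)
Lemma Co_data (p : R) (f : C -> sphere) :
  0 < p < 1 -> Co p f ->
  exists N N1 N2 : C -> C,
    concave_numerator N /\
    (forall w, Cmod w < 1 -> cderiv N w (N1 w)) /\
    (forall w, Cmod w < 1 -> cderiv N1 w (N2 w) /\ cdiff N2 w) /\
    N (- p)%R = 0 /\ ((N (- p)%R + p * N1 (- p)%R) * (1 - p * p) = - (p * p))%C /\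
    laurent_coeff p f 1 = (N2 0 / (2 * (1 - p * p)))%C /\
    f p = None /\
    forall z, Cmod z < 1 -> z <> RtoC p -> f z = Some (N (moebius (- p) z) / moebius (- p) z)%C.
Proof.
  intros Hp Hco.
  destruct (Co_numerator p f Hp Hco) as [J [HJ [Jp [Np Hf]]]].
  assert (HN := shifted_numerator_concave p f J Hp Hco HJ Jp Np Hf).
  assert (Val := shifted_value p f J).
  assert (HNJ : forall z, shifted_numerator p J z = ((1 + p * z) / (1 - p * p) * J (moebius p z))%C)
    by reflexivity.
  set (N := shifted_numerator p J) in *.
  destruct (derivative_on_open_disc N 1 ltac:(lra) (cn_diff N HN)) as [N1 H1].
  destruct (derivative_on_open_disc N1 1 ltac:(lra) (fun w Hw => proj2 (H1 w Hw))) as [N2 H2].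
  assert (Pn : RtoC p <> RtoC 0) by (apply RtoC_pos_neq; lra).
  assert (E := one_minus_sqr_neq p Hp).
  assert (Mp : Cmod (RtoC (- p)) = p) by (rewrite Cmod_R, Rabs_Ropp, Rabs_pos_eq; lra).
  assert (M0 : Cmod 0 < 1) by (rewrite Cmod_0; lra).
  assert (Inv : forall z, Cmod z < 1 -> Cmod (moebius (- p) z) < 1) by (intros; apply moebius_disc; lra).
  assert (Inv2 : forall z, Cmod z < 1 -> moebius p (moebius (- p) z) = z) by (intros; apply moebius_inv; lra).
  assert (Z0 : forall z, Cmod z < 1 -> z <> RtoC p -> moebius (- p) z <> 0).
  { intros z Hz Hn Q. apply Hn. rewrite <- (Inv2 z Hz), Q. unfold moebius. field. }
  assert (Fz : forall z, Cmod z < 1 -> z <> RtoC p -> f z = Some (N (moebius (- p) z) / moebius (- p) z)%C).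
  { intros z Hz Hn. rewrite <- (Inv2 z Hz) at 1. apply Val; auto. }
  assert (S0 : moebius (- p) 0 = RtoC (- p)) by (unfold moebius; rewrite RtoC_opp; field).
  destruct Hco as [_ [_ [F0 [D0 _]]]].
  assert (Np0 : N (RtoC (- p)) = 0).
  { rewrite Fz in F0; [|exact M0|auto]. apply Some_C_inj in F0. rewrite S0 in F0.
    replace (N (RtoC (- p))) with (N (RtoC (- p)) / RtoC (- p) * RtoC (- p))%C
      by (field; rewrite RtoC_opp; intros Q; apply Pn; replace (RtoC p) with (- - p)%C by ring; rewrite Q; ring).
    rewrite F0. ring. }
  exists N, N1, N2. split; [exact HN|]. split; [intros; now apply H1|]. split; [exact H2|].
  split; [exact Np0|]. split; [|split; [|split; [exact Np|exact Fz]]].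
  - apply is_derive_cderiv in D0.
    assert (Q : ((N1 (RtoC (- p)) * (1 - p * p) * RtoC (- p) - N (RtoC (- p)) * (1 - p * p)) / (RtoC (- p) * RtoC (- p)))%C = 1).
    { apply (cderiv_unique (finite_part f) 0); [|exact D0].
      apply cderiv_ext_near with (fun z => N (moebius (- p) z) / moebius (- p) z)%C p; [lra| |].
      - intros y Hy. replace (y - 0)%C with y in Hy by ring.
        assert (Hn : y <> RtoC p) by (intros ->; rewrite Cmod_R, Rabs_pos_eq in Hy; lra).
        unfold finite_part. rewrite Fz; [reflexivity|lra|exact Hn].
      - assert (Dm : cderiv (moebius (- p)) 0 (1 - p * p)).
        { eapply cderiv_eq; [|apply cderiv_moebius; [lra|exact M0]]. rewrite RtoC_opp. field. }
        eapply cderiv_eq; [|apply cderiv_div; [|exact Dm|]].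
        2:{ apply (cderiv_comp N (moebius (- p))); [exact Dm|]. apply H1. rewrite S0, Mp. lra. }
        + cbv beta. rewrite S0. reflexivity.
        + apply Z0; [exact M0|auto]. }
    rewrite Np0 in *. rewrite RtoC_opp in *.
    replace ((0 + p * N1 (- p)) * (1 - p * p))%C
      with (- (p * p) * ((N1 (- p) * (1 - p * p) * - p - 0 * (1 - p * p)) / (- p * - p)))%C by (field; exact Pn).
    rewrite Q. ring.
  - destruct (second_order_quotient N N1 (N2 0) (1/2)) as [q [Hq [Dq Eq]]].
    + lra.
    + intros v Hv. apply H1. lra.
    + apply H2, M0.
    + (* [J (p + h) = (1 - p (p + h)) N (zeta)] with [zeta = h / (1 - p (p + h))] *)
      set (w := fun h => (1 - p * p - p * h)%C).
      assert (W0 : w 0 = (1 - p * p)%C) by (unfold w; ring).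
      assert (Cw : ccont w 0).
      { apply ccont_minus; [apply ccont_const|apply ccont_mult; [apply ccont_const|apply ccont_id]]. }
      assert (C2 : ccont (fun h => q (h / w h) / w h)%C 0).
      { apply ccont_div; [|exact Cw|rewrite W0; exact E].
        apply (ccont_comp q (fun h => h / w h)%C).
        - apply ccont_div; [apply ccont_id|exact Cw|rewrite W0; exact E].
        - replace (0 / w 0)%C with (RtoC 0) by (unfold Cdiv; ring).
          apply cdiff_cont, Dq. rewrite Cmod_0. lra. }
      rewrite (laurent_coeff_1 p f J (N 0 * (1 - p * p))%C (N1 0 - p * N 0)%C
                 (fun h => q (h / w h) / w h)%C (1 - p) Hp HJ Hf); [|lra|exact C2|].
      * rewrite W0. replace (0 / (1 - p * p))%C with (RtoC 0) by (unfold Cdiv; ring).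
        rewrite Eq. field. exact E.
      * intros h Hh.
        assert (Hz : Cmod (p + h) < 1).
        { assert (T := Cmod_triangle p h). rewrite (Cmod_R p), Rabs_pos_eq in T by lra. lra. }
        assert (D := moebius_den (- p) (p + h)%C ltac:(lra) Hz).
        assert (Ew : w h = (1 + RtoC (- p) * (p + h))%C) by (unfold w; rewrite RtoC_opp; ring).
        assert (Wn : w h <> 0) by (rewrite Ew; exact D).
        assert (Es : moebius (- p) (p + h)%C = (h / w h)%C).
        { unfold moebius. rewrite Ew. f_equal. rewrite RtoC_opp. ring. }
        assert (EJ : J (p + h)%C = (w h * N (h / w h))%C).
        { rewrite HNJ, <- Es, Inv2 by exact Hz. rewrite Es.
          unfold w in Wn |- *. field. split; [exact Wn|exact E]. }
        rewrite EJ, (Hq (h / w h)%C).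
        replace (N 0 * (1 - p * p) + (N1 0 - p * N 0) * h)%C with (N 0 * w h + N1 0 * h)%C by (unfold w; ring).
        field. exact Wn.
Qed.

Lemma unit_Cexpi (c : C) : Cmod c = 1 -> exists t, 0 <= t <= 2 * PI /\ c = Cexpi t.
Proof.
  intros Hc. assert (S := Cmod_sqr c). rewrite Hc in S. destruct c as [x y].
  unfold Re, Im in S. simpl in S.
  assert (Hx : -1 <= x <= 1) by nra. assert (B := acos_bound x). assert (P := PI_RGT_0).
  assert (Sq : sin (acos x) * sin (acos x) = y * y).
  { assert (T := sin2_cos2 (acos x)). unfold Rsqr in T. rewrite cos_acos in T by exact Hx. lra. }
  assert (Sp : 0 <= sin (acos x)) by (apply sin_ge_0; lra).
  destruct (Rle_dec 0 y) as [Hy|Hy].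
  - exists (acos x). split; [lra|]. unfold Cexpi. rewrite cos_acos by exact Hx. f_equal. nra.
  - exists (2 * PI - acos x). split; [lra|]. unfold Cexpi.
    replace (2 * PI - acos x) with (- acos x + 2 * INR 1 * PI) by (simpl; ring).
    rewrite cos_period, sin_period, cos_neg, sin_neg, cos_acos by exact Hx. f_equal. nra.
Qed.

(** [|q u - x|^2 - |u - q x|^2 = (1 - q^2) (|x|^2 - |u|^2)]. *)
Lemma disc_quotient_iff (q : R) (u x : C) :
  0 <= q < 1 ->
  (Cmod (q * u - x) <= Cmod (u - q * x) <-> Cmod x <= Cmod u) /\
  (Cmod (q * u - x) = Cmod (u - q * x) <-> Cmod u = Cmod x).
Proof.
  intros Hq.
  assert (D : Cmod (u - q * x) ^ 2 - Cmod (q * u - x) ^ 2 = (1 - q * q) * (Cmod u ^ 2 - Cmod x ^ 2)).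
  { rewrite !Cmod_sqr. destruct u as [u1 u2], x as [x1 x2]. unfold Re, Im. simpl. ring. }
  assert (Q : 0 < 1 - q * q) by nra.
  assert (A := Cmod_ge_0 (q * u - x)). assert (B := Cmod_ge_0 (u - q * x)).
  assert (U := Cmod_ge_0 u). assert (X := Cmod_ge_0 x).
  set (a := Cmod (q * u - x)) in *. set (b := Cmod (u - q * x)) in *.
  set (s := Cmod u) in *. set (t := Cmod x) in *.
  assert (L1 : a <= b <-> t <= s).
  { split; intros H; apply Rnot_lt_le; intros Hl.
    - assert (a ^ 2 <= b ^ 2) by (apply pow_incr; lra). assert (s ^ 2 < t ^ 2) by (simpl; nra). nra.
    - assert (b ^ 2 < a ^ 2) by (simpl; nra). assert (t ^ 2 <= s ^ 2) by (apply pow_incr; lra). nra. }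
  split; [exact L1|]. split; intros H.
  - rewrite H in D. assert (E : s ^ 2 = t ^ 2) by nra. simpl in E. nra.
  - rewrite H in D. assert (E : b ^ 2 = a ^ 2) by lra. simpl in E. nra.
Qed.

Lemma ellipse_map_coeff (p : R) (c : C) (f : C -> sphere) :
  0 < p < 1 -> Co p f -> (forall z, Cmod z < 1 -> f z = ellipse_map p c z) ->
  (laurent_coeff p f 1 * ((1 - p ^ 2) / p) ^ 2 + p ^ 2 / (1 - p ^ 4))%C = (c / (1 - p ^ 4))%C.
Proof.
  intros Hp Hco Hf.
  destruct (Co_numerator p f Hp Hco) as [J [HJ [_ [_ HfJ]]]].
  assert (Pn := RtoC_pos_neq p (proj1 Hp)).
  assert (E := one_minus_sqr_neq p Hp).
  assert (E4 : (1 + p * p)%C <> 0).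
  { rewrite <- RtoC_mult, <- RtoC_plus. apply RtoC_pos_neq. nra. }
  set (w := fun h => (1 - p * p - p * h)%C).
  set (K := (p * p * (c - p * p) / ((1 - p * p) * ((1 - p * p) * (1 + p * p))))%C).
  assert (W0 : w 0 = (1 - p * p)%C) by (unfold w; ring).
  assert (L : laurent_coeff p f 1 = (K / w 0)%C).
  { (* the numerator is [a + b z + a x z^2] with [x = (p^2 - c) / (1 - p^2 c)]; in the
       variable [h] this gives [(z - p) f = a w + b h + a x h^2 / w], and [K = a x] *)
    apply (laurent_coeff_1 p f J
      (- (p * p) * (1 - p * p * c) / ((1 - p * p) * (1 + p * p)))%C
      ((p * p * p * (1 - p * p * c) - p * (1 + p * p * p * p - 2 * (p * p) * c))
         / ((1 - p * p) * ((1 - p * p) * (1 + p * p))))%C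
      (fun h => K / w h)%C (1 - p) Hp HJ HfJ).
    - lra.
    - apply ccont_div; [apply ccont_const| |rewrite W0; exact E].
      apply ccont_minus; [apply ccont_const|apply ccont_mult; [apply ccont_const|apply ccont_id]].
    - intros h Hh. assert (H0 : h <> 0) by (apply Cmod_pos_neq; lra).
      set (z := (p + h)%C).
      assert (Hz : Cmod z < 1).
      { unfold z. assert (T := Cmod_triangle p h). rewrite (Cmod_R p), Rabs_pos_eq in T by lra. lra. }
      assert (Hn : z <> RtoC p).
      { intros Q. apply H0. replace h with (z - p)%C by (unfold z; ring). rewrite Q. ring. }
      assert (V := HfJ z Hz Hn). rewrite (Hf z Hz) in V.
      destruct (ellipse_map_finite p c z Hp Hz Hn) as [D V2]. rewrite V2 in V. apply Some_C_inj in V.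
      assert (Zn := Csub_neq_0 _ _ Hn).
      replace (J z) with (J z / (z - p) * (z - p))%C by (field; exact Zn).
      rewrite <- V. assert (D2 := pole_factor_neq p z Hp Hz).
      assert (Ew : w h = (1 - z * p)%C) by (unfold w, z; ring).
      assert (Eh : h = (z - p)%C) by (unfold z; ring).
      assert (E5 : (1 + p ^ 2)%C <> 0) by (simpl; rewrite Cmult_1_r; exact E4).
      rewrite Ew. clearbody z. subst h. unfold K. field.
      repeat split; auto.
      intros Q. apply Zn. replace (z - p)%C with (- (p - z))%C by ring. rewrite Q. ring. }
  rewrite L, W0. unfold K.
  assert (E6 : (1 - p ^ 4)%C <> 0).
  { replace (1 - p ^ 4)%C with ((1 - p * p) * (1 + p * p))%C by (simpl; ring). now apply Cmult_neq_0. }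
  field. repeat split; auto.
Qed.

Theorem theorem4 (p : R) (hp : 0 < p <= 1 - sqrt 2 / 2) :
  (forall w : C,
     (exists f : C -> sphere, Co p f /\ w = laurent_coeff p f 1) <->
     Cmod (w * ((1 - p ^ 2) / p) ^ 2 + p ^ 2 / (1 - p ^ 4))%C
       <= 1 / (1 - p ^ 4))
  /\
  (forall f : C -> sphere, Co p f ->
     (Cmod (laurent_coeff p f 1 * ((1 - p ^ 2) / p) ^ 2
            + p ^ 2 / (1 - p ^ 4))%C = 1 / (1 - p ^ 4)
      <->
      exists theta : R, 0 <= theta <= 2 * PI /\
        forall z : C, unit_disc z ->
          f z = sphere_div
                  (z - p / (1 + p ^ 2) * (1 + Cexpi theta) * z ^ 2)%C
                  ((1 - z / p) * (1 - z * p))%C)).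
Proof.
  assert (Hp3 : 0 < p <= 3 / 10).
  { assert (S : 7 / 5 <= sqrt 2).
    { rewrite <- (sqrt_Rsqr (7/5)) by lra. apply sqrt_le_1; unfold Rsqr; lra. }
    lra. }
  assert (Hp : 0 < p < 1) by lra.
  assert (Pn := RtoC_pos_neq p (proj1 Hp)).
  assert (E := one_minus_sqr_neq p Hp).
  assert (Q4 : 0 < 1 - p ^ 4).
  { assert (0 < p * p < 1) by nra. replace (p ^ 4) with (p * p * (p * p)) by ring. nra. }
  assert (R4 : (1 - p ^ 4)%C = RtoC (1 - p ^ 4)) by (now rewrite RtoC_minus, RtoC_pow).
  assert (N4 : (1 - p ^ 4)%C <> 0) by (rewrite R4; now apply RtoC_pos_neq).
  assert (Div : forall d, Cmod (d / (1 - p ^ 4)) = Cmod d / (1 - p ^ 4)).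
  { intros d. rewrite Cmod_div by exact N4. rewrite R4, Cmod_R, Rabs_pos_eq by lra. reflexivity. }
  assert (Low : forall d, Cmod (d / (1 - p ^ 4)) <= 1 / (1 - p ^ 4) <-> Cmod d <= 1).
  { intros d. rewrite Div. unfold Rdiv. split; intros H.
    - apply Rmult_le_reg_r in H; [exact H|now apply Rinv_0_lt_compat].
    - apply Rmult_le_compat_r; [left; now apply Rinv_0_lt_compat|exact H]. }
  assert (Main : forall f, Co p f -> exists d,
    (laurent_coeff p f 1 * ((1 - p ^ 2) / p) ^ 2 + p ^ 2 / (1 - p ^ 4))%C = (d / (1 - p ^ 4))%C /\
    Cmod d <= 1 /\
    (Cmod d = 1 -> forall z, Cmod z < 1 -> f z = ellipse_map p d z)).
  { intros f Hco.
    destruct (Co_data p f Hp Hco) as [N [N1 [N2 [HN [HN1 [HN2 [Np [Dp [L [Fp Fz]]]]]]]]]].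
    destruct (concave_coefficient_inequality N N1 N2 p HN HN1 HN2 Hp3) as [X1 [Ineq [Eq Ext]]].
    set (a := N 0) in *. assert (Ha : a <> 0) by apply (cn_pole N HN).
    set (x := (N2 0 / (2 * a))%C) in *.
    set (H := ((N (RtoC (- p)) + p * N1 (RtoC (- p))) / a)%C) in *.
    assert (N22 := RtoC_pos_neq 2 ltac:(lra)).
    assert (EH : (a * H * (1 - p * p) = - (p * p))%C).
    { rewrite <- Dp. unfold H. field. exact Ha. }
    assert (Hn : H <> 0).
    { intros Z. rewrite Z in EH. apply (Cmult_neq_0 p p Pn Pn).
      replace (p * p)%C with (- - (p * p))%C by ring. rewrite <- EH. ring. }
    set (u := (H + p * p * x)%C) in *.
    assert (Hu : H = (u - RtoC (p * p) * x)%C) by (unfold u; rewrite RtoC_mult; ring).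
    exists ((RtoC (p * p) * u - x) / (u - RtoC (p * p) * x))%C.
    destruct (disc_quotient_iff (p * p) u x ltac:(nra)) as [I1 I2].
    assert (Hp0 := proj1 (Cmod_gt_0 H) Hn).
    assert (Qm : Cmod ((RtoC (p * p) * u - x) / (u - RtoC (p * p) * x))
                 = Cmod (RtoC (p * p) * u - x) / Cmod (u - RtoC (p * p) * x))
      by (rewrite Cmod_div; [reflexivity|rewrite <- Hu; exact Hn]).
    rewrite Qm. split; [|split].
    - rewrite <- Hu.
      assert (Ea : a = (- (p * p) / (H * (1 - p * p)))%C) by (rewrite <- EH; field; auto).
      assert (EN : N2 0 = (2 * a * x)%C) by (unfold x; field; auto).
      rewrite L, EN, Ea. unfold u. rewrite RtoC_mult.
      replace (1 - p ^ 4)%C with ((1 - p * p) * (1 + p * p))%C by (simpl; ring).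
      field. repeat split; auto.
      intros Z. apply N4. replace (1 - p ^ 4)%C with ((1 - p * p) * (1 + p * p))%C by (simpl; ring).
      rewrite Z. ring.
    - rewrite <- Hu in *. apply Rmult_le_reg_r with (Cmod H); [exact Hp0|].
      unfold Rdiv. rewrite Rmult_assoc, Rinv_l, Rmult_1_r, Rmult_1_l by lra. now apply I1.
    - intros Qe.
      assert (Me : Cmod (RtoC (p * p) * u - x) = Cmod (u - RtoC (p * p) * x)).
      { rewrite <- Hu in *. replace (Cmod (RtoC (p * p) * u - x)) with
          (Cmod (RtoC (p * p) * u - x) / Cmod H * Cmod H) by (field; lra). rewrite Qe. ring. }
      assert (X2 : Cmod x = 1) by (apply Eq, I2, Me).
      assert (EN := Ext X2).
      assert (Mp : Cmod (RtoC (- p)) = p) by (rewrite Cmod_R, Rabs_Ropp, Rabs_pos_eq; lra).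
      assert (D1 : N1 (RtoC (- p)) = (N1 0 + 2 * a * x * RtoC (- p))%C).
      { apply (cderiv_unique N (RtoC (- p))); [apply HN1; lra|].
        apply cderiv_ext_near with (fun z => a + N1 0 * z + a * x * (z * z))%C (1 - p); [lra| |].
        - intros y Hy. symmetry. apply EN.
          assert (T := Cmod_triangle_rev y (RtoC (- p))). lra.
        - eapply cderiv_eq; [|apply cderiv_plus; [apply cderiv_plus; [apply cderiv_const|
            apply cderiv_mult; [apply cderiv_const|apply cderiv_id]]|
            apply cderiv_mult; [apply cderiv_const|apply cderiv_mult; apply cderiv_id]]].
          cbv beta. ring. }
      assert (Nm := EN (RtoC (- p)) ltac:(lra)).
      assert (n1 : N1 0 = ((a + a * x * (p * p)) / p)%C).
      { rewrite Np in Nm. rewrite RtoC_opp in Nm.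
        replace (N1 0) with ((a + a * x * (p * p) - (a + N1 0 * - p + a * x * (- p * - p))) / p)%C
          by (field; exact Pn). rewrite <- Nm. field. exact Pn. }
      assert (H1 : H = (1 - p * p * x)%C).
      { unfold H. rewrite D1, Np, n1, RtoC_opp. field. auto. }
      intros z Hz. destruct (classic (z = p)) as [->|Hz0].
      { rewrite Fp. symmetry. now apply ellipse_map_pole. }
      rewrite (Fz z Hz Hz0).
      destruct (ellipse_map_finite p ((RtoC (p * p) * u - x) / (u - RtoC (p * p) * x)) z Hp Hz Hz0) as [_ V].
      rewrite V. f_equal. rewrite <- Hu.
      assert (D := moebius_den (- p) z ltac:(lra) Hz).
      assert (Dm := Csub_neq_0 _ _ Hz0).
      rewrite EN by (apply moebius_disc; [lra|exact Hz]).
      rewrite n1.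
      assert (Ea : a = (- (p * p) / (H * (1 - p * p)))%C) by (rewrite <- EH; field; auto).
      unfold u. rewrite Ea, H1, RtoC_mult. rewrite H1 in Hn. unfold moebius. rewrite RtoC_opp in *.
      assert (D2 := pole_factor_neq p z Hp Hz).
      assert (P2 : (1 + p * p)%C <> 0).
      { rewrite <- RtoC_mult, <- RtoC_plus. apply RtoC_pos_neq. nra. }
      simpl. field.
      repeat split; auto.
      intros Z. apply Dm. replace (z - p)%C with (- (p - z))%C by ring. rewrite Z. ring. }
  split.
  - intros w. split.
    + intros [f [Hco ->]]. destruct (Main f Hco) as [d [Ed [Hd _]]]. rewrite Ed. now apply Low.
    + intros Hw.
      set (d := ((w * ((1 - p ^ 2) / p) ^ 2 + p ^ 2 / (1 - p ^ 4)) * (1 - p ^ 4))%C).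
      assert (Ed : (w * ((1 - p ^ 2) / p) ^ 2 + p ^ 2 / (1 - p ^ 4))%C = (d / (1 - p ^ 4))%C)
        by (unfold d; field; auto).
      rewrite Ed in Hw. apply Low in Hw.
      assert (Hco := ellipse_map_Co p d Hp Hw).
      exists (ellipse_map p d). split; [exact Hco|].
      assert (L := ellipse_map_coeff p d _ Hp Hco (fun z _ => eq_refl)).
      rewrite <- Ed in L. set (m := laurent_coeff p (ellipse_map p d) 1) in *.
      assert (E2 : (1 - p ^ 2)%C <> 0) by (simpl; rewrite Cmult_1_r; exact E).
      replace w with ((w * ((1 - p ^ 2) / p) ^ 2 + p ^ 2 / (1 - p ^ 4) - p ^ 2 / (1 - p ^ 4))
                      * (p / (1 - p ^ 2)) ^ 2)%C by (field; auto).
      rewrite <- L. field. auto.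
  - intros f Hco. split.
    + intros He. destruct (Main f Hco) as [d [Ed [_ Hd]]]. rewrite Ed, Div in He.
      assert (D1 : Cmod d = 1).
      { apply Rmult_eq_reg_r with (/ (1 - p ^ 4)); [exact He|]. apply Rinv_neq_0_compat. lra. }
      destruct (unit_Cexpi d D1) as [t [Ht Et]]. exists t. split; [exact Ht|].
      intros z Hz. rewrite (Hd D1 z Hz), <- Et. reflexivity.
    + intros [t [_ Hf]].
      rewrite (ellipse_map_coeff p (Cexpi t) f Hp Hco Hf), Div, Cmod_Cexpi. reflexivity.
Qed.
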